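(* Let $R_0:=\sqrt[3]{9(a+2)}\,e^{(3e)^{-1}}$ and let $R_1,R_2\in(R_0,+\infty)$. Then for any $u_1\in\mathcal R_{R_1,R_2}$ there exists a control input $h\in G^{1,2}([0,1]\times[0,T])$ such that the solution $u$ of the system $$\begin{aligned} &u_t+u_{xxx}+u_{xyy}+au_x=0, && (x,y)\in\Omega,\ t\in(0,T),\\ &u(0,y,t)=u_x(0,y,t)=0, && y\in(0,1),\ t\in(0,T),\\ &u(-1,y,t)=h(y,t), && y\in(0,1),\ t\in(0,T),\\ &u(x,0,t)=u(x,1,t)=0, && x\in(-1,0),\ t\in(0,T),\\ &u(x,y,0)=0, && (x,y)\in\Omega, \end{aligned}$$ satisfies $u(\cdot,\cdot,T)=u_1$. Furthermore, $u\in G^{1,1,2}([-1,0]\times[0,1]\times[0,T])$, and the trajectory $u$ and the control $h$ can be expanded as series, for some functions $z_j\in C^\infty([0,T])$, $j\ge1$: $$u(x,y,t)=\sum_{j=1}^\infty\sum_{i=0}^\infty g_{i,j}(x)z_j^{(i)}(t)e_j(y),\qquad h(y,t)=\sum_{j=1}^\infty\sum_{i=0}^\infty g_{i,j}(-1)z_j^{(i)}(t)e_j(y).$$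
   Context: $a>0$ is a given constant, $T>0$ is a given time, and $\Omega=(-1,0)\times(0,1)$; $0\in\mathbb N$. Let $Pu:=\Delta u_x+au_x=u_{xxx}+u_{xyy}+au_x$. The space $\mathcal R_{R_1,R_2}$ is the set of all $u\in C^\infty([-1,0]\times[0,1])$ such that there exists $C>0$ with $$|\partial_x^p\partial_y^q u(x,y)|\le C\frac{(p!)^{2/3}(q!)^{2/3}}{R_1^pR_2^q}\qquad\forall p,q\in\mathbb N,\ \forall(x,y)\in\overline\Omega,$$ and such that $P^nu(0,y)=\partial_xP^nu(0,y)=P^nu(x,0)=P^nu(x,1)=0$ for all $n\in\mathbb N$, $x\in[-1,0]$, $y\in[0,1]$. For $j\ge1$ let $e_j(y)=\sqrt2\sin(j\pi y)$ and $\lambda_j=(j\pi)^2$. The generating functions $g_{i,j}$ on $[-1,0]$ are defined as follows: $g_{0,j}$ solves $g_{0,j}'''-(\lambda_j-a)g_{0,j}'=0$ with $g_{0,j}(0)=g_{0,j}'(0)=0$, $g_{0,j}''(0)=1$; and for $i\ge1$, $g_{i,j}$ solves $g_{i,j}'''-(\lambda_j-a)g_{i,j}'=-g_{i-1,j}$ with $g_{i,j}(0)=g_{i,j}'(0)=g_{i,j}''(0)=0$. Gevrey classes: a function $u\in C^\infty([x_1,x_2]\times[y_1,y_2]\times[t_1,t_2])$ belongs to $G^{s_1,s_2,s_3}([x_1,x_2]\times[y_1,y_2]\times[t_1,t_2])$ if there exist constants $C,\rho_1,\rho_2,\rho_3>0$ such that $$|\partial_x^{n_1}\partial_y^{n_2}\partial_t^{n_3}u(x,y,t)|\le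 C\frac{(n_1!)^{s_1}(n_2!)^{s_2}(n_3!)^{s_3}}{\rho_1^{n_1}\rho_2^{n_2}\rho_3^{n_3}}$$ for all $n_1,n_2,n_3\in\mathbb N$ and all $(x,y,t)$ in the box. The class $G^{s_2,s_3}([y_1,y_2]\times[t_1,t_2])$ of functions of $(y,t)$ is defined analogously. *)

(* Defs.v *)
From Stdlib Require Import Reals Factorial.
From Coquelicot Require Import Coquelicot.
Open Scope R_scope.

(* A pair (a, b) stands for the closed interval [a, b]. *)
Definition itv : Type := (R * R)%type.
Definition in_itv (I : itv) (x : R) : Prop := fst I <= x <= snd I.
Definition in_itv_open (I : itv) (x : R) : Prop := fst I < x < snd I.

(* Derivative relative to a closed interval: two-sided in the interior and
   one-sided at the endpoints, so that it only involves the values of f on I. *)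
Definition is_deriv_on (I : itv) (f : R -> R) (x l : R) : Prop :=
  filterlim (fun x' => (f x' - f x) / (x' - x))
    (within (in_itv I) (locally' x)) (locally l).
Definition ex_deriv_on (I : itv) (f : R -> R) (x : R) : Prop :=
  exists l, is_deriv_on I f x l.
Definition deriv_on (I : itv) (f : R -> R) : R -> R :=
  fun x => @iota R_CompleteNormedModule (is_deriv_on I f x).
Definition deriv_on_n (I : itv) (n : nat) (f : R -> R) : R -> R :=
  Nat.iter n (deriv_on I) f.

Fixpoint Ck1 (k : nat) (X : itv) (f : R -> R) : Prop :=
  continuous_on (in_itv X) f /\
  match k with
  | O => True
  | S k' => (forall x, in_itv X x -> ex_deriv_on X f x) /\ Ck1 k' X (deriv_on X f)
  end.
Definition Cinf1 (X : itv) (f : R -> R) : Prop := forall k, Ck1 k X f.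

Definition d1_2 (X : itv) (u : R -> R -> R) : R -> R -> R :=
  fun x y => deriv_on X (fun x' => u x' y) x.
Definition d2_2 (Y : itv) (u : R -> R -> R) : R -> R -> R :=
  fun x y => deriv_on Y (fun y' => u x y') y.

Definition cont2 (X Y : itv) (u : R -> R -> R) : Prop :=
  continuous_on (fun p : R * R => in_itv X (fst p) /\ in_itv Y (snd p))
    (fun p => u (fst p) (snd p)).

Fixpoint Ck2 (k : nat) (X Y : itv) (u : R -> R -> R) : Prop :=
  cont2 X Y u /\
  match k with
  | O => True
  | S k' =>
      (forall x y, in_itv X x -> in_itv Y y ->
         ex_deriv_on X (fun x' => u x' y) x /\
         ex_deriv_on Y (fun y' => u x y') y) /\
      Ck2 k' X Y (d1_2 X u) /\ Ck2 k' X Y (d2_2 Y u)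
  end.
Definition Cinf2 (X Y : itv) (u : R -> R -> R) : Prop := forall k, Ck2 k X Y u.

Definition dpart2 (X Y : itv) (p q : nat) (u : R -> R -> R) : R -> R -> R :=
  Nat.iter p (d1_2 X) (Nat.iter q (d2_2 Y) u).

Definition d1_3 (X : itv) (u : R -> R -> R -> R) : R -> R -> R -> R :=
  fun x y t => deriv_on X (fun x' => u x' y t) x.
Definition d2_3 (Y : itv) (u : R -> R -> R -> R) : R -> R -> R -> R :=
  fun x y t => deriv_on Y (fun y' => u x y' t) y.
Definition d3_3 (I : itv) (u : R -> R -> R -> R) : R -> R -> R -> R :=
  fun x y t => deriv_on I (fun t' => u x y t') t.

Definition cont3 (X Y I : itv) (u : R -> R -> R -> R) : Prop :=
  continuous_on
    (fun p : R * R * R =>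
       in_itv X (fst (fst p)) /\ in_itv Y (snd (fst p)) /\ in_itv I (snd p))
    (fun p => u (fst (fst p)) (snd (fst p)) (snd p)).

Fixpoint Ck3 (k : nat) (X Y I : itv) (u : R -> R -> R -> R) : Prop :=
  cont3 X Y I u /\
  match k with
  | O => True
  | S k' =>
      (forall x y t, in_itv X x -> in_itv Y y -> in_itv I t ->
         ex_deriv_on X (fun x' => u x' y t) x /\
         ex_deriv_on Y (fun y' => u x y' t) y /\
         ex_deriv_on I (fun t' => u x y t') t) /\
      Ck3 k' X Y I (d1_3 X u) /\ Ck3 k' X Y I (d2_3 Y u) /\
      Ck3 k' X Y I (d3_3 I u)
  end.
Definition Cinf3 (X Y I : itv) (u : R -> R -> R -> R) : Prop :=
  forall k, Ck3 k X Y I u.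

Definition dpart3 (X Y I : itv) (n1 n2 n3 : nat) (u : R -> R -> R -> R) :
  R -> R -> R -> R :=
  Nat.iter n1 (d1_3 X) (Nat.iter n2 (d2_3 Y) (Nat.iter n3 (d3_3 I) u)).

Definition factpow (n : nat) (s : R) : R := Rpower (INR (fact n)) s.

Definition gevrey2 (s1 s2 : R) (X Y : itv) (u : R -> R -> R) : Prop :=
  Cinf2 X Y u /\
  exists C rho1 rho2 : R, 0 < C /\ 0 < rho1 /\ 0 < rho2 /\
    forall (n1 n2 : nat) (x y : R), in_itv X x -> in_itv Y y ->
      Rabs (dpart2 X Y n1 n2 u x y) <=
        C * (factpow n1 s1 * factpow n2 s2 / (rho1 ^ n1 * rho2 ^ n2)).

Definition gevrey3 (s1 s2 s3 : R) (X Y I : itv) (u : R -> R -> R -> R) : Prop :=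
  Cinf3 X Y I u /\
  exists C rho1 rho2 rho3 : R, 0 < C /\ 0 < rho1 /\ 0 < rho2 /\ 0 < rho3 /\
    forall (n1 n2 n3 : nat) (x y t : R),
      in_itv X x -> in_itv Y y -> in_itv I t ->
      Rabs (dpart3 X Y I n1 n2 n3 u x y t) <=
        C * (factpow n1 s1 * factpow n2 s2 * factpow n3 s3 /
             (rho1 ^ n1 * rho2 ^ n2 * rho3 ^ n3)).

(* The closure of Omega is Ix * Iy. *)
Definition Ix : itv := (-1, 0).
Definition Iy : itv := (0, 1).

Definition opP (a : R) (u : R -> R -> R) : R -> R -> R :=
  fun x y =>
    let ux := d1_2 Ix u in
    d1_2 Ix (d1_2 Ix ux) x y + d2_2 Iy (d2_2 Iy ux) x y + a * ux x y.
Definition opP_n (a : R) (n : nat) (u : R -> R -> R) : R -> R -> R :=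
  Nat.iter n (opP a) u.

Definition space_R (a R1 R2 : R) (u : R -> R -> R) : Prop :=
  Cinf2 Ix Iy u /\
  (exists C : R, 0 < C /\
     forall (p q : nat) (x y : R), in_itv Ix x -> in_itv Iy y ->
       Rabs (dpart2 Ix Iy p q u x y) <=
         C * (factpow p (2 / 3) * factpow q (2 / 3) / (R1 ^ p * R2 ^ q))) /\
  (forall (n : nat) (x y : R), in_itv Ix x -> in_itv Iy y ->
     opP_n a n u 0 y = 0 /\ d1_2 Ix (opP_n a n u) 0 y = 0 /\
     opP_n a n u x 0 = 0 /\ opP_n a n u x 1 = 0).

Definition efun (j : nat) (y : R) : R := sqrt 2 * sin (INR j * PI * y).
Definition lambda (j : nat) : R := (INR j * PI) ^ 2.

(* Only the indices j >= 1 and the values on [-1, 0] are constrained. *)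
Definition generating_functions (a : R) (g : nat -> nat -> R -> R) : Prop :=
  forall j : nat, (1 <= j)%nat ->
    (forall i : nat, Ck1 3 Ix (g i j)) /\
    (forall x : R, in_itv Ix x ->
       deriv_on_n Ix 3 (g O j) x - (lambda j - a) * deriv_on Ix (g O j) x = 0) /\
    g O j 0 = 0 /\ deriv_on Ix (g O j) 0 = 0 /\ deriv_on_n Ix 2 (g O j) 0 = 1 /\
    (forall i : nat,
       (forall x : R, in_itv Ix x ->
          deriv_on_n Ix 3 (g (S i) j) x
            - (lambda j - a) * deriv_on Ix (g (S i) j) x = - g i j x) /\
       g (S i) j 0 = 0 /\ deriv_on Ix (g (S i) j) 0 = 0 /\
       deriv_on_n Ix 2 (g (S i) j) 0 = 0).

(* Classical solution of the boundary initial-value problem with control h.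
   The equation is of order three, hence the regularity C^3 up to the boundary. *)
Definition zk_solution (a T : R) (h : R -> R -> R) (u : R -> R -> R -> R) : Prop :=
  Ck3 3 Ix Iy (0, T) u /\
  (forall x y t, in_itv_open Ix x -> in_itv_open Iy y -> in_itv_open (0, T) t ->
     d3_3 (0, T) u x y t + opP a (fun x' y' => u x' y' t) x y = 0) /\
  (forall y t, in_itv_open Iy y -> in_itv_open (0, T) t ->
     u 0 y t = 0 /\ d1_3 Ix u 0 y t = 0 /\ u (-1) y t = h y t) /\
  (forall x t, in_itv_open Ix x -> in_itv_open (0, T) t ->
     u x 0 t = 0 /\ u x 1 t = 0) /\
  (forall x y, in_itv_open Ix x -> in_itv_open Iy y -> u x y 0 = 0).

(* l is the iterated sum, over j >= 1 and then over i >= 0, of F j i. *)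
Definition is_double_series (F : nat -> nat -> R) (l : R) : Prop :=
  exists s : nat -> R,
    (forall j : nat, (1 <= j)%nat -> is_series (F j) (s j)) /\
    is_series (fun j => s (S j)) l.

Definition R_threshold (a : R) : R :=
  Rpower (9 * (a + 2)) (1 / 3) * exp (/ (3 * exp 1)).

(* Main.v *)
Require Import Defs.
From Stdlib Require Import Reals Factorial Lra Lia ClassicalEpsilon.
From Coquelicot Require Import Coquelicot.
Open Scope R_scope.

(* Write [u1 = sum_j f_j(x) e_j(y)] with [f_j(x) = int u1(x, .) e_j]. The boundary conditions
   on all [P^n u1] force the even [y]-derivatives of [P^n u1] to vanish on the sides, so that
   integrating by parts [j] times shows that the numbers
   [b_(n,j) = (-1)^n int d_x^2 P^n u1(0, .) e_j] are at most [C B^(-j) L^n (2n)!] for every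
   [B >= 1]. By Green's formula on [x, 0], [f_j = sum_n b_(n,j) g_(n,j)].
   The Gevrey-2 data [b_(n,j)] at [T] and [0] at [0] are interpolated by functions [z_j] obeying
   the same bounds, using truncated Laplace transforms [int_0^r z^n exp(-z/s) dz/s] times a
   cutoff function. Since [g_(i,j)] and its [p]-th derivatives are bounded by
   [p! 16^i exp(c j) / (3i+2)!], the flatness series converges with all its derivatives and
   is the required trajectory. Uniqueness is the energy identity. *)

(** * Derivatives relative to a closed interval *)

(** The obstacle is uniformity in the mode j. The bounds on [gen] and on the derivatives of [efun]
    grow like exp(c j), so the data must decay faster than any geometric sequence in j, and the
    interpolation in time must use the same constants for all modes. The decay comes from comparing
    the cost of 2j derivatives in y, about (2j)!^(2/3), that is j!^(4/3) up to geometric factors,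
    with the gain lambda_j^j >= j!^2. A factor j!^(-2/3) is left over, which beats every B^(-j).
    Each iterate of the operator costs three derivatives, and (3n)!^(2/3) is (2n)! up to geometric
    factors: this is the Gevrey order 2 in time. The same exponents make the flatness series
    converge: (2i)! / (3i+2)! <= 1 / i!, so whatever geometric factor K^i the interpolation produces
    is summed by an exponential series, and no radius has to be tracked in time. *)

Definition clamp (I : itv) (x : R) : R := Rmax (fst I) (Rmin x (snd I)).

Lemma clamp_in I x : fst I <= snd I -> in_itv I (clamp I x).
Proof.
  intros H; unfold in_itv, clamp; split; [apply Rmax_l|].
  apply Rmax_lub; [exact H | apply Rmin_r].
Qed.

Lemma clamp_id I x : in_itv I x -> clamp I x = x.
Proof.
  intros [H1 H2]; unfold clamp; rewrite Rmin_left, Rmax_right; auto.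
Qed.

Lemma clamp_dist I x y : Rabs (clamp I x - clamp I y) <= Rabs (x - y).
Proof.
  unfold clamp, Rmax, Rmin.
  repeat destruct Rle_dec; unfold Rabs; repeat destruct Rcase_abs; lra.
Qed.

(** The product form also holds at x' = x, which the difference quotient must exclude, and it is the
    form in which remainders can be summed or integrated. *)
Lemma is_deriv_on_eps I f x l :
  is_deriv_on I f x l <->
  forall eps, 0 < eps -> exists d, 0 < d /\ forall x', in_itv I x' ->
    Rabs (x' - x) < d -> Rabs (f x' - f x - l * (x' - x)) <= eps * Rabs (x' - x).
Proof.
  split.
  - intros H eps Heps.
    destruct (proj1 (filterlim_locally _ _) H (mkposreal eps Heps)) as [d Hd].
    exists d; split; [apply cond_pos|].
    intros x' Hx' Hdx.
    destruct (Req_dec x' x) as [->|Hne].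
    { replace (f x - f x - l * (x - x)) with 0 by ring.
      rewrite Rminus_diag, Rabs_R0; lra. }
    assert (B := Hd x' Hdx Hne Hx').
    unfold ball in B; simpl in B; unfold AbsRing_ball, abs, minus, plus, opp in B;
      simpl in B.
    replace (f x' - f x - l * (x' - x))
      with (((f x' - f x) / (x' - x) + - l) * (x' - x)) by (field; lra).
    rewrite Rabs_mult; apply Rmult_le_compat_r; [apply Rabs_pos | lra].
  - intros H; apply filterlim_locally; intros eps.
    destruct (H (eps / 2)) as [d [Hd H']]; [generalize (cond_pos eps); lra|].
    exists (mkposreal d Hd); intros x' Hx' Hne HI.
    assert (B := H' x' HI Hx').
    unfold ball; simpl; unfold AbsRing_ball, abs, minus, plus, opp; simpl.
    replace ((f x' - f x) / (x' - x) + - l)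
      with ((f x' - f x - l * (x' - x)) / (x' - x)) by (field; lra).
    unfold Rdiv; rewrite Rabs_mult, Rabs_inv.
    assert (0 < Rabs (x' - x)) by (apply Rabs_pos_lt; lra).
    apply Rle_lt_trans with (eps / 2); [|generalize (cond_pos eps); lra].
    apply Rmult_le_reg_r with (Rabs (x' - x)); [assumption|].
    rewrite Rmult_assoc, Rinv_l by lra; lra.
Qed.

Lemma is_derive_eps f x l :
  is_derive f x l <->
  forall eps, 0 < eps -> exists d, 0 < d /\ forall x',
    Rabs (x' - x) < d -> Rabs (f x' - f x - l * (x' - x)) <= eps * Rabs (x' - x).
Proof.
  rewrite is_derive_Reals; split.
  - intros H eps Heps; destruct (H eps Heps) as [d Hd].
    exists d; split; [apply cond_pos|].
    intros x' Hdx; destruct (Req_dec x' x) as [->|Hne].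
    { replace (f x - f x - l * (x - x)) with 0 by ring.
      rewrite Rminus_diag, Rabs_R0; lra. }
    assert (B := Hd (x' - x) ltac:(lra) Hdx).
    replace (x + (x' - x)) with x' in B by ring.
    replace (f x' - f x - l * (x' - x))
      with (((f x' - f x) / (x' - x) - l) * (x' - x)) by (field; lra).
    rewrite Rabs_mult; apply Rmult_le_compat_r; [apply Rabs_pos | lra].
  - intros H eps Heps; destruct (H (eps / 2)) as [d [Hd H']]; [lra|].
    exists (mkposreal d Hd); intros h Hh Hhd; simpl in Hhd.
    assert (B := H' (x + h) ltac:(now replace (x + h - x) with h by ring)).
    replace (x + h - x) with h in B by ring.
    replace ((f (x + h) - f x) / h - l) with ((f (x + h) - f x - l * h) / h)
      by (field; lra).
    unfold Rdiv; rewrite Rabs_mult, Rabs_inv.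
    assert (0 < Rabs h) by (apply Rabs_pos_lt; lra).
    apply Rle_lt_trans with (eps / 2); [|lra].
    apply Rmult_le_reg_r with (Rabs h); [assumption|].
    rewrite Rmult_assoc, Rinv_l by lra; lra.
Qed.

(* A one-sided derivative is the derivative of a (locally affine) extension; this
   transfers all the differentiation rules to [is_deriv_on]. *)
Lemma is_deriv_on_iff I f x l : in_itv I x ->
  is_deriv_on I f x l <->
  exists F, (forall y, in_itv I y -> F y = f y) /\ is_derive F x l.
Proof.
  intros Hx; split.
  - intros H; exists (fun y => f (clamp I y) + l * (y - clamp I y)); split.
    { intros y Hy; rewrite clamp_id by assumption; ring. }
    apply is_derive_eps; intros eps Heps.
    destruct (proj1 (is_deriv_on_eps _ _ _ _) H eps Heps) as [d [Hd H']].
    exists d; split; [exact Hd|]; intros y Hy.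
    assert (D := clamp_dist I y x); rewrite (clamp_id I x Hx) in *.
    assert (HI : fst I <= snd I) by (destruct Hx; lra).
    specialize (H' (clamp I y) (clamp_in I y HI) ltac:(lra)).
    replace (f (clamp I y) + l * (y - clamp I y) - (f x + l * (x - x)) - l * (y - x))
      with (f (clamp I y) - f x - l * (clamp I y - x)) by ring.
    eapply Rle_trans; [exact H'|]; apply Rmult_le_compat_l; lra.
  - intros [F [HF H]]; apply is_deriv_on_eps; intros eps Heps.
    destruct (proj1 (is_derive_eps _ _ _) H eps Heps) as [d [Hd H']].
    exists d; split; [exact Hd|]; intros y Hy Hyd.
    rewrite <- (HF y Hy), <- (HF x Hx); auto.
Qed.

Lemma is_derive_deriv_on I f x l : in_itv I x -> is_derive f x l ->
  is_deriv_on I f x l.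
Proof. intros Hx H; apply is_deriv_on_iff; eauto. Qed.

Lemma is_deriv_on_ext I f g x l : in_itv I x ->
  (forall y, in_itv I y -> f y = g y) -> is_deriv_on I f x l -> is_deriv_on I g x l.
Proof.
  intros Hx E H; apply is_deriv_on_iff in H as [F [HF H]]; [|assumption].
  apply is_deriv_on_iff; [assumption|]; exists F; split; [|assumption].
  intros y Hy; rewrite HF; auto.
Qed.

Lemma is_deriv_on_sub I J f x l : (forall y, in_itv J y -> in_itv I y) ->
  in_itv J x -> is_deriv_on I f x l -> is_deriv_on J f x l.
Proof.
  intros S Hx H; apply is_deriv_on_iff in H as [F [HF H]]; [|auto].
  apply is_deriv_on_iff; [assumption|]; exists F; split; auto.
Qed.

Lemma is_deriv_on_plus I f g x l m : in_itv I x ->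
  is_deriv_on I f x l -> is_deriv_on I g x m ->
  is_deriv_on I (fun y => f y + g y) x (l + m).
Proof.
  intros Hx Hf Hg.
  apply is_deriv_on_iff in Hf as [F [HF Hf]]; [|assumption].
  apply is_deriv_on_iff in Hg as [G [HG Hg]]; [|assumption].
  apply is_deriv_on_iff; [assumption|]; exists (fun y => F y + G y); split.
  - intros y Hy; rewrite HF, HG; auto.
  - now apply (is_derive_plus F G).
Qed.

Lemma is_deriv_on_mult I f g x l m : in_itv I x ->
  is_deriv_on I f x l -> is_deriv_on I g x m ->
  is_deriv_on I (fun y => f y * g y) x (l * g x + f x * m).
Proof.
  intros Hx Hf Hg.
  apply is_deriv_on_iff in Hf as [F [HF Hf]]; [|assumption].
  apply is_deriv_on_iff in Hg as [G [HG Hg]]; [|assumption].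
  apply is_deriv_on_iff; [assumption|]; exists (fun y => F y * G y); split.
  - intros y Hy; rewrite HF, HG; auto.
  - rewrite <- HF, <- HG by assumption.
    apply (is_derive_mult F G); auto; intros; apply Rmult_comm.
Qed.

Lemma is_deriv_on_const I c x : in_itv I x -> is_deriv_on I (fun _ => c) x 0.
Proof. intros Hx; apply is_derive_deriv_on; [assumption|]; apply is_derive_Reals, derivable_pt_lim_const. Qed.

Lemma is_deriv_on_scal I f x l c : in_itv I x -> is_deriv_on I f x l ->
  is_deriv_on I (fun y => c * f y) x (c * l).
Proof.
  intros Hx H.
  replace (c * l) with (0 * f x + c * l) by ring.
  apply (is_deriv_on_mult I (fun _ => c) f); auto using is_deriv_on_const.
Qed.

Lemma is_deriv_on_minus I f g x l m : in_itv I x ->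
  is_deriv_on I f x l -> is_deriv_on I g x m ->
  is_deriv_on I (fun y => f y - g y) x (l - m).
Proof.
  intros Hx Hf Hg.
  apply is_deriv_on_ext with (fun y => f y + (-1) * g y); [auto|intros; ring|].
  replace (l - m) with (l + (-1) * m) by ring.
  now apply is_deriv_on_plus; [| |apply is_deriv_on_scal].
Qed.

Lemma is_deriv_on_reflect I J f c x l : in_itv J x ->
  (forall y, in_itv J y -> in_itv I (c - y)) ->
  is_deriv_on I f (c - x) l -> is_deriv_on J (fun y => f (c - y)) x (- l).
Proof.
  intros Hx S H; apply is_deriv_on_iff in H as [F [HF H]]; [|auto].
  apply is_deriv_on_iff; [assumption|]; exists (fun y => F (c - y)); split.
  - intros y Hy; apply HF; auto.
  - replace (- l) with ((-1) * l) by ring.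
    apply (is_derive_comp F (fun y => c - y)); [exact H|].
    auto_derive; auto; ring.
Qed.

Lemma is_deriv_on_interior I f x l : in_itv_open I x ->
  is_deriv_on I f x l -> is_derive f x l.
Proof.
  intros Hx H; apply is_derive_eps; intros eps Heps.
  destruct (proj1 (is_deriv_on_eps _ _ _ _) H eps Heps) as [d [Hd H']].
  exists (Rmin d (Rmin (x - fst I) (snd I - x))); split.
  - destruct Hx; repeat apply Rmin_pos; lra.
  - intros y Hy.
    assert (A1 := Rmin_l d (Rmin (x - fst I) (snd I - x))).
    assert (A2 := Rmin_r d (Rmin (x - fst I) (snd I - x))).
    assert (A3 := Rmin_l (x - fst I) (snd I - x)).
    assert (A4 := Rmin_r (x - fst I) (snd I - x)).
    apply H'; [|lra].
    apply Rabs_lt_between in Hy; split; lra.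
Qed.

Lemma is_deriv_on_unique I f x l m : fst I < snd I -> in_itv I x ->
  is_deriv_on I f x l -> is_deriv_on I f x m -> l = m.
Proof.
  intros HI Hx Hl Hm.
  apply Rminus_diag_uniq, Rabs_eq_0, Rle_antisym; [|apply Rabs_pos].
  apply le_epsilon; intros eps Heps; rewrite Rplus_0_l.
  destruct (proj1 (is_deriv_on_eps _ _ _ _) Hl (eps / 2)) as [d1 [P1 Q1]]; [lra|].
  destruct (proj1 (is_deriv_on_eps _ _ _ _) Hm (eps / 2)) as [d2 [P2 Q2]]; [lra|].
  assert (P0 : 0 < Rmin d1 (Rmin d2 (snd I - fst I))) by (repeat apply Rmin_pos; lra).
  set (d := Rmin d1 (Rmin d2 (snd I - fst I))) in *.
  assert (A1 : d <= d1) by apply Rmin_l.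
  assert (A2 : d <= d2) by (eapply Rle_trans; [apply Rmin_r | apply Rmin_l]).
  assert (A3 : d <= snd I - fst I) by (eapply Rle_trans; [apply Rmin_r | apply Rmin_r]).
  (* If there is no room in I to the right of x, then d <= snd I - fst I leaves room to its left. *)
  assert (E : exists y, in_itv I y /\ 0 < Rabs (y - x) < d).
  { destruct Hx as [X1 X2]; unfold in_itv.
    destruct (Rle_lt_dec (x + d / 2) (snd I)).
    - exists (x + d / 2); rewrite Rabs_pos_eq; lra.
    - exists (x - d / 2); rewrite Rabs_left; lra. }
  destruct E as [y [Hy [Y1 Y2]]].
  specialize (Q1 y Hy ltac:(lra)); specialize (Q2 y Hy ltac:(lra)).
  apply Rmult_le_reg_r with (Rabs (y - x)); [assumption|].
  rewrite <- Rabs_mult.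
  replace ((l - m) * (y - x)) with
    ((f y - f x - m * (y - x)) - (f y - f x - l * (y - x))) by ring.
  eapply Rle_trans; [apply Rabs_triang|]; rewrite Rabs_Ropp; lra.
Qed.

Lemma deriv_on_eq I f x l : fst I < snd I -> in_itv I x ->
  is_deriv_on I f x l -> deriv_on I f x = l.
Proof.
  intros HI Hx H; unfold deriv_on.
  apply iota_unique; [|exact H].
  intros m Hm; now apply (is_deriv_on_unique I f x).
Qed.

Lemma ex_deriv_on_correct I f x : fst I < snd I -> in_itv I x ->
  ex_deriv_on I f x -> is_deriv_on I f x (deriv_on I f x).
Proof.
  intros HI Hx [l H]; now rewrite (deriv_on_eq I f x l HI Hx H).
Qed.

(** Continuity of the extension by constants. Global theorems on continuous functions and integrals
    apply to it directly, whatever f does outside I. *)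
Definition cont_on (I : itv) (f : R -> R) : Prop :=
  forall x, continuous (fun y => f (clamp I y)) x.

Lemma cont_on_eps I f : fst I <= snd I ->
  cont_on I f <->
  forall x, in_itv I x -> forall eps, 0 < eps -> exists d, 0 < d /\ forall x',
    in_itv I x' -> Rabs (x' - x) < d -> Rabs (f x' - f x) < eps.
Proof.
  intros HI; split.
  - intros H x Hx eps Heps.
    destruct (proj1 (filterlim_locally _ _) (H x) (mkposreal eps Heps)) as [d Hd].
    exists d; split; [apply cond_pos|]; intros y Hy Hyd.
    specialize (Hd y Hyd); rewrite !clamp_id in Hd by assumption; exact Hd.
  - intros H x; apply filterlim_locally; intros eps.
    destruct (H (clamp I x) (clamp_in I x HI) eps (cond_pos eps)) as [d [Hd H']].
    exists (mkposreal d Hd); intros y Hy.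
    apply (H' (clamp I y) (clamp_in I y HI)).
    eapply Rle_lt_trans; [apply clamp_dist | exact Hy].
Qed.

Lemma cont_on_continuous_on I f : fst I <= snd I ->
  cont_on I f <-> continuous_on (in_itv I) f.
Proof.
  intros HI; rewrite cont_on_eps by assumption; split.
  - intros H x Hx; apply filterlim_locally; intros eps.
    destruct (H x Hx eps (cond_pos eps)) as [d [Hd H']].
    exists (mkposreal d Hd); intros y Hy Hyd; now apply H'.
  - intros H x Hx eps Heps.
    destruct (proj1 (filterlim_locally _ _) (H x Hx) (mkposreal eps Heps)) as [d Hd].
    exists d; split; [apply cond_pos|]; intros y Hy Hyd; now apply Hd.
Qed.

Lemma deriv_cont_on I f f' : fst I <= snd I ->
  (forall x, in_itv I x -> is_deriv_on I f x (f' x)) -> cont_on I f.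
Proof.
  intros HI H; apply cont_on_eps; [assumption|]; intros x Hx eps Heps.
  destruct (proj1 (is_deriv_on_eps _ _ _ _) (H x Hx) 1 Rlt_0_1) as [d [Hd H']].
  assert (K := Rabs_pos (f' x)).
  exists (Rmin d (eps / (1 + Rabs (f' x)))); split.
  - apply Rmin_pos; [assumption|]; apply Rdiv_lt_0_compat; lra.
  - intros y Hy Hyd.
    assert (Y1 := Rlt_le_trans _ _ _ Hyd (Rmin_l _ _)).
    assert (Y2 := Rlt_le_trans _ _ _ Hyd (Rmin_r _ _)).
    specialize (H' y Hy Y1).
    replace (f y - f x) with ((f y - f x - f' x * (y - x)) + f' x * (y - x)) by ring.
    eapply Rle_lt_trans; [apply Rabs_triang|]; rewrite Rabs_mult.
    apply (Rmult_lt_compat_r (1 + Rabs (f' x))) in Y2; [|lra].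
    unfold Rdiv in Y2; rewrite Rmult_assoc, Rinv_l in Y2 by lra; lra.
Qed.

Lemma cont_on_ext I f g : fst I <= snd I -> (forall x, in_itv I x -> f x = g x) ->
  cont_on I f -> cont_on I g.
Proof.
  intros HI E H x; apply continuous_ext with (fun y => f (clamp I y)); [|apply H].
  intros y; apply E, clamp_in, HI.
Qed.

Lemma cont_on_plus I f g : cont_on I f -> cont_on I g -> cont_on I (fun x => f x + g x).
Proof. intros Hf Hg x; apply (continuous_plus (fun y => f (clamp I y)) (fun y => g (clamp I y))); auto. Qed.

Lemma cont_on_mult I f g : cont_on I f -> cont_on I g -> cont_on I (fun x => f x * g x).
Proof. intros Hf Hg x; apply (continuous_mult (fun y => f (clamp I y)) (fun y => g (clamp I y))); auto. Qed.

Lemma cont_on_const I c : cont_on I (fun _ => c).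
Proof. intros x; apply continuous_const. Qed.

Lemma cont_on_minus I f g : cont_on I f -> cont_on I g -> cont_on I (fun x => f x - g x).
Proof. intros Hf Hg x; apply (continuous_minus (fun y => f (clamp I y)) (fun y => g (clamp I y))); auto. Qed.

Lemma continuous_cont_on I f : fst I <= snd I -> (forall x, continuous f x) -> cont_on I f.
Proof.
  intros HI H; apply cont_on_eps; [assumption|]; intros x Hx eps Heps.
  destruct (proj1 (filterlim_locally _ _) (H x) (mkposreal eps Heps)) as [d Hd].
  exists d; split; [apply cond_pos|]; intros y Hy Hyd; now apply Hd.
Qed.

(** * Mean value and Taylor estimates on a closed interval *)

Lemma MVT_on I f f' x y : in_itv I x -> in_itv I y -> x < y -> cont_on I f ->
  (forall z, x < z < y -> is_derive f z (f' z)) ->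
  exists c, x < c < y /\ f y - f x = f' c * (y - x).
Proof.
  intros Hx Hy Hxy Hc H.
  (* The clamped function is continuous on the whole line and coincides with f near each interior
     point, so the two-sided theorem applies to it. *)
  set (F := fun z => f (clamp I z)).
  assert (HF : forall z, x < z < y -> derivable_pt_lim F z (f' z)).
  { intros z Hz; apply is_derive_Reals.
    apply is_derive_ext_loc with f; [|now apply H].
    apply (locally_interval _ z x y); simpl; [tauto..|].
    intros w W1 W2; symmetry; unfold F; simpl in *; rewrite clamp_id; auto.
    destruct Hx, Hy; split; lra. }
  destruct (MVT F id x y (fun c P => exist _ (f' c) (HF c P))
              (fun c _ => derivable_pt_id c) Hxy) as [c [P E]].
  - intros c _; apply continuity_pt_filterlim, Hc.
  - intros c _; apply derivable_continuous_pt, derivable_pt_id.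
  - exists c; split; [exact P|].
    rewrite derive_pt_id in E; simpl in E; unfold F, id in E.
    rewrite !clamp_id in E by assumption; lra.
Qed.

Lemma MVT_deriv_on I f f' x y : in_itv I x -> in_itv I y -> x < y ->
  (forall z, in_itv I z -> is_deriv_on I f z (f' z)) ->
  exists c, x < c < y /\ f y - f x = f' c * (y - x).
Proof.
  intros Hx Hy Hxy H.
  apply (MVT_on I f f'); auto.
  - apply deriv_cont_on with f'; [destruct Hx; lra | exact H].
  - intros z Hz; apply (is_deriv_on_interior I); [destruct Hx, Hy; split; lra|].
    apply H; destruct Hx, Hy; split; lra.
Qed.

Lemma MVT_bound I f f' B x y : in_itv I x -> in_itv I y ->
  (forall z, in_itv I z -> is_deriv_on I f z (f' z)) ->
  (forall z, in_itv I z -> Rabs (f' z) <= B) ->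
  Rabs (f y - f x) <= B * Rabs (y - x).
Proof.
  intros Hx Hy H HB.
  destruct (Rtotal_order x y) as [L|[->|L]].
  - destruct (MVT_deriv_on I f f' x y Hx Hy L H) as [c [Hc ->]].
    rewrite Rabs_mult; apply Rmult_le_compat_r; [apply Rabs_pos|].
    apply HB; destruct Hx, Hy; split; lra.
  - rewrite !Rminus_diag, Rabs_R0; lra.
  - rewrite (Rabs_minus_sym (f y)), (Rabs_minus_sym y).
    destruct (MVT_deriv_on I f f' y x Hy Hx L H) as [c [Hc ->]].
    rewrite Rabs_mult; apply Rmult_le_compat_r; [apply Rabs_pos|].
    apply HB; destruct Hx, Hy; split; lra.
Qed.

Lemma deriv_on_const I f x y : in_itv I x -> in_itv I y ->
  (forall z, in_itv I z -> is_deriv_on I f z 0) -> f x = f y.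
Proof.
  intros Hx Hy H.
  assert (B : Rabs (f y - f x) <= 0 * Rabs (y - x)).
  { apply (MVT_bound I f (fun _ => 0)); auto; intros; rewrite Rabs_R0; lra. }
  rewrite Rmult_0_l in B.
  assert (f y - f x = 0); [|lra].
  apply Rabs_eq_0, Rle_antisym; [exact B | apply Rabs_pos].
Qed.

(** Two mean value estimates in a row. The constant M instead of M/2 spares an integral
    remainder. *)
Lemma taylor_bound I f f1 f2 M x y : in_itv I x -> in_itv I y ->
  (forall z, in_itv I z -> is_deriv_on I f z (f1 z)) ->
  (forall z, in_itv I z -> is_deriv_on I f1 z (f2 z)) ->
  (forall z, in_itv I z -> Rabs (f2 z) <= M) ->
  Rabs (f y - f x - f1 x * (y - x)) <= M * (y - x) ^ 2.
Proof.
  intros Hx Hy H1 H2 HM.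
  assert (K : forall c, in_itv I c -> Rabs (c - x) <= Rabs (y - x) ->
    f y - f x = f1 c * (y - x) -> Rabs (f y - f x - f1 x * (y - x)) <= M * (y - x) ^ 2).
  { intros c Hc Hcx ->.
    replace (f1 c * (y - x) - f1 x * (y - x)) with ((f1 c - f1 x) * (y - x)) by ring.
    rewrite Rabs_mult, <- (pow2_abs (y - x)).
    assert (B := MVT_bound I f1 f2 M x c Hx Hc H2 HM).
    assert (0 <= M) by (eapply Rle_trans; [apply Rabs_pos | apply (HM x Hx)]).
    simpl; rewrite Rmult_1_r, <- Rmult_assoc.
    apply Rmult_le_compat_r; [apply Rabs_pos|].
    eapply Rle_trans; [exact B|]; now apply Rmult_le_compat_l. }
  destruct (Rtotal_order x y) as [L|[<-|L]].
  - destruct (MVT_deriv_on I f f1 x y Hx Hy L H1) as [c [Hc E]].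
    apply (K c); auto; [destruct Hx, Hy; split; lra|].
    rewrite !Rabs_pos_eq; lra.
  - apply (K x); auto; [rewrite Rminus_diag; lra | ring].
  - destruct (MVT_deriv_on I f f1 y x Hy Hx L H1) as [c [Hc E]].
    apply (K c); auto; [destruct Hx, Hy; split; lra| |lra].
    rewrite !Rabs_left1; lra.
Qed.

(** * Integrals and the fundamental theorem *)

Lemma ex_RInt_cont_on I f a b : fst I <= snd I -> in_itv I a -> in_itv I b ->
  cont_on I f -> ex_RInt f a b.
Proof.
  intros HI Ha Hb H.
  apply ex_RInt_ext with (fun y => f (clamp I y)).
  - intros x Hx; rewrite clamp_id; [reflexivity|].
    destruct Ha, Hb; unfold Rmin, Rmax in Hx; destruct Rle_dec; split; lra.
  - apply (@ex_RInt_continuous R_CompleteNormedModule); intros; apply H.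
Qed.

(** The difference between f and a primitive of the clamped f' has zero derivative inside, hence
    equal values at both ends. Derivatives of f at the endpoints do not enter. *)
Lemma FTC_on f f' a b : a <= b ->
  cont_on (a, b) f -> cont_on (a, b) f' ->
  (forall x, a < x < b -> is_derive f x (f' x)) -> RInt f' a b = f b - f a :> R.
Proof.
  intros Hab Hf Hf' H.
  destruct (Req_dec a b) as [<-|Hne]; [rewrite RInt_point; unfold zero; simpl; ring|].
  set (I := (a, b) : itv).
  set (g := fun x : R => RInt (fun y => f' (clamp I y)) a x).
  assert (Hg : forall x, is_derive g x (f' (clamp I x))).
  { intros x; apply (is_derive_RInt (fun y => f' (clamp I y)) g a x); [|apply Hf'].
    apply filter_forall; intros y; apply (@RInt_correct R_CompleteNormedModule).
    apply (@ex_RInt_continuous R_CompleteNormedModule); intros; apply Hf'. }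
  assert (Ha : in_itv I a) by (split; simpl; lra).
  assert (Hb : in_itv I b) by (split; simpl; lra).
  destruct (MVT_on I (fun x => f x - g x) (fun _ => 0) a b) as [c [_ E]]; auto; try lra.
  - apply cont_on_minus; [exact Hf|]; apply continuous_cont_on; [exact Hab|].
    intros x; apply (ex_derive_continuous g); eexists; apply Hg.
  - intros x Hx; replace 0 with (f' x - f' (clamp I x))
      by (rewrite clamp_id; [ring | split; simpl; lra]).
    apply (is_derive_minus f g); auto.
  - assert (Ga : g a = 0) by (unfold g; rewrite RInt_point; reflexivity).
    rewrite Ga in E.
    replace (RInt f' a b) with (g b); [lra|].
    unfold g; apply RInt_ext; intros x Hx; rewrite clamp_id; [reflexivity|].
    rewrite Rmin_left, Rmax_right in Hx by lra; split; simpl; lra.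
Qed.

Lemma FTC_deriv_on f f' a b : a <= b -> cont_on (a, b) f' ->
  (forall x, in_itv (a, b) x -> is_deriv_on (a, b) f x (f' x)) ->
  RInt f' a b = f b - f a :> R.
Proof.
  intros Hab Hc H; apply FTC_on; auto.
  - apply deriv_cont_on with f'; auto.
  - intros x Hx; apply (is_deriv_on_interior (a, b)); [exact Hx|].
    apply H; split; simpl; lra.
Qed.

Lemma RInt_bound f a b M : a <= b -> ex_RInt f a b ->
  (forall x, a <= x <= b -> Rabs (f x) <= M) -> Rabs (RInt f a b) <= M * (b - a).
Proof.
  intros Hab Hf HM; rewrite Rmult_comm.
  apply (norm_RInt_le_const f a b (RInt f a b)); auto.
  now apply (@RInt_correct R_CompleteNormedModule).
Qed.

(** * Dominated series and termwise differentiation *)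

Lemma ex_series_dom (a b : nat -> R) :
  (forall n, Rabs (a n) <= b n) -> ex_series b -> ex_series a.
Proof. intros H; apply (@ex_series_le R_AbsRing R_CompleteNormedModule a b H). Qed.

Lemma ex_series_dom_abs (a b : nat -> R) :
  (forall n, Rabs (a n) <= b n) -> ex_series b -> ex_series (fun n => Rabs (a n)).
Proof. intros H; apply ex_series_dom; intros n; rewrite Rabs_Rabsolu; apply H. Qed.

Lemma Series_dom (a b : nat -> R) :
  (forall n, Rabs (a n) <= b n) -> ex_series b -> Rabs (Series a) <= Series b.
Proof.
  intros H Hb; eapply Rle_trans; [apply Series_Rabs; now apply ex_series_dom_abs with b|].
  apply Series_le; [|exact Hb]; intros; split; [apply Rabs_pos | apply H].
Qed.

Lemma Series_zero (f : nat -> R) : (forall k, f k = 0) -> Series f = 0.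
Proof.
  intros Hf; rewrite (Series_ext f (fun _ => 0 * 0)) by (intros; rewrite Hf; ring).
  rewrite Series_scal_l; ring.
Qed.

(** A summable bound on the second derivatives dominates the Taylor remainders by m k (y - x)^2.
    Summing them gives the derivative directly, without an argument on uniform convergence. *)
Lemma is_deriv_on_Series I (f f1 f2 : nat -> R -> R) (m : nat -> R) x :
  in_itv I x -> ex_series m ->
  (forall k z, in_itv I z -> is_deriv_on I (f k) z (f1 k z)) ->
  (forall k z, in_itv I z -> is_deriv_on I (f1 k) z (f2 k z)) ->
  (forall k z, in_itv I z -> Rabs (f2 k z) <= m k) ->
  (forall z, in_itv I z -> ex_series (fun k => f k z)) ->
  (forall z, in_itv I z -> ex_series (fun k => f1 k z)) ->
  is_deriv_on I (fun z => Series (fun k => f k z)) x (Series (fun k => f1 k x)).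
Proof.
  intros Hx Hm H1 H2 HM E0 E1; apply is_deriv_on_eps; intros eps Heps.
  assert (M0 : 0 <= Series m).
  { eapply Rle_trans; [apply Rabs_pos|].
    apply (Series_dom (fun k => f2 k x)); auto. }
  exists (eps / (1 + Series m)); split; [apply Rdiv_lt_0_compat; lra|].
  intros y Hy Hyd.
  set (q := fun k => f k y - f k x - f1 k x * (y - x)).
  assert (Hq : forall k, Rabs (q k) <= m k * (y - x) ^ 2).
  { intros k; apply (taylor_bound I (f k) (f1 k) (f2 k)); auto. }
  assert (Em : ex_series (fun k => m k * (y - x) ^ 2)) by now apply ex_series_scal_r.
  replace (Series (fun k => f k y) - Series (fun k => f k x) -
            Series (fun k => f1 k x) * (y - x)) with (Series q).
  2: { unfold q; rewrite Series_minus, Series_minus, Series_scal_r; auto.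
       - now apply (ex_series_minus (fun k => f k y) (fun k => f k x)); apply E0.
       - now apply ex_series_scal_r, E1. }
  eapply Rle_trans; [now apply Series_dom with (1 := Hq)|].
  rewrite Series_scal_r, <- (pow2_abs (y - x)).
  apply (Rmult_lt_compat_r (1 + Series m)) in Hyd; [|lra].
  unfold Rdiv in Hyd; rewrite Rmult_assoc, Rinv_l in Hyd by lra.
  assert (P := Rabs_pos (y - x)).
  simpl; nra.
Qed.

(** * Jets *)

(* Jets are families closed under differentiation: all iterated one-sided derivatives
   are read off from them. *)
Definition jet1 (I : itv) (f : nat -> R -> R) : Prop :=
  forall n x, in_itv I x -> is_deriv_on I (f n) x (f (S n) x).

Definition jet2 (X Y : itv) (U : nat -> nat -> R -> R -> R) : Prop :=
  forall p q x y, in_itv X x -> in_itv Y y ->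
    is_deriv_on X (fun x' => U p q x' y) x (U (S p) q x y) /\
    is_deriv_on Y (fun y' => U p q x y') y (U p (S q) x y).

Definition jet3 (X Y I : itv) (U : nat -> nat -> nat -> R -> R -> R -> R) : Prop :=
  forall n1 n2 n3 x y t, in_itv X x -> in_itv Y y -> in_itv I t ->
    is_deriv_on X (fun x' => U n1 n2 n3 x' y t) x (U (S n1) n2 n3 x y t) /\
    is_deriv_on Y (fun y' => U n1 n2 n3 x y' t) y (U n1 (S n2) n3 x y t) /\
    is_deriv_on I (fun t' => U n1 n2 n3 x y t') t (U n1 n2 (S n3) x y t).

Lemma jet1_deriv_on_n I f u : fst I < snd I -> jet1 I f ->
  (forall x, in_itv I x -> u x = f O x) ->
  forall n x, in_itv I x -> deriv_on_n I n u x = f n x.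
Proof.
  intros HI J E n; induction n as [|n IH]; intros x Hx; [now apply E|].
  apply deriv_on_eq; auto.
  apply is_deriv_on_ext with (f n); auto.
  intros y Hy; symmetry; now apply IH.
Qed.

Lemma jet1_Cinf1 I f u : fst I < snd I -> jet1 I f ->
  (forall x, in_itv I x -> u x = f O x) -> Cinf1 I u.
Proof.
  intros HI J E k.
  assert (H : forall n v, (forall x, in_itv I x -> v x = f n x) -> Ck1 k I v).
  2: now apply (H O).
  induction k as [|k IH]; intros n v Ev.
  all: assert (D : forall x, in_itv I x -> is_deriv_on I v x (f (S n) x))
    by (intros x Hx; apply is_deriv_on_ext with (f n); auto; intros; symmetry; auto).
  all: assert (C : continuous_on (in_itv I) v)
    by (apply cont_on_continuous_on; [lra|]; apply deriv_cont_on with (f (S n)); auto; lra).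
  - split; auto.
  - split; [exact C|]; split.
    + intros x Hx; eexists; now apply D.
    + apply (IH (S n)); intros x Hx; apply deriv_on_eq; auto.
Qed.

(** A jet only asserts derivatives along each axis. Bounds on the next order make its members
    Lipschitz in each variable uniformly in the other, hence jointly continuous. *)
Lemma jet2_cont2 X Y U B : jet2 X Y U ->
  (forall p q x y, in_itv X x -> in_itv Y y -> Rabs (U p q x y) <= B p q) ->
  forall p q, cont2 X Y (U p q).
Proof.
  intros J HB p q [x y] [Hx Hy]; simpl in *.
  apply filterlim_locally; intros eps.
  set (K := B (S p) q + B p (S q)).
  assert (P1 : 0 <= B (S p) q) by (eapply Rle_trans; [apply Rabs_pos|]; now apply HB with (x:=x)(y:=y)).
  assert (P2 : 0 <= B p (S q)) by (eapply Rle_trans; [apply Rabs_pos|]; now apply HB with (x:=x)(y:=y)).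
  assert (Pd : 0 < eps / (1 + K)) by (apply Rdiv_lt_0_compat; [apply cond_pos | unfold K; lra]).
  exists (mkposreal _ Pd); intros [x' y'] [Bx By] [Hx' Hy']; simpl in *.
  unfold ball in *; simpl in *; unfold AbsRing_ball, abs, minus, plus, opp in *; simpl in *.
  replace (U p q x' y' + - U p q x y)
    with ((U p q x' y' - U p q x y') + (U p q x y' - U p q x y)) by ring.
  eapply Rle_lt_trans; [apply Rabs_triang|].
  assert (A1 : Rabs (U p q x' y' - U p q x y') <= B (S p) q * Rabs (x' - x))
    by (apply (MVT_bound X (fun z => U p q z y') (fun z => U (S p) q z y'));
        auto; intros; now apply J).
  assert (A2 : Rabs (U p q x y' - U p q x y) <= B p (S q) * Rabs (y' - y))
    by (apply (MVT_bound Y (fun z => U p q x z) (fun z => U p (S q) x z));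
        auto; intros; now apply J).
  fold (x' - x) in Bx; fold (y' - y) in By.
  apply Rle_lt_trans with (K * (eps / (1 + K))).
  - unfold K at 1; rewrite Rmult_plus_distr_r; apply Rplus_le_compat;
      (eapply Rle_trans; [eassumption|]; apply Rmult_le_compat_l; lra).
  - apply Rlt_le_trans with ((1 + K) * (eps / (1 + K))).
    + apply Rmult_lt_compat_r; lra.
    + right; field; unfold K; lra.
Qed.

Lemma jet3_cont3 X Y I U B : jet3 X Y I U ->
  (forall n1 n2 n3 x y t, in_itv X x -> in_itv Y y -> in_itv I t ->
    Rabs (U n1 n2 n3 x y t) <= B n1 n2 n3) ->
  forall n1 n2 n3, cont3 X Y I (U n1 n2 n3).
Proof.
  intros J HB p q r [[x y] t] [Hx [Hy Ht]]; simpl in *.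
  apply filterlim_locally; intros eps.
  set (K := B (S p) q r + B p (S q) r + B p q (S r)).
  assert (P : forall a b c, 0 <= B a b c)
    by (intros; eapply Rle_trans; [apply Rabs_pos|]; now apply HB with (x:=x)(y:=y)(t:=t)).
  assert (P1 := P (S p) q r); assert (P2 := P p (S q) r); assert (P3 := P p q (S r)).
  assert (Pd : 0 < eps / (1 + K)) by (apply Rdiv_lt_0_compat; [apply cond_pos | unfold K; lra]).
  exists (mkposreal _ Pd); intros [[x' y'] t'] [[Bx By] Bt] [Hx' [Hy' Ht']]; simpl in *.
  unfold ball in *; simpl in *; unfold AbsRing_ball, abs, minus, plus, opp in *; simpl in *.
  replace (U p q r x' y' t' + - U p q r x y t)
    with ((U p q r x' y' t' - U p q r x y' t') + (U p q r x y' t' - U p q r x y t')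
          + (U p q r x y t' - U p q r x y t)) by ring.
  eapply Rle_lt_trans; [apply Rabs_triang|].
  eapply Rle_lt_trans; [apply Rplus_le_compat_r, Rabs_triang|].
  assert (A1 : Rabs (U p q r x' y' t' - U p q r x y' t') <= B (S p) q r * Rabs (x' - x))
    by (apply (MVT_bound X (fun z => U p q r z y' t') (fun z => U (S p) q r z y' t'));
        auto; intros; now apply J).
  assert (A2 : Rabs (U p q r x y' t' - U p q r x y t') <= B p (S q) r * Rabs (y' - y))
    by (apply (MVT_bound Y (fun z => U p q r x z t') (fun z => U p (S q) r x z t'));
        auto; intros; now apply J).
  assert (A3 : Rabs (U p q r x y t' - U p q r x y t) <= B p q (S r) * Rabs (t' - t))
    by (apply (MVT_bound I (fun z => U p q r x y z) (fun z => U p q (S r) x y z));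
        auto; intros; now apply J).
  fold (x' - x) in Bx; fold (y' - y) in By; fold (t' - t) in Bt.
  apply Rle_lt_trans with (K * (eps / (1 + K))).
  - unfold K at 1; rewrite !Rmult_plus_distr_r; repeat apply Rplus_le_compat;
      (eapply Rle_trans; [eassumption|]; apply Rmult_le_compat_l; lra).
  - apply Rlt_le_trans with ((1 + K) * (eps / (1 + K))).
    + apply Rmult_lt_compat_r; lra.
    + right; field; unfold K; lra.
Qed.

Lemma jet2_d X Y U u p q : fst X < snd X -> fst Y < snd Y -> jet2 X Y U ->
  (forall x y, in_itv X x -> in_itv Y y -> u x y = U p q x y) ->
  forall x y, in_itv X x -> in_itv Y y ->
    is_deriv_on X (fun x' => u x' y) x (U (S p) q x y) /\
    is_deriv_on Y (fun y' => u x y') y (U p (S q) x y) /\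
    d1_2 X u x y = U (S p) q x y /\ d2_2 Y u x y = U p (S q) x y.
Proof.
  intros HX HY J E x y Hx Hy.
  assert (D1 : is_deriv_on X (fun x' => u x' y) x (U (S p) q x y)).
  { apply is_deriv_on_ext with (fun x' => U p q x' y); [auto| |now apply J].
    intros; symmetry; auto. }
  assert (D2 : is_deriv_on Y (fun y' => u x y') y (U p (S q) x y)).
  { apply is_deriv_on_ext with (fun y' => U p q x y'); [auto| |now apply J].
    intros; symmetry; auto. }
  repeat split; auto; now apply deriv_on_eq.
Qed.

Lemma jet2_d1_eq X Y U u p q : fst X < snd X -> fst Y < snd Y -> jet2 X Y U ->
  (forall x y, in_itv X x -> in_itv Y y -> u x y = U p q x y) ->
  forall x y, in_itv X x -> in_itv Y y -> d1_2 X u x y = U (S p) q x y.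
Proof.
  intros HX HY J E x y Hx Hy.
  exact (proj1 (proj2 (proj2 (jet2_d X Y U u p q HX HY J E x y Hx Hy)))).
Qed.

Lemma jet2_d2_eq X Y U u p q : fst X < snd X -> fst Y < snd Y -> jet2 X Y U ->
  (forall x y, in_itv X x -> in_itv Y y -> u x y = U p q x y) ->
  forall x y, in_itv X x -> in_itv Y y -> d2_2 Y u x y = U p (S q) x y.
Proof.
  intros HX HY J E x y Hx Hy.
  exact (proj2 (proj2 (proj2 (jet2_d X Y U u p q HX HY J E x y Hx Hy)))).
Qed.

Lemma jet3_d X Y I U u p q r : fst X < snd X -> fst Y < snd Y -> fst I < snd I ->
  jet3 X Y I U ->
  (forall x y t, in_itv X x -> in_itv Y y -> in_itv I t -> u x y t = U p q r x y t) ->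
  forall x y t, in_itv X x -> in_itv Y y -> in_itv I t ->
    (is_deriv_on X (fun x' => u x' y t) x (U (S p) q r x y t) /\
     is_deriv_on Y (fun y' => u x y' t) y (U p (S q) r x y t) /\
     is_deriv_on I (fun t' => u x y t') t (U p q (S r) x y t)) /\
    d1_3 X u x y t = U (S p) q r x y t /\ d2_3 Y u x y t = U p (S q) r x y t /\
    d3_3 I u x y t = U p q (S r) x y t.
Proof.
  intros HX HY HI J E x y t Hx Hy Ht.
  assert (D1 : is_deriv_on X (fun x' => u x' y t) x (U (S p) q r x y t)).
  { apply is_deriv_on_ext with (fun x' => U p q r x' y t); [auto| |now apply J].
    intros; symmetry; auto. }
  assert (D2 : is_deriv_on Y (fun y' => u x y' t) y (U p (S q) r x y t)).
  { apply is_deriv_on_ext with (fun y' => U p q r x y' t); [auto| |now apply J].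
    intros; symmetry; auto. }
  assert (D3 : is_deriv_on I (fun t' => u x y t') t (U p q (S r) x y t)).
  { apply is_deriv_on_ext with (fun t' => U p q r x y t'); [auto| |now apply J].
    intros; symmetry; auto. }
  repeat split; auto; now apply deriv_on_eq.
Qed.

Lemma cont2_ext X Y u v : (forall x y, in_itv X x -> in_itv Y y -> u x y = v x y) ->
  cont2 X Y v -> cont2 X Y u.
Proof.
  intros E C [x y] [Hx Hy]; specialize (C (x, y) (conj Hx Hy)); simpl in *.
  rewrite (E x y Hx Hy).
  eapply filterlim_ext_loc; [|exact C].
  exists (mkposreal 1 Rlt_0_1); intros [x' y'] _ [Hx' Hy']; simpl in *; symmetry; auto.
Qed.

Lemma cont3_ext X Y I u v :
  (forall x y t, in_itv X x -> in_itv Y y -> in_itv I t -> u x y t = v x y t) ->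
  cont3 X Y I v -> cont3 X Y I u.
Proof.
  intros E C [[x y] t] [Hx [Hy Ht]]; specialize (C (x, y, t) (conj Hx (conj Hy Ht))); simpl in *.
  rewrite (E x y t Hx Hy Ht).
  eapply filterlim_ext_loc; [|exact C].
  exists (mkposreal 1 Rlt_0_1); intros [[x' y'] t'] _ [Hx' [Hy' Ht']]; simpl in *; symmetry; auto.
Qed.

Lemma jet2_Cinf2 X Y U u : fst X < snd X -> fst Y < snd Y -> jet2 X Y U ->
  (forall p q, cont2 X Y (U p q)) ->
  (forall x y, in_itv X x -> in_itv Y y -> u x y = U O O x y) -> Cinf2 X Y u.
Proof.
  intros HX HY J C E k.
  assert (H : forall p q v, (forall x y, in_itv X x -> in_itv Y y -> v x y = U p q x y) ->
                Ck2 k X Y v); [|now apply (H O O)].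
  induction k as [|k IH]; intros p q v Ev.
  - split; [now apply cont2_ext with (U p q) | exact I].
  - split; [now apply cont2_ext with (U p q)|].
    assert (D := jet2_d X Y U v p q HX HY J Ev).
    split; [|split].
    + intros x y Hx Hy; destruct (D x y Hx Hy) as [D1 [D2 _]]; split; eexists; eauto.
    + apply (IH (S p) q); intros; now apply D.
    + apply (IH p (S q)); intros; now apply D.
Qed.

Lemma jet3_Cinf3 X Y I U u : fst X < snd X -> fst Y < snd Y -> fst I < snd I ->
  jet3 X Y I U -> (forall p q r, cont3 X Y I (U p q r)) ->
  (forall x y t, in_itv X x -> in_itv Y y -> in_itv I t -> u x y t = U O O O x y t) ->
  Cinf3 X Y I u.
Proof.
  intros HX HY HI J C E k.
  assert (H : forall p q r v,
    (forall x y t, in_itv X x -> in_itv Y y -> in_itv I t -> v x y t = U p q r x y t) ->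
    Ck3 k X Y I v); [|now apply (H O O O)].
  induction k as [|k IH]; intros p q r v Ev.
  - split; [now apply cont3_ext with (U p q r) | exact Logic.I].
  - split; [now apply cont3_ext with (U p q r)|].
    assert (D := jet3_d X Y I U v p q r HX HY HI J Ev).
    split; [|split; [|split]].
    + intros x y t Hx Hy Ht; destruct (D x y t Hx Hy Ht) as [[D1 [D2 D3]] _];
        repeat split; eexists; eauto.
    + apply (IH (S p) q r); intros; now apply D.
    + apply (IH p (S q) r); intros; now apply D.
    + apply (IH p q (S r)); intros; now apply D.
Qed.

Lemma jet2_dpart2 X Y U u : fst X < snd X -> fst Y < snd Y -> jet2 X Y U ->
  (forall x y, in_itv X x -> in_itv Y y -> u x y = U O O x y) ->
  forall p q x y, in_itv X x -> in_itv Y y -> dpart2 X Y p q u x y = U p q x y.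
Proof.
  intros HX HY J E p q; unfold dpart2.
  assert (H2 : forall x y, in_itv X x -> in_itv Y y ->
    Nat.iter q (d2_2 Y) u x y = U O q x y).
  { induction q as [|q IH]; intros x y Hx Hy; [now apply E|].
    now apply (jet2_d X Y U _ O q HX HY J IH). }
  induction p as [|p IH]; intros x y Hx Hy; [now apply H2|].
  now apply (jet2_d X Y U _ p q HX HY J IH).
Qed.

Lemma jet3_dpart3 X Y I U u : fst X < snd X -> fst Y < snd Y -> fst I < snd I ->
  jet3 X Y I U ->
  (forall x y t, in_itv X x -> in_itv Y y -> in_itv I t -> u x y t = U O O O x y t) ->
  forall p q r x y t, in_itv X x -> in_itv Y y -> in_itv I t ->
    dpart3 X Y I p q r u x y t = U p q r x y t.
Proof.
  intros HX HY HI J E p q r; unfold dpart3.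
  assert (H3 : forall x y t, in_itv X x -> in_itv Y y -> in_itv I t ->
    Nat.iter r (d3_3 I) u x y t = U O O r x y t).
  { induction r as [|r IH]; intros x y t Hx Hy Ht; [now apply E|].
    now apply (jet3_d X Y I U _ O O r HX HY HI J IH). }
  assert (H2 : forall x y t, in_itv X x -> in_itv Y y -> in_itv I t ->
    Nat.iter q (d2_3 Y) (Nat.iter r (d3_3 I) u) x y t = U O q r x y t).
  { induction q as [|q IH]; intros x y t Hx Hy Ht; [now apply H3|].
    now apply (jet3_d X Y I U _ O q r HX HY HI J IH). }
  induction p as [|p IH]; intros x y t Hx Hy Ht; [now apply H2|].
  now apply (jet3_d X Y I U _ p q r HX HY HI J IH).
Qed.

(** The factored bound W n * m k lets one summable sequence serve every order: order n is
    differentiated with the bound at order n + 2. *)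
Lemma jet1_Series I (F : nat -> nat -> R -> R) (W : nat -> R) (m : nat -> R) :
  (forall k, jet1 I (F k)) -> ex_series m ->
  (forall k n x, in_itv I x -> Rabs (F k n x) <= W n * m k) ->
  jet1 I (fun n x => Series (fun k => F k n x)).
Proof.
  intros J Hm HB n x Hx.
  assert (E : forall n z, in_itv I z -> ex_series (fun k => F k n z)).
  { intros n' z Hz; apply ex_series_dom with (fun k => W n' * m k); [auto|].
    apply (ex_series_scal_l (W n') m Hm). }
  apply (is_deriv_on_Series I (fun k => F k n) (fun k => F k (S n)) (fun k => F k (S (S n)))
           (fun k => W (S (S n)) * m k)); auto.
  - apply (ex_series_scal_l (W (S (S n))) m Hm).
  - intros; now apply J.
  - intros; now apply J.
Qed.

Lemma jet3_Series X Y I (F : nat -> nat -> nat -> nat -> R -> R -> R -> R)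
  (W : nat -> nat -> nat -> R) (m : nat -> R) :
  (forall k, jet3 X Y I (F k)) -> ex_series m ->
  (forall k p q r x y t, in_itv X x -> in_itv Y y -> in_itv I t ->
    Rabs (F k p q r x y t) <= W p q r * m k) ->
  jet3 X Y I (fun p q r x y t => Series (fun k => F k p q r x y t)).
Proof.
  intros J Hm HB p q r x y t Hx Hy Ht; repeat split.
  - apply (jet1_Series X (fun k p x => F k p q r x y t) (fun p => W p q r) m); auto.
    intros k p' x' Hx'; now apply J.
  - apply (jet1_Series Y (fun k q y => F k p q r x y t) (fun q => W p q r) m); auto.
    intros k q' y' Hy'; now apply J.
  - apply (jet1_Series I (fun k r t => F k p q r x y t) (fun r => W p q r) m); auto.
    intros k r' t' Ht'; now apply J.
Qed.

Lemma jet3_product X Y I A B C : jet1 X A -> jet1 Y B -> jet1 I C ->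
  jet3 X Y I (fun p q r x y t => A p x * C r t * B q y).
Proof.
  intros HA HB HC p q r x y t Hx Hy Ht; repeat split.
  - replace (A (S p) x * C r t * B q y) with ((C r t * B q y) * A (S p) x) by ring.
    apply is_deriv_on_ext with (fun x => (C r t * B q y) * A p x); auto; [intros; ring|].
    apply is_deriv_on_scal; auto.
  - apply is_deriv_on_scal; auto.
  - replace (A p x * C (S r) t * B q y) with ((A p x * B q y) * C (S r) t) by ring.
    apply is_deriv_on_ext with (fun t => (A p x * B q y) * C r t); auto; [intros; ring|].
    apply is_deriv_on_scal; auto.
Qed.

(** * Generating functions *)

Local Notation rfact n := (INR (fact n)).

Lemma rfact_S n : rfact (S n) = INR (S n) * rfact n.
Proof. rewrite fact_simpl, mult_INR; reflexivity. Qed.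

Lemma rfact_ge1 n : 1 <= rfact n.
Proof. apply (le_INR 1), lt_O_fact. Qed.

Lemma rfact_pos n : 0 < rfact n.
Proof. generalize (rfact_ge1 n); lra. Qed.

Lemma rfact_mono n m : (n <= m)%nat -> rfact n <= rfact m.
Proof. intros H; apply le_INR, fact_le, H. Qed.

(** The binomial coefficient of a + b over a is at most 2^(a+b). The induction on a + b is Pascal's
    rule multiplied by the factorials. *)
Lemma rfact_add_upper a b : rfact (a + b) <= 2 ^ (a + b) * (rfact a * rfact b).
Proof.
  remember (a + b)%nat as n eqn:E; revert a b E.
  induction n as [|n IH]; intros a b E.
  { assert (a = O /\ b = O) as [-> ->] by lia; simpl; lra. }
  destruct a as [|a].
  { simpl in E; subst b; simpl (fact 0); rewrite Rmult_1_l.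
    assert (1 <= 2 ^ S n) by (apply pow_R1_Rle; lra).
    generalize (rfact_pos (S n)); simpl INR; nra. }
  destruct b as [|b].
  { rewrite Nat.add_0_r in E; injection E as <-; simpl (fact 0).
    assert (1 <= 2 ^ S n) by (apply pow_R1_Rle; lra).
    generalize (rfact_pos (S n)); simpl INR; nra. }
  assert (H2 := IH (S a) b ltac:(lia)).
  rewrite (rfact_S n).
  replace (INR (S n)) with (INR (S a) + INR (S b)) by (rewrite <- plus_INR; f_equal; lia).
  replace (2 ^ S n * (rfact (S a) * rfact (S b))) with
    (INR (S a) * (2 ^ n * (rfact a * rfact (S b))) + INR (S b) * (2 ^ n * (rfact (S a) * rfact b)))
    by (rewrite !(rfact_S a), !(rfact_S b); simpl; ring).
  rewrite Rmult_plus_distr_r; apply Rplus_le_compat; apply Rmult_le_compat_l; auto;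
    apply pos_INR.
Qed.

Lemma rfact_add_lower a b : rfact a * rfact b <= rfact (a + b).
Proof.
  induction a as [|a IH]; [simpl (fact 0); simpl (0 + b)%nat; simpl INR; lra|].
  simpl (S a + b)%nat; rewrite !rfact_S, Rmult_assoc.
  apply Rmult_le_compat; auto; try apply pos_INR.
  - apply Rmult_le_pos; apply pos_INR.
  - apply le_INR; lia.
Qed.

Lemma nondecr_from0 f f' x : 0 <= x -> (forall y, is_derive f y (f' y)) ->
  (forall y, 0 <= y -> 0 <= f' y) -> f 0 <= f x.
Proof.
  intros Hx H Hp.
  destruct (MVT_gen f 0 x f') as [c [Hc E]].
  - intros; apply H.
  - intros y _; apply continuity_pt_filterlim, (ex_derive_continuous f); eexists; apply H.
  - rewrite Rmin_left, Rmax_right in Hc by lra.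
    specialize (Hp c ltac:(lra)); nra.
Qed.

Definition exp_sum n x := sum_f_R0 (fun k => x ^ k / rfact k) n.

Lemma is_derive_monomial n x :
  is_derive (fun x => x ^ S n / rfact (S n)) x (x ^ n / rfact n).
Proof.
  assert (H := rfact_pos n); assert (0 < INR (S n)) by (apply lt_0_INR; lia).
  auto_derive; auto.
  change (pred (S n)) with n.
  replace (fact n + n * fact n)%nat with (fact (S n)) by reflexivity.
  replace (match n with O => 1 | S _ => INR n + 1 end) with (INR (S n)) by reflexivity.
  rewrite rfact_S; field; lra.
Qed.

Lemma is_derive_exp_sum n x : is_derive (exp_sum (S n)) x (exp_sum n x).
Proof.
  induction n as [|n IH].
  - apply is_derive_ext with (fun x => 1 + x); [intros; unfold exp_sum; simpl; field|].
    unfold exp_sum; simpl; auto_derive; auto; field.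
  - apply (is_derive_plus (exp_sum (S n)) (fun x => x ^ S (S n) / rfact (S (S n)))); auto.
    apply is_derive_monomial.
Qed.

Lemma exp_sum_0 n : exp_sum n 0 = 1.
Proof.
  unfold exp_sum; induction n as [|n IH].
  - simpl; field.
  - rewrite tech5, IH, pow_i by lia; unfold Rdiv; ring.
Qed.

(** Induction on n: the tail of order n + 1 vanishes at 0 and has the tail of order n as derivative.
    The upper bound is what keeps [trunc r n] below r^n. *)
Lemma exp_tail n x : 0 <= x -> 0 <= exp x - exp_sum n x <= x ^ n / rfact n * exp x.
Proof.
  revert x; induction n as [|n IH]; intros x Hx.
  - unfold exp_sum; simpl.
    assert (E := exp_ineq1_le x); split; lra.
  - split.
    + replace 0 with (exp 0 - exp_sum (S n) 0) by (rewrite exp_0, exp_sum_0; ring).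
      apply (nondecr_from0 (fun x => exp x - exp_sum (S n) x) (fun x => exp x - exp_sum n x));
        auto; [|intros; now apply IH].
      intros y; apply (is_derive_minus exp); [apply is_derive_exp|apply is_derive_exp_sum].
    + apply Rminus_le_0.
      set (h := fun x => x ^ S n / rfact (S n) * exp x - (exp x - exp_sum (S n) x)).
      change (0 <= h x).
      replace 0 with (h 0)
        by (unfold h; rewrite exp_0, exp_sum_0, pow_i by lia; unfold Rdiv; ring).
      apply (nondecr_from0 h (fun x => (x ^ n / rfact n * exp x + x ^ S n / rfact (S n) * exp x)
                                       - (exp x - exp_sum n x))); auto.
      * intros y; apply (is_derive_minus (fun x => x ^ S n / rfact (S n) * exp x)
                           (fun x => exp x - exp_sum (S n) x)).
        { apply (is_derive_mult (fun x => x ^ S n / rfact (S n)) exp);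
            [apply is_derive_monomial | apply is_derive_exp | intros; apply Rmult_comm]. }
        apply (is_derive_minus exp); [apply is_derive_exp|apply is_derive_exp_sum].
      * intros y Hy; assert (H := proj2 (IH y Hy)).
        assert (0 <= y ^ S n / rfact (S n) * exp y); [|lra].
        apply Rmult_le_pos; [|left; apply exp_pos].
        apply Rdiv_le_0_compat; [now apply pow_le | apply rfact_pos].
Qed.

Lemma pow_fact_le_exp n x : 0 <= x -> x ^ n / rfact n <= exp x.
Proof.
  intros Hx; assert (H := proj1 (exp_tail n x Hx)).
  assert (x ^ n / rfact n <= exp_sum n x); [|lra].
  assert (P : forall k, 0 <= x ^ k / rfact k)
    by (intros; apply Rdiv_le_0_compat; [now apply pow_le | apply rfact_pos]).
  destruct n as [|n]; [unfold exp_sum; simpl; lra|].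
  unfold exp_sum; rewrite tech5.
  assert (0 <= sum_f_R0 (fun k => x ^ k / rfact k) n) by (apply cond_pos_sum; auto).
  lra.
Qed.

Lemma ex_series_exp x : ex_series (fun n => x ^ n / rfact n).
Proof.
  exists (exp x); generalize (is_exp_Reals x); unfold is_pseries.
  apply is_series_ext; intros n; rewrite pow_n_pow; reflexivity.
Qed.

(* [mono p n] is the [n]-th derivative of [x ^ p / p!]. *)
Fixpoint mono (p n : nat) (x : R) {struct n} : R :=
  match n, p with
  | O, _ => x ^ p / rfact p
  | S n', O => 0
  | S n', S p' => mono p' n' x
  end.

Lemma mono_add d n x : mono (n + d) n x = x ^ d / rfact d.
Proof. induction n as [|n IH]; [destruct d; reflexivity | exact IH]. Qed.

Lemma mono_lt p n x : (p < n)%nat -> mono p n x = 0.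
Proof.
  revert n; induction p as [|p IH]; intros n Hn; (destruct n as [|n]; [lia|]); simpl; auto.
  apply IH; lia.
Qed.

Lemma is_derive_mono p n x : is_derive (mono p n) x (mono p (S n) x).
Proof.
  revert p; induction n as [|n IH]; intros [|p].
  - apply is_derive_ext with (fun _ => 1); [intros; simpl; field|].
    apply (is_derive_const (1 : R_NormedModule) x).
  - assert (H := is_derive_monomial p x).
    apply is_derive_ext with (2 := H); reflexivity.
  - apply (is_derive_const (0 : R_NormedModule) x).
  - exact (IH p).
Qed.

(** Since 1 / (p-n)! <= 2^p n! / p!, the order n of derivation separates from the rank p. The factor
    n! then leaves the series defining [gen], which makes [gen] Gevrey of order 1 in x. *)
Lemma mono_bound p n x : Rabs x <= 1 -> Rabs (mono p n x) <= rfact n * (2 ^ p / rfact p).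
Proof.
  intros Hx.
  assert (N := rfact_pos n); assert (P := rfact_pos p); assert (Q := pow_lt 2 p Rlt_0_2).
  destruct (Nat.le_gt_cases n p) as [H|H].
  - replace p with (n + (p - n))%nat at 1 by lia; rewrite mono_add.
    assert (D := rfact_pos (p - n)).
    unfold Rdiv; rewrite Rabs_mult, <- RPow_abs, Rabs_inv, (Rabs_pos_eq (rfact (p - n))) by lra.
    apply Rle_trans with (/ rfact (p - n)).
    + rewrite <- (Rmult_1_l (/ rfact (p - n))) at 2.
      apply Rmult_le_compat_r; [left; now apply Rinv_0_lt_compat|].
      rewrite <- (pow1 (p - n)); apply pow_incr; split; [apply Rabs_pos | exact Hx].
    + apply Rmult_le_reg_r with (rfact (p - n) * rfact p); [nra|].
      rewrite <- Rmult_assoc, Rinv_l, Rmult_1_l by lra.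
      replace (rfact n * (2 ^ p * / rfact p) * (rfact (p - n) * rfact p))
        with (2 ^ p * (rfact n * rfact (p - n))) by (field; lra).
      assert (A := rfact_add_upper n (p - n)).
      now replace (n + (p - n))%nat with p in A by lia.
  - rewrite mono_lt, Rabs_R0 by assumption.
    apply Rmult_le_pos; [lra|]; apply Rlt_le, Rdiv_lt_0_compat; lra.
Qed.

(* [multichoose i k] is the binomial coefficient [C(i + k, k)]. *)
Fixpoint multichoose (i : nat) : nat -> R :=
  match i with
  | O => fun _ => 1
  | S i' => sum_f_R0 (multichoose i')
  end.

Lemma multichoose_bound i k : 0 <= multichoose i k <= 2 ^ (i + k).
Proof.
  revert k; induction i as [|i IH]; intros k.
  - simpl; split; [lra|]; apply pow_R1_Rle; lra.
  - simpl multichoose; induction k as [|k IHk].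
    + simpl; rewrite Nat.add_0_r; specialize (IH O); rewrite Nat.add_0_r in IH.
      generalize (pow_lt 2 i Rlt_0_2); lra.
    + rewrite tech5; specialize (IH (S k)).
      replace (2 ^ (S i + S k)) with (2 ^ (S i + k) + 2 ^ (i + S k)).
      * lra.
      * rewrite <- !Nat.add_succ_comm; simpl; ring.
Qed.

Definition gen_term (mu : R) (i n : nat) (x : R) (k : nat) : R :=
  multichoose i k * mu ^ k * mono (3 * i + 2 + 2 * k) n x.

(* The Laplace transform of [g_i] is [(-1)^i / (s (s^2 - mu))^(i+1)]; expand it in
   powers of [1/s]. The argument [n] is the order of derivation. *)
Definition gen (mu : R) (i n : nat) (x : R) : R :=
  (-1) ^ i * Series (gen_term mu i n x).

(** With p = 3i + 2 + 2k, use p! >= (3i+2)! (2k)!. The factor 16^i collects 2^i from [multichoose]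
    and 2^(3i) from [mono]. In k there remains (8 y^2)^k / (2k)!, at most 4^(-k) (6y)^(2k) / (2k)!
    because 8 <= 36 / 4, hence at most 4^(-k) exp(6y). Measuring mu by a square y^2 makes the
    exponent linear in the frequency, although mu itself is quadratic in it. *)
Lemma gen_term_bound mu y i n x k : Rabs mu <= y ^ 2 -> 0 <= y -> Rabs x <= 1 ->
  Rabs (gen_term mu i n x k) <=
    rfact n * (4 * 16 ^ i / rfact (3 * i + 2) * exp (6 * y)) * (/ 4) ^ k.
Proof.
  intros Hmu Hy Hx; unfold gen_term.
  rewrite !Rabs_mult, <- RPow_abs.
  destruct (multichoose_bound i k) as [M0 M1].
  rewrite (Rabs_pos_eq (multichoose i k)) by assumption.
  assert (B := mono_bound (3 * i + 2 + 2 * k) n x Hx).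
  set (p := (3 * i + 2 + 2 * k)%nat) in *.
  assert (N := rfact_pos n).
  apply Rle_trans with (2 ^ (i + k) * (y ^ 2) ^ k * (rfact n * (2 ^ p / rfact p))).
  { apply Rmult_le_compat; auto using Rabs_pos.
    - apply Rmult_le_pos; auto; apply pow_le, Rabs_pos.
    - apply Rmult_le_compat; auto.
      + apply pow_le, Rabs_pos.
      + apply pow_incr; split; [apply Rabs_pos | exact Hmu]. }
  assert (F1 := rfact_pos (3 * i + 2)); assert (F2 := rfact_pos (2 * k)).
  assert (L : / rfact p <= / (rfact (3 * i + 2) * rfact (2 * k)))
    by (apply Rinv_le_contravar; [nra | apply rfact_add_lower]).
  apply Rle_trans with (2 ^ (i + k) * (y ^ 2) ^ k *
     (rfact n * (2 ^ p * / (rfact (3 * i + 2) * rfact (2 * k))))).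
  { apply Rmult_le_compat_l.
    - apply Rmult_le_pos; apply pow_le; [lra | nra].
    - apply Rmult_le_compat_l; [lra|].
      unfold Rdiv; apply Rmult_le_compat_l; [apply pow_le; lra | exact L]. }
  assert (E := pow_fact_le_exp (2 * k) (6 * y) ltac:(lra)).
  unfold p; rewrite !pow_add, !pow_mult.
  replace (2 ^ i * 2 ^ k * (y ^ 2) ^ k *
    (rfact n * ((2 ^ 3) ^ i * 2 ^ 2 * (2 ^ 2) ^ k * / (rfact (3 * i + 2) * rfact (2 * k)))))
    with (rfact n * (4 * ((2 * 2 ^ 3) ^ i) / rfact (3 * i + 2) *
            (((8 * y ^ 2) ^ k) / rfact (2 * k)))).
  2: { rewrite !Rpow_mult_distr.
       replace (8 ^ k) with (2 ^ k * (2 ^ 2) ^ k)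
         by (rewrite <- Rpow_mult_distr; f_equal; ring).
       field; lra. }
  replace (2 * 2 ^ 3) with 16 by ring.
  rewrite !(Rmult_assoc (rfact n)); apply Rmult_le_compat_l; [lra|].
  rewrite Rmult_assoc; apply Rmult_le_compat_l.
  { apply Rlt_le, Rdiv_lt_0_compat; [|lra]; apply Rmult_lt_0_compat; [lra|apply pow_lt; lra]. }
  rewrite pow_mult in E.
  apply Rle_trans with (((6 * y) ^ 2) ^ k / rfact (2 * k) * (/ 4) ^ k).
  - replace (((6 * y) ^ 2) ^ k / rfact (2 * k) * (/ 4) ^ k)
      with ((((6 * y) ^ 2) * / 4) ^ k / rfact (2 * k))
      by (rewrite Rpow_mult_distr; field; lra).
    apply Rmult_le_compat_r; [left; now apply Rinv_0_lt_compat|].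
    apply pow_incr; split; nra.
  - apply Rmult_le_compat_r; [apply pow_le; lra | exact E].
Qed.

Lemma ex_series_quarter : ex_series (fun k => (/ 4) ^ k).
Proof. apply ex_series_geom; rewrite Rabs_pos_eq; lra. Qed.

Lemma Series_quarter : Series (fun k => (/ 4) ^ k) = 4 / 3.
Proof. rewrite Series_geom; [field | rewrite Rabs_pos_eq; lra]. Qed.

Lemma Rabs_sqrt_sq mu : Rabs mu <= (1 + Rabs mu) ^ 2 /\ 0 <= 1 + Rabs mu.
Proof. generalize (Rabs_pos mu); intros; split; nra. Qed.

Lemma ex_series_gen mu i n x : Rabs x <= 1 -> ex_series (gen_term mu i n x).
Proof.
  intros Hx; destruct (Rabs_sqrt_sq mu) as [H1 H2].
  eapply ex_series_dom; [intros k; now apply gen_term_bound with (1 := H1)|].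
  apply (ex_series_scal_l _ _ ex_series_quarter).
Qed.

Lemma gen_bound mu y i n x : Rabs mu <= y ^ 2 -> 0 <= y -> Rabs x <= 1 ->
  Rabs (gen mu i n x) <= rfact n * (8 * (16 ^ i / rfact (3 * i + 2)) * exp (6 * y)).
Proof.
  intros Hmu Hy Hx; unfold gen; rewrite Rabs_mult, pow_1_abs, Rmult_1_l.
  eapply Rle_trans.
  - apply Series_dom; [intros k; now apply gen_term_bound with (y := y)|].
    apply (ex_series_scal_l _ _ ex_series_quarter).
  - rewrite (Series_scal_l _ (fun k => (/ 4) ^ k)), Series_quarter.
    assert (0 <= rfact n * (16 ^ i / rfact (3 * i + 2) * exp (6 * y))).
    { apply Rmult_le_pos; [left; apply rfact_pos|].
      apply Rmult_le_pos; [|left; apply exp_pos].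
      apply Rdiv_le_0_compat; [apply pow_le; lra | apply rfact_pos]. }
    unfold Rdiv in *; nra.
Qed.

Lemma Ix_abs x : in_itv Ix x -> Rabs x <= 1.
Proof. intros [H1 H2]; simpl in *; apply Rabs_le; lra. Qed.

Lemma gen_jet mu i : jet1 Ix (gen mu i).
Proof.
  destruct (Rabs_sqrt_sq mu) as [H1 H2].
  intros n x Hx; unfold gen; apply is_deriv_on_scal; [assumption|].
  apply (jet1_Series Ix (fun k n x => gen_term mu i n x k)
           (fun n => rfact n * (4 * 16 ^ i / rfact (3 * i + 2) * exp (6 * (1 + Rabs mu))))
           (fun k => (/ 4) ^ k)); auto.
  - intros k n' x' Hx'; apply is_derive_deriv_on; [assumption|].
    unfold gen_term.
    apply (is_derive_scal (mono (3 * i + 2 + 2 * k) n') x' (multichoose i k * mu ^ k)).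
    apply is_derive_mono.
  - apply ex_series_quarter.
  - intros k n' x' Hx'; apply gen_term_bound; auto using Ix_abs.
Qed.

Lemma gen_at_0 mu i : gen mu i 0 0 = 0 /\ gen mu i 1 0 = 0 /\
  gen mu i 2 0 = match i with O => 1 | S _ => 0 end.
Proof.
  assert (Z : forall d, 0 ^ S d / rfact (S d) = 0)
    by (intros; rewrite pow_i by lia; unfold Rdiv; ring).
  assert (A : forall n k, (n < 3 * i + 2 + 2 * k)%nat -> gen_term mu i n 0 k = 0).
  { intros n k H; unfold gen_term.
    replace (3 * i + 2 + 2 * k)%nat with (n + S (3 * i + 1 + 2 * k - n))%nat by lia.
    rewrite mono_add, Z; ring. }
  repeat split.
  - unfold gen; rewrite Series_zero; [ring|]; intros k; apply A; lia.
  - unfold gen; rewrite Series_zero; [ring|]; intros k; apply A; lia.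
  - destruct i as [|i].
    + unfold gen; rewrite Series_incr_1 by (apply ex_series_gen; rewrite Rabs_R0; lra).
      rewrite Series_zero; [unfold gen_term; simpl; field|].
      intros k; apply A; lia.
    + unfold gen; rewrite Series_zero; [ring|]; intros k; apply A; lia.
Qed.

Lemma gen_ode_0 mu x : Rabs x <= 1 -> gen mu 0 3 x - mu * gen mu 0 1 x = 0.
Proof.
  intros Hx; unfold gen.
  rewrite (Series_incr_1 (gen_term mu 0 3 x)) by now apply ex_series_gen.
  rewrite (Series_ext (fun k => gen_term mu 0 3 x (S k)) (fun k => mu * gen_term mu 0 1 x k)).
  - rewrite Series_scal_l; unfold gen_term; simpl; ring.
  - intros k; unfold gen_term; simpl multichoose.
    replace (3 * 0 + 2 + 2 * S k)%nat with (S (S (3 * 0 + 2 + 2 * k))) by lia.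
    change (mono (S (S (3 * 0 + 2 + 2 * k))) 3 x) with (mono (3 * 0 + 2 + 2 * k) 1 x).
    simpl pow; ring.
Qed.

(** Three derivatives lower the rank of [mono] by three. Pascal's rule, [multichoose] of (S i, S k)
    being the sum of those of (S i, k) and (i, S k), then splits each coefficient into a term of mu
    times the first derivative and a term of the preceding function. *)
Lemma gen_ode_S mu i x : Rabs x <= 1 ->
  gen mu (S i) 3 x - mu * gen mu (S i) 1 x = - gen mu i 0 x.
Proof.
  intros Hx; unfold gen.
  assert (E : Series (gen_term mu (S i) 3 x) =
              Series (gen_term mu i 0 x) + mu * Series (gen_term mu (S i) 1 x)).
  2: rewrite E; simpl pow; ring.
  rewrite (Series_incr_1 (gen_term mu (S i) 3 x)) by now apply ex_series_gen.
  rewrite (Series_incr_1 (gen_term mu i 0 x)) by now apply ex_series_gen.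
  rewrite Rplus_assoc; f_equal.
  - unfold gen_term; simpl multichoose.
    replace (3 * S i + 2 + 2 * 0)%nat with (S (S (S (3 * i + 2 + 2 * 0)))) by lia.
    reflexivity.
  - rewrite <- Series_scal_l, <- Series_plus.
    + apply Series_ext; intros k; unfold gen_term; simpl multichoose.
      replace (3 * S i + 2 + 2 * S k)%nat with (S (S (S (3 * i + 2 + 2 * S k)))) by lia.
      replace (3 * S i + 2 + 2 * k)%nat with (S (3 * i + 2 + 2 * S k)) by lia.
      change (mono (S (S (S (3 * i + 2 + 2 * S k)))) 3 x) with (mono (3 * i + 2 + 2 * S k) 0 x).
      change (mono (S (3 * i + 2 + 2 * S k)) 1 x) with (mono (3 * i + 2 + 2 * S k) 0 x).
      rewrite <- (tech_pow_Rmult mu k); ring.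
    + apply (ex_series_incr_1 (gen_term mu i 0 x)); now apply ex_series_gen.
    + apply (ex_series_scal_l mu (gen_term mu (S i) 1 x)); now apply ex_series_gen.
Qed.

(** * Identification of the generating functions *)

Lemma Ix_lt : fst Ix < snd Ix.
Proof. simpl; lra. Qed.

Lemma Ix_0 : in_itv Ix 0.
Proof. split; simpl; lra. Qed.

(* Gronwall: [(f1^2 + f2^2) exp ((1 + |mu|) x)] is nondecreasing and vanishes at 0. *)
Lemma ode_unique mu f f1 f2 f3 :
  (forall x, in_itv Ix x -> is_deriv_on Ix f x (f1 x)) ->
  (forall x, in_itv Ix x -> is_deriv_on Ix f1 x (f2 x)) ->
  (forall x, in_itv Ix x -> is_deriv_on Ix f2 x (f3 x)) ->
  (forall x, in_itv Ix x -> f3 x = mu * f1 x) ->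
  f 0 = 0 -> f1 0 = 0 -> f2 0 = 0 ->
  forall x, in_itv Ix x -> f x = 0.
Proof.
  intros D0 D1 D2 Eq Z0 Z1 Z2.
  set (K := 1 + Rabs mu).
  assert (V : forall x, in_itv Ix x -> f1 x = 0).
  { intros x Hx.
    set (E := fun z => (f1 z * f1 z + f2 z * f2 z) * exp (K * z)).
    set (E' := fun z => ((f2 z * f1 z + f1 z * f2 z) + (f3 z * f2 z + f2 z * f3 z)) * exp (K * z)
                        + (f1 z * f1 z + f2 z * f2 z) * (K * exp (K * z))).
    assert (DE : forall z, in_itv Ix z -> is_deriv_on Ix E z (E' z)).
    { intros z Hz.
      apply (is_deriv_on_mult Ix (fun z => f1 z * f1 z + f2 z * f2 z) (fun z => exp (K * z))); auto.
      - apply (is_deriv_on_plus Ix (fun z => f1 z * f1 z) (fun z => f2 z * f2 z)); auto;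
          apply is_deriv_on_mult; auto.
      - apply is_derive_deriv_on; auto; auto_derive; auto; ring. }
    assert (PE : forall z, in_itv Ix z -> 0 <= E' z).
    { intros z Hz; unfold E'; rewrite (Eq z Hz).
      replace (((f2 z * f1 z + f1 z * f2 z) + (mu * f1 z * f2 z + f2 z * (mu * f1 z))) * exp (K * z)
         + (f1 z * f1 z + f2 z * f2 z) * (K * exp (K * z)))
        with ((2 * (1 + mu) * (f1 z * f2 z) + K * (f1 z * f1 z + f2 z * f2 z)) * exp (K * z)) by ring.
      apply Rmult_le_pos; [|left; apply exp_pos].
      assert (A : Rabs (1 + mu) <= K)
        by (unfold K; rewrite <- Rabs_R1 at 2; apply Rabs_triang).
      apply Rabs_le_between in A.
      assert (0 <= (f1 z + f2 z) ^ 2) by apply pow2_ge_0.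
      assert (0 <= (f1 z - f2 z) ^ 2) by apply pow2_ge_0.
      nra. }
    destruct (Rle_lt_or_eq_dec x 0) as [L| ->]; [apply Hx| |assumption].
    destruct (MVT_deriv_on Ix E E' x 0 Hx Ix_0 L DE) as [c [Hc Ec]].
    assert (P := PE c ltac:(destruct Hx; split; simpl in *; lra)).
    assert (E0 : E 0 = 0) by (unfold E; rewrite Z1, Z2; ring).
    assert (N : E x <= 0) by nra.
    unfold E in N; assert (X := exp_pos (K * x)).
    assert (f1 x * f1 x + f2 x * f2 x <= 0).
    { apply Rmult_le_reg_r with (exp (K * x)); lra. }
    nra. }
  intros x Hx; rewrite <- Z0; apply (deriv_on_const Ix); auto using Ix_0.
  intros z Hz; rewrite <- (V z Hz); auto.
Qed.

Lemma Ck1_3_derivs X f : fst X < snd X -> Ck1 3 X f -> forall x, in_itv X x ->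
  is_deriv_on X f x (deriv_on X f x) /\
  is_deriv_on X (deriv_on X f) x (deriv_on_n X 2 f x) /\
  is_deriv_on X (deriv_on_n X 2 f) x (deriv_on_n X 3 f x).
Proof.
  intros HX [_ [H1 [_ [H2 [_ [H3 _]]]]]] x Hx.
  repeat split; apply ex_deriv_on_correct; auto.
Qed.

(** The given functions are known only through their equations. Induction on i: once the source term
    is identified, the difference with [gen] solves the homogeneous equation with zero Cauchy data
    at 0. From here on only the explicit series is used. *)
Lemma generating_functions_eq a g : generating_functions a g ->
  forall j, (1 <= j)%nat -> forall i x, in_itv Ix x ->
    g i j x = gen (lambda j - a) i 0 x.
Proof.
  intros Hg j Hj; destruct (Hg j Hj) as [C [O0 [A0 [A1 [A2 HS]]]]].
  set (mu := lambda j - a) in *.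
  assert (D := fun i => Ck1_3_derivs Ix (g i j) Ix_lt (C i)).
  assert (J := gen_jet mu).
  assert (Core : forall i,
    (forall x, in_itv Ix x -> deriv_on_n Ix 3 (g i j) x - gen mu i 3 x =
       mu * (deriv_on Ix (g i j) x - gen mu i 1 x)) ->
    g i j 0 = 0 -> deriv_on Ix (g i j) 0 = 0 -> deriv_on_n Ix 2 (g i j) 0 = gen mu i 2 0 ->
    forall x, in_itv Ix x -> g i j x = gen mu i 0 x).
  { intros i E Z0 Z1 Z2 x Hx; apply Rminus_diag_uniq.
    destruct (gen_at_0 mu i) as [G0 [G1 G2]].
    apply (ode_unique mu (fun x => g i j x - gen mu i 0 x)
      (fun x => deriv_on Ix (g i j) x - gen mu i 1 x)
      (fun x => deriv_on_n Ix 2 (g i j) x - gen mu i 2 x)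
      (fun x => deriv_on_n Ix 3 (g i j) x - gen mu i 3 x)); auto.
    - intros z Hz; apply (is_deriv_on_minus Ix (g i j) (gen mu i 0)); [exact Hz|apply (D i z Hz)|apply (J i 0%nat z Hz)].
    - intros z Hz; apply (is_deriv_on_minus Ix (deriv_on Ix (g i j)) (gen mu i 1)); [exact Hz|apply (D i z Hz)|apply (J i 1%nat z Hz)].
    - intros z Hz; apply (is_deriv_on_minus Ix (deriv_on_n Ix 2 (g i j)) (gen mu i 2)); [exact Hz|apply (D i z Hz)|apply (J i 2%nat z Hz)].
    - rewrite Z0, G0; ring.
    - rewrite Z1, G1; ring.
    - rewrite Z2; ring. }
  induction i as [|i IH].
  - apply Core; auto.
    + intros x Hx; specialize (O0 x Hx); assert (Q := gen_ode_0 mu x (Ix_abs x Hx)); lra.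
    + rewrite A2; symmetry; apply gen_at_0.
  - destruct (HS i) as [O1 [B0 [B1 B2]]]; apply Core; auto.
    + intros x Hx; specialize (O1 x Hx); rewrite (IH x Hx) in O1.
      assert (Q := gen_ode_S mu i x (Ix_abs x Hx)); lra.
    + rewrite B2; symmetry; apply gen_at_0.
Qed.

(** * Gevrey interpolation in time *)

(** The powers of 1/s make the family stable under differentiation: the derivatives of exp(-r/s),
    extended by 0 to the left of 0, are combinations of its members. *)
Definition flat (r : R) (al : nat) (s : R) : R :=
  if Rle_dec s 0 then 0 else (/ s) ^ al * exp (- (r * / s)).

Lemma flat_npos r al s : s <= 0 -> flat r al s = 0.
Proof. intros H; unfold flat; destruct Rle_dec; [reflexivity|contradiction]. Qed.

Lemma flat_pos r al s : 0 < s -> flat r al s = (/ s) ^ al * exp (- (r * / s)).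
Proof. intros H; unfold flat; destruct Rle_dec; [lra|reflexivity]. Qed.

Lemma flat_S r al s : s * flat r (S al) s = flat r al s.
Proof.
  unfold flat; destruct Rle_dec; [ring|]; simpl; field; lra.
Qed.

(** This is x^al / al! <= exp x at x = r / s. *)
Lemma flat_bound r al s : 0 < r -> 0 <= flat r al s <= rfact al / r ^ al.
Proof.
  intros Hr; assert (Pr := pow_lt r al Hr); assert (F := rfact_pos al).
  assert (Q : 0 < rfact al / r ^ al) by now apply Rdiv_lt_0_compat.
  destruct (Rle_lt_dec s 0) as [H|H]; [rewrite flat_npos by assumption; lra|].
  rewrite flat_pos by assumption.
  assert (Hs := Rinv_0_lt_compat s H).
  split; [apply Rmult_le_pos; [apply pow_le; lra|left; apply exp_pos]|].
  assert (E := pow_fact_le_exp al (r * / s) ltac:(nra)).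
  rewrite exp_Ropp, Rpow_mult_distr in *.
  assert (X := exp_pos (r * / s)).
  apply Rmult_le_reg_r with (exp (r * / s) * (r ^ al / rfact al)).
  { apply Rmult_lt_0_compat; [assumption|]; now apply Rdiv_lt_0_compat. }
  replace ((/ s) ^ al * / exp (r * / s) * (exp (r * / s) * (r ^ al / rfact al)))
    with (r ^ al * (/ s) ^ al / rfact al) by (field; lra).
  replace (rfact al / r ^ al * (exp (r * / s) * (r ^ al / rfact al)))
    with (exp (r * / s)) by (field; lra).
  exact E.
Qed.

Lemma is_derive_flat r al s : 0 < r ->
  is_derive (flat r al) s (r * flat r (al + 2) s - INR al * flat r (al + 1) s).
Proof.
  intros Hr; destruct (Rtotal_order s 0) as [H|[->|H]].
  - rewrite !flat_npos by lra.
    replace (r * 0 - INR al * 0) with 0 by ring.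
    apply is_derive_ext_loc with (fun _ => 0).
    2: apply (is_derive_const (0 : R_NormedModule) s).
    apply (locally_interval _ s m_infty 0); simpl; auto.
    intros y _ Hy; rewrite flat_npos; [reflexivity|simpl in Hy; lra].
  - rewrite !flat_npos by lra.
    replace (r * 0 - INR al * 0) with 0 by ring.
    apply is_derive_eps; intros eps Heps.
    set (M := rfact (S (S al)) / r ^ S (S al)).
    assert (M0 : 0 < M) by (apply Rdiv_lt_0_compat; [apply rfact_pos | now apply pow_lt]).
    exists (eps / M); split; [now apply Rdiv_lt_0_compat|]; intros y Hy.
    (* At the origin, [flat r al y] is y^2 times the bounded function [flat r (al + 2) y], so its
       derivative there is 0. *)
    rewrite (flat_npos r al 0) by lra; rewrite <- (flat_S r al), <- (flat_S r (S al)).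
    assert (B := flat_bound r (S (S al)) y Hr); fold M in B.
    replace (y * (y * flat r (S (S al)) y) - 0 - 0 * (y - 0))
      with ((y - 0) * (flat r (S (S al)) y * (y - 0))) by ring.
    rewrite Rabs_mult, Rmult_comm; apply Rmult_le_compat_r; [apply Rabs_pos|].
    rewrite Rabs_mult, Rabs_pos_eq by tauto.
    apply Rle_trans with (M * (eps / M)); [|right; field; lra].
    apply Rmult_le_compat; auto using Rabs_pos; try tauto; lra.
  - rewrite !flat_pos by assumption.
    apply is_derive_ext_loc with (fun s => (/ s) ^ al * exp (- (r * / s))).
    { apply (locally_interval _ s 0 p_infty); simpl; auto.
      intros y Hy _; rewrite flat_pos; [reflexivity|exact Hy]. }
    replace (r * ((/ s) ^ (al + 2) * exp (- (r * / s))) -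
        INR al * ((/ s) ^ (al + 1) * exp (- (r * / s))))
      with ((INR al * (- / s ^ 2) * (/ s) ^ pred al) * exp (- (r * / s))
            + (/ s) ^ al * ((r * / s ^ 2) * exp (- (r * / s)))).
    2: { destruct al as [|al]; rewrite !pow_add; [simpl; field; lra|].
         simpl pred; simpl pow; field; lra. }
    assert (DI : is_derive (fun s => / s) s (- / s ^ 2)) by (auto_derive; [lra|field; lra]).
    apply (is_derive_mult (fun s => (/ s) ^ al) (fun s => exp (- (r * / s))));
      [|auto_derive; [lra|field; lra]|intros; apply Rmult_comm].
    apply (is_derive_pow (fun s => / s) al s _ DI).
Qed.

Fixpoint flat_jet (r : R) (al n : nat) (s : R) {struct n} : R :=
  match n with
  | O => flat r al s
  | S n' => r * flat_jet r (al + 2) n' s - INR al * flat_jet r (al + 1) n' s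
  end.

Lemma is_derive_flat_jet r al n s : 0 < r ->
  is_derive (flat_jet r al n) s (flat_jet r al (S n) s).
Proof.
  intros Hr; revert al; induction n as [|n IH]; intros al; [now apply is_derive_flat|].
  apply (is_derive_minus (fun s => r * flat_jet r (al + 2) n s)
           (fun s => INR al * flat_jet r (al + 1) n s)).
  - apply (is_derive_scal (flat_jet r (al + 2) n)); apply IH.
  - apply (is_derive_scal (flat_jet r (al + 1) n)); apply IH.
Qed.

Lemma flat_jet_npos r al n s : s <= 0 -> flat_jet r al n s = 0.
Proof.
  intros H; revert al; induction n as [|n IH]; intros al; [now apply flat_npos|].
  simpl; rewrite !IH; ring.
Qed.

(** Gevrey order 2 of the flat functions. A derivation either raises al by two with factor r, or by
    one with factor al. Both outcomes fit under (al + 2n)! / r^(al+n), and 2^n counts the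
    branches. *)
Lemma flat_jet_bound r al n s : 0 < r ->
  Rabs (flat_jet r al n s) <= 2 ^ n * rfact (al + 2 * n) / r ^ (al + n).
Proof.
  intros Hr; revert al; induction n as [|n IH]; intros al.
  - simpl flat_jet; rewrite Nat.mul_0_r, !Nat.add_0_r.
    destruct (flat_bound r al s Hr) as [B0 B1]; rewrite Rabs_pos_eq by assumption.
    simpl pow; unfold Rdiv in *; lra.
  - simpl flat_jet; unfold Rminus.
    eapply Rle_trans; [apply Rabs_triang|]; rewrite Rabs_Ropp, !Rabs_mult.
    rewrite (Rabs_pos_eq r), (Rabs_pos_eq (INR al)) by (auto using pos_INR; lra).
    assert (I2 := IH (al + 2)%nat); assert (I1 := IH (al + 1)%nat).
    apply (Rmult_le_compat_l r) in I2; [|lra].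
    apply (Rmult_le_compat_l (INR al)) in I1; [|apply pos_INR].
    replace (al + 2 + 2 * n)%nat with (al + 2 * S n)%nat in I2 by lia.
    set (q := rfact (al + 2 * S n)) in *.
    assert (P2 := pow_lt 2 n Rlt_0_2).
    replace (al + 2 + n)%nat with (S (al + S n)) in I2 by lia.
    replace (al + 1 + n)%nat with (al + S n)%nat in I1 by lia.
    assert (Rp := pow_lt r (al + S n) Hr).
    apply Rle_trans with (2 ^ n * q / r ^ (al + S n) + 2 ^ n * q / r ^ (al + S n)).
    2: { right; simpl pow; field; lra. }
    apply Rplus_le_compat.
    + eapply Rle_trans; [exact I2|]; right; simpl pow; field; lra.
    + eapply Rle_trans; [exact I1|].
      unfold Rdiv; rewrite <- !Rmult_assoc.
      apply Rmult_le_compat_r; [left; now apply Rinv_0_lt_compat|].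
      rewrite (Rmult_comm (INR al)), !Rmult_assoc; apply Rmult_le_compat_l; [lra|].
      unfold q; replace (al + 2 * S n)%nat with (S (al + 1 + 2 * n)) by lia.
      rewrite rfact_S.
      apply Rmult_le_compat_r; [left; apply rfact_pos | apply le_INR; lia].
Qed.

(* [trunc r n s = int_0^r z^n exp(-z/s) dz / s], a truncated Laplace transform; it
   approximates [n! s^n] near [0] and stays below [r^n]. *)
Fixpoint trunc (r : R) (n : nat) (s : R) : R :=
  match n with
  | O => 1 - flat r 0 s
  | S n' => INR n * s * trunc r n' s - r ^ n * flat r 0 s
  end.

(** Closed form of the incomplete gamma integral: n integrations by parts leave a tail of the
    exponential series at r / s. *)
Lemma trunc_eq r n s : 0 < s ->
  trunc r n s = rfact n * s ^ n * (exp (- (r * / s)) * (exp (r * / s) - exp_sum n (r * / s))).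
Proof.
  intros Hs; induction n as [|n IH].
  - simpl trunc; rewrite flat_pos by assumption; unfold exp_sum; simpl.
    rewrite exp_Ropp; generalize (exp_pos (r * / s)); intros; field; lra.
  - change (trunc r (S n) s) with (INR (S n) * s * trunc r n s - r ^ S n * flat r 0 s).
    rewrite IH, flat_pos by assumption; unfold exp_sum; rewrite tech5.
    fold (exp_sum n (r * / s)); rewrite rfact_S, Rpow_mult_distr.
    assert (F := rfact_pos n); assert (0 < INR (S n)) by (apply lt_0_INR; lia).
    assert (S1 := pow_lt s n Hs).
    rewrite !pow_inv, exp_Ropp; assert (X := exp_pos (r * / s)).
    simpl pow; field; repeat split; lra.
Qed.

Lemma trunc_bound r n s : 0 < r -> 0 <= s -> Rabs (trunc r n s) <= r ^ n.
Proof.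
  intros Hr [Hs|<-].
  - rewrite trunc_eq by assumption.
    assert (Hi := Rinv_0_lt_compat s Hs).
    destruct (exp_tail n (r * / s) ltac:(nra)) as [T0 T1].
    assert (F := rfact_pos n); assert (S1 := pow_lt s n Hs).
    assert (X := exp_pos (r * / s)).
    rewrite exp_Ropp, Rabs_pos_eq.
    2: { apply Rmult_le_pos; [nra|]; apply Rmult_le_pos; auto; left; now apply Rinv_0_lt_compat. }
    apply Rle_trans with (rfact n * s ^ n *
      (/ exp (r * / s) * ((r * / s) ^ n / rfact n * exp (r * / s)))).
    + apply Rmult_le_compat_l; [nra|]; apply Rmult_le_compat_l; auto.
      left; now apply Rinv_0_lt_compat.
    + rewrite Rpow_mult_distr, pow_inv; right; field; lra.
  - destruct n as [|n].
    + simpl; rewrite flat_npos by lra; rewrite Rminus_0_r, Rabs_R1; lra.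
    + change (trunc r (S n) 0) with (INR (S n) * 0 * trunc r n 0 - r ^ S n * flat r 0 0).
      rewrite flat_npos by lra.
      replace (INR (S n) * 0 * trunc r n 0 - r ^ S n * 0) with 0 by ring.
      rewrite Rabs_R0; apply pow_le; lra.
Qed.

(** The leading term copies the rule for n! s^n, whose derivative is n^2 times (n-1)! s^(n-1). The
    other terms are flat at 0. For n = 0 the value of [pred] is immaterial, its coefficient being
    0. *)
Lemma is_derive_trunc r n s : 0 < r ->
  is_derive (trunc r n) s
    (INR n ^ 2 * trunc r (pred n) s - INR n * r ^ n * flat r 1 s - r ^ S n * flat r 2 s).
Proof.
  intros Hr.
  assert (F0 : forall s, is_derive (flat r 0) s (r * flat r 2 s)).
  { intros s'; replace (r * flat r 2 s') with (r * flat r (0 + 2) s' - INR 0 * flat r (0 + 1) s')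
      by (simpl; ring).
    now apply is_derive_flat. }
  revert s; induction n as [|n IH]; intros s.
  - simpl pred; replace (INR 0 ^ 2 * trunc r 0 s - INR 0 * r ^ 0 * flat r 1 s - r ^ 1 * flat r 2 s)
      with (0 - r * flat r 2 s) by (simpl; ring).
    apply (is_derive_minus (fun _ => 1) (flat r 0)); auto.
    apply (is_derive_const (1 : R_NormedModule) s).
  - simpl pred.
    (* Euler's relation satisfied by [trunc r n]: near 0 it behaves like [s ^ n]. *)
    assert (Euler : s * (INR n ^ 2 * trunc r (pred n) s - INR n * r ^ n * flat r 1 s
                         - r ^ S n * flat r 2 s) = INR n * trunc r n s - r ^ S n * flat r 1 s).
    { replace (s * (INR n ^ 2 * trunc r (pred n) s - INR n * r ^ n * flat r 1 s
                         - r ^ S n * flat r 2 s))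
        with (INR n ^ 2 * s * trunc r (pred n) s - INR n * r ^ n * (s * flat r 1 s)
                         - r ^ S n * (s * flat r 2 s)) by ring.
      rewrite !flat_S; destruct n as [|n]; [simpl; ring|].
      simpl pred.
      change (trunc r (S n) s) with (INR (S n) * s * trunc r n s - r ^ S n * flat r 0 s).
      ring. }
    replace (INR (S n) ^ 2 * trunc r n s - INR (S n) * r ^ S n * flat r 1 s
              - r ^ S (S n) * flat r 2 s)
      with (INR (S n) * (1 * trunc r n s + s * (INR n ^ 2 * trunc r (pred n) s
               - INR n * r ^ n * flat r 1 s - r ^ S n * flat r 2 s))
            - r ^ S n * (r * flat r 2 s)).
    2: { rewrite Euler, S_INR; simpl pow; ring. }
    apply is_derive_ext with (fun s => INR (S n) * (s * trunc r n s) - r ^ S n * flat r 0 s).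
    { intros t; change (trunc r (S n) t) with (INR (S n) * t * trunc r n t - r ^ S n * flat r 0 t).
      simpl; ring. }
    apply (is_derive_minus (fun s => INR (S n) * (s * trunc r n s)) (fun s => r ^ S n * flat r 0 s)).
    + apply (is_derive_scal (fun s => s * trunc r n s)).
      apply (is_derive_mult (fun s => s) (trunc r n)); auto; [|intros; apply Rmult_comm].
      apply (is_derive_id s).
    + now apply (is_derive_scal (flat r 0)).
Qed.

Fixpoint trunc_jet (r : R) (n m : nat) (s : R) {struct m} : R :=
  match m with
  | O => trunc r n s
  | S m' => INR n ^ 2 * trunc_jet r (pred n) m' s - INR n * r ^ n * flat_jet r 1 m' s
            - r ^ S n * flat_jet r 2 m' s
  end.

Lemma is_derive_trunc_jet r n m s : 0 < r ->
  is_derive (trunc_jet r n m) s (trunc_jet r n (S m) s).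
Proof.
  intros Hr; revert n; induction m as [|m IH]; intros n; [now apply is_derive_trunc|].
  apply (is_derive_minus (fun s => INR n ^ 2 * trunc_jet r (pred n) m s - INR n * r ^ n * flat_jet r 1 m s)
           (fun s => r ^ S n * flat_jet r 2 m s)).
  - apply (is_derive_minus (fun s => INR n ^ 2 * trunc_jet r (pred n) m s)
             (fun s => INR n * r ^ n * flat_jet r 1 m s)).
    + apply (is_derive_scal (trunc_jet r (pred n) m)); apply IH.
    + apply (is_derive_scal (flat_jet r 1 m)); now apply is_derive_flat_jet.
  - apply (is_derive_scal (flat_jet r 2 m)); now apply is_derive_flat_jet.
Qed.

(** The flat terms vanish at 0, so the derivatives there are those of n! s^n: only the n-th one is
    nonzero and it equals n! squared. *)
Lemma trunc_jet_0 r n m : trunc_jet r n m 0 = if Nat.eqb n m then rfact m ^ 2 else 0.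
Proof.
  revert n; induction m as [|m IH]; intros n.
  - simpl trunc_jet; destruct n as [|n].
    + simpl; rewrite flat_npos by lra; ring.
    + change (trunc r (S n) 0) with (INR (S n) * 0 * trunc r n 0 - r ^ S n * flat r 0 0).
      rewrite flat_npos by lra; simpl Nat.eqb; cbv iota; ring.
  - simpl trunc_jet; rewrite !flat_jet_npos, IH by lra.
    destruct n as [|n]; [simpl; ring|]; simpl pred; simpl Nat.eqb.
    destruct (Nat.eqb_spec n m) as [->|H]; [|ring].
    rewrite rfact_S; ring.
Qed.

(** One unit sharper than [rfact_add_lower]. This unit absorbs the factor n + 1 carried by the flat
    terms in [trunc_jet_bound]. *)
Lemma fact_rising n p : INR (S n) * rfact n * rfact (S p) <= rfact (n + S p).
Proof.
  rewrite <- rfact_S; induction p as [|p IH].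
  - rewrite Nat.add_1_r; simpl (fact 1); simpl INR at 2; lra.
  - rewrite (rfact_S (S p)); replace (n + S (S p))%nat with (S (n + S p)) by lia.
    rewrite (rfact_S (n + S p)).
    replace (rfact (S n) * (INR (S (S p)) * rfact (S p)))
      with (INR (S (S p)) * (rfact (S n) * rfact (S p))) by ring.
    apply Rmult_le_compat; auto using pos_INR.
    + apply Rmult_le_pos; apply pos_INR.
    + apply le_INR; lia.
Qed.

(** Each of the three terms of the recursion is at most [w], whence 3^m. Since r <= 1, all negative
    powers of r are replaced by r^(-2m). The positive power r^n has to be kept: it is what makes the
    Borel series converge when r is small. *)
Lemma trunc_jet_bound r n m s : 0 < r <= 1 -> 0 <= s ->
  Rabs (trunc_jet r n m s) <= 3 ^ m * (rfact (n + 2 * m) / rfact n) * (r ^ n / r ^ (2 * m)).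
Proof.
  intros [Hr Hr1] Hs; revert n; induction m as [|m IH]; intros n.
  - simpl trunc_jet; rewrite Nat.mul_0_r, Nat.add_0_r.
    assert (F := rfact_pos n).
    replace (3 ^ 0 * (rfact n / rfact n) * (r ^ n / r ^ 0)) with (r ^ n)
      by (simpl; field; lra).
    now apply trunc_bound.
  - simpl trunc_jet; unfold Rminus.
    assert (Fn := rfact_pos n).
    assert (Prn := pow_lt r n Hr); assert (Pr2m := pow_lt r (2 * m) Hr).
    set (q := rfact (n + 2 * S m) / rfact n).
    assert (Q : 0 < q) by (apply Rdiv_lt_0_compat; auto using rfact_pos).
    set (w := 3 ^ m * q * (r ^ n / r ^ (2 * S m))).
    assert (Er : r ^ (2 * S m) = r ^ (2 * m) * (r * r))
      by (replace (2 * S m)%nat with (2 * m + 2)%nat by lia; rewrite pow_add; simpl; ring).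
    assert (Pr2 : 0 < r ^ (2 * S m)) by now apply pow_lt.
    replace (3 ^ S m * q * (r ^ n / r ^ (2 * S m))) with (w + w + w)
      by (unfold w; simpl (3 ^ S m); ring).
    eapply Rle_trans; [apply Rabs_triang|].
    eapply Rle_trans; [apply Rplus_le_compat_r, Rabs_triang|].
    rewrite !Rabs_Ropp, (Rabs_mult (INR n ^ 2)), (Rabs_mult (INR n * r ^ n)), (Rabs_mult (r ^ S n)).
    rewrite (Rabs_pos_eq (INR n ^ 2)) by apply pow2_ge_0.
    rewrite (Rabs_pos_eq (r ^ S n)) by (apply pow_le; lra).
    rewrite (Rabs_pos_eq (INR n * r ^ n)) by (apply Rmult_le_pos; [apply pos_INR|lra]).
    assert (Fl : forall al, (al <= 2)%nat -> (1 <= al)%nat ->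
       rfact (al + 2 * m) * INR (S n) <= q).
    { intros al H1 H2; unfold q; apply Rmult_le_reg_r with (rfact n); [assumption|].
      unfold Rdiv; rewrite (Rmult_assoc _ (/ _)), Rinv_l, Rmult_1_r by lra.
      replace (n + 2 * S m)%nat with (n + S (S (2 * m)))%nat by lia.
      eapply Rle_trans; [|apply (fact_rising n (S (2 * m)))].
      rewrite Rmult_assoc, Rmult_comm.
      apply Rmult_le_compat_l; [apply Rmult_le_pos; apply pos_INR|].
      apply rfact_mono; lia. }
    assert (P2 : 2 ^ m <= 3 ^ m) by (apply pow_incr; lra).
    assert (P2' := pow_lt 2 m Rlt_0_2).
    assert (Hrm : r ^ (2 * m) <= r ^ m).
    { replace (2 * m)%nat with (m + m)%nat by lia; rewrite pow_add.
      assert (r ^ m <= 1) by (rewrite <- (pow1 m); apply pow_incr; lra).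
      generalize (pow_lt r m Hr); nra. }
    assert (Hpw : r ^ (2 * m) * (r * r) <= r ^ (1 + m)).
    { change (r ^ (1 + m)) with (r * r ^ m); rewrite Rmult_comm.
      apply Rmult_le_compat; try lra; clear - Hr Hr1; nra. }
    assert (Hfin : forall c u, 0 <= c -> c <= q -> 0 < u -> r ^ (2 * S m) <= u ->
              2 ^ m * c * (r ^ n / u) <= w).
    { intros c u C0 C1 U0 U1; unfold w.
      apply Rmult_le_compat.
      - apply Rmult_le_pos; lra.
      - apply Rlt_le, Rdiv_lt_0_compat; assumption.
      - apply Rmult_le_compat; lra.
      - apply Rmult_le_compat_l; [lra|]; now apply Rinv_le_contravar. }
    apply Rplus_le_compat; [apply Rplus_le_compat|].
    + destruct n as [|n].
      { simpl INR; simpl (0 ^ 2); rewrite !Rmult_0_l; unfold w.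
        apply Rmult_le_pos; [|apply Rlt_le, Rdiv_lt_0_compat; assumption].
        apply Rmult_le_pos; lra. }
      simpl pred; specialize (IH n).
      apply (Rmult_le_compat_l (INR (S n) ^ 2)) in IH; [|apply pow2_ge_0].
      eapply Rle_trans; [exact IH|]; clear IH.
      unfold w, q.
      assert (F' := rfact_pos n); assert (N0 : 0 < INR (S n)) by (apply lt_0_INR; lia).
      set (b := rfact (n + 2 * m)).
      assert (B0 : 0 < b) by apply rfact_pos.
      (* Two of the three factors n + 1 come from the recursion, the third from (n+1)! / n!. They
         are absorbed by the three new factors of the factorial. *)
      assert (B1 : INR (S n) ^ 3 * b <= rfact (S n + 2 * S m)).
      { replace (S n + 2 * S m)%nat with (S (S (S (n + 2 * m)))) by lia.
        rewrite !rfact_S; fold b.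
        replace (INR (S n) ^ 3 * b) with (INR (S n) * (INR (S n) * (INR (S n) * b))) by ring.
        assert (X : forall k u v, (n <= k)%nat -> 0 <= u -> u <= v ->
                  INR (S n) * u <= INR (S k) * v).
        { intros; apply Rmult_le_compat; auto using pos_INR; apply le_INR; lia. }
        repeat (apply X; [lia| |]); try nra. }
      rewrite Er.
      replace (INR (S n) ^ 2 * (3 ^ m * (b / rfact n) * (r ^ n / r ^ (2 * m))))
        with (3 ^ m * ((INR (S n) ^ 3 * b) / rfact (S n)) * (r ^ n / r ^ (2 * m)))
        by (rewrite rfact_S; field; lra).
      apply Rmult_le_compat.
      * apply Rmult_le_pos; [lra|]; apply Rdiv_le_0_compat; [|lra].
        apply Rmult_le_pos; [apply pow_le|]; lra.
      * apply Rlt_le, Rdiv_lt_0_compat; [now apply pow_lt|assumption].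
      * apply Rmult_le_compat_l; [lra|]; apply Rmult_le_compat_r; [|exact B1].
        left; now apply Rinv_0_lt_compat.
      * assert (Pn := pow_lt r n Hr).
        apply Rmult_le_reg_r with (r ^ (2 * m) * (r * r)); [nra|].
        replace (r ^ n / r ^ (2 * m) * (r ^ (2 * m) * (r * r))) with (r ^ n * (r * r))
          by (field; lra).
        replace (r ^ S n / (r ^ (2 * m) * (r * r)) * (r ^ (2 * m) * (r * r))) with (r ^ n * r)
          by (rewrite <- (tech_pow_Rmult r n); field; lra).
        apply Rmult_le_compat_l; [lra|]; clear - Hr Hr1; nra.
    + assert (B := flat_jet_bound r 1 m s Hr).
      apply (Rmult_le_compat_l (INR n * r ^ n)) in B; [|apply Rmult_le_pos; [apply pos_INR|lra]].
      eapply Rle_trans; [exact B|].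
      assert (U0 : 0 < r ^ (1 + m)) by now apply pow_lt.
      replace (INR n * r ^ n * (2 ^ m * rfact (1 + 2 * m) / r ^ (1 + m)))
        with (2 ^ m * (rfact (1 + 2 * m) * INR n) * (r ^ n / r ^ (1 + m))) by (field; lra).
      apply Hfin; auto.
      * apply Rmult_le_pos; apply pos_INR.
      * eapply Rle_trans; [|apply (Fl 1%nat); lia].
        apply Rmult_le_compat_l; [apply pos_INR | apply le_INR; lia].
      * rewrite Er; apply Hpw.
    + assert (B := flat_jet_bound r 2 m s Hr).
      apply (Rmult_le_compat_l (r ^ S n)) in B; [|apply pow_le; lra].
      eapply Rle_trans; [exact B|].
      assert (U0 : 0 < r ^ (1 + m)) by now apply pow_lt.
      replace (r ^ S n * (2 ^ m * rfact (2 + 2 * m) / r ^ (2 + m)))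
        with (2 ^ m * rfact (2 + 2 * m) * (r ^ n / r ^ (1 + m))).
      2: { replace (2 + m)%nat with (S (1 + m)) by lia.
           rewrite <- (tech_pow_Rmult r (1 + m)), <- (tech_pow_Rmult r n); field; lra. }
      apply Hfin; auto.
      * apply pos_INR.
      * eapply Rle_trans; [|apply (Fl 2%nat); lia].
        rewrite <- (Rmult_1_r (rfact _)) at 1; apply Rmult_le_compat_l; [apply pos_INR|].
        apply (le_INR 1); lia.
      * rewrite Er; apply Hpw.
Qed.

(* [jet_mul f g n p q] is the [n]-th derivative of [f p * g q]: Leibniz' rule without
   binomial coefficients. *)
Fixpoint jet_mul (f g : nat -> R -> R) (n p q : nat) (x : R) {struct n} : R :=
  match n with
  | O => f p x * g q x
  | S n' => jet_mul f g n' (S p) q x + jet_mul f g n' p (S q) x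
  end.

Lemma jet_mul_jet I f g : jet1 I f -> jet1 I g ->
  forall p q, jet1 I (fun n => jet_mul f g n p q).
Proof.
  intros Jf Jg p q n; revert p q; induction n as [|n IH]; intros p q x Hx.
  - simpl; apply (is_deriv_on_mult I (f p) (g q)); auto.
  - apply (is_deriv_on_plus I (jet_mul f g n (S p) q) (jet_mul f g n p (S q)));
      [exact Hx | apply (IH (S p) q x Hx) | apply (IH p (S q) x Hx)].
Qed.

(** The inequality (2p)! (2q)! <= (2p + 2q)! is the stability of Gevrey-2 growth under products. The
    factor 2^n counts the branches of the Leibniz recursion. *)
Lemma jet_mul_bound f g A B K x : 0 <= A -> 0 <= B -> 0 <= K ->
  (forall n, Rabs (f n x) <= A * (K ^ n * rfact (2 * n))) ->
  (forall n, Rabs (g n x) <= B * (K ^ n * rfact (2 * n))) ->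
  forall n p q, Rabs (jet_mul f g n p q x) <=
    A * B * (2 ^ n * K ^ (p + q + n) * rfact (2 * (p + q + n))).
Proof.
  intros HA HB HK Hf Hg n; induction n as [|n IH]; intros p q.
  - simpl jet_mul; rewrite Rabs_mult, Nat.add_0_r.
    eapply Rle_trans; [apply Rmult_le_compat; [apply Rabs_pos|apply Rabs_pos|apply Hf|apply Hg]|].
    assert (L := rfact_add_lower (2 * p) (2 * q)).
    replace (2 * p + 2 * q)%nat with (2 * (p + q))%nat in L by lia.
    replace (A * (K ^ p * rfact (2 * p)) * (B * (K ^ q * rfact (2 * q))))
      with (A * B * (K ^ (p + q) * (rfact (2 * p) * rfact (2 * q)))) by (rewrite pow_add; ring).
    apply Rmult_le_compat_l; [now apply Rmult_le_pos|].
    simpl (2 ^ 0); rewrite Rmult_1_l; apply Rmult_le_compat_l; [now apply pow_le|exact L].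
  - simpl jet_mul; eapply Rle_trans; [apply Rabs_triang|].
    assert (H1 := IH (S p) q); assert (H2 := IH p (S q)).
    replace (S p + q + n)%nat with (p + q + S n)%nat in H1 by lia.
    replace (p + S q + n)%nat with (p + q + S n)%nat in H2 by lia.
    simpl (2 ^ S n); lra.
Qed.

Lemma jet_mul_0_r f g x : (forall q, g q x = 0) -> forall n p q, jet_mul f g n p q x = 0.
Proof.
  intros Hg n; induction n as [|n IH]; intros p q; simpl; [rewrite Hg | rewrite !IH]; ring.
Qed.

Lemma jet_mul_0_l f g x : (forall q, f q x = 0) -> forall n p q, jet_mul f g n p q x = 0.
Proof.
  intros Hg n; induction n as [|n IH]; intros p q; simpl; [rewrite Hg | rewrite !IH]; ring.
Qed.

Lemma jet_mul_1_r f g x : g O x = 1 -> (forall q, g (S q) x = 0) ->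
  forall n p, jet_mul f g n p 0 x = f (p + n)%nat x.
Proof.
  intros G0 GS n.
  assert (Z : forall m p q, jet_mul f g m p (S q) x = 0).
  { induction m as [|m IH]; intros p q; simpl; [rewrite GS | rewrite !IH]; ring. }
  induction n as [|n IH]; intros p; simpl.
  - rewrite G0, Nat.add_0_r; ring.
  - rewrite IH, Z, Rplus_0_r; f_equal; lia.
Qed.

(** * Cutoff, Borel theorem and interpolation between two times *)

Lemma jet1_reflect T f : jet1 (0, T) f -> jet1 (0, T) (fun n t => (-1) ^ n * f n (T - t)).
Proof.
  intros J n t Ht.
  replace ((-1) ^ S n * f (S n) (T - t)) with ((-1) ^ n * - f (S n) (T - t)) by (simpl; ring).
  apply (is_deriv_on_scal (0, T) (fun t => f n (T - t))); [assumption|].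
  apply (is_deriv_on_reflect (0, T) (0, T) (f n)); auto.
  - intros y [H1 H2]; simpl in *; split; simpl; lra.
  - apply J; destruct Ht; simpl in *; split; simpl; lra.
Qed.

Lemma Rabs_pow_m1_mult n x : Rabs ((-1) ^ n * x) = Rabs x.
Proof. rewrite Rabs_mult, pow_1_abs; ring. Qed.

(** The cutoff is 1 - P / P(T), where P is the primitive of exp(-1/s) exp(-1/(T-s)). This integrand
    is positive inside (0, T) and flat at both ends, so all derivatives of the cutoff vanish
    there. *)
Lemma gevrey2_cutoff T : 0 < T -> exists A chi, 0 < A /\ jet1 (0, T) chi /\
  chi O 0 = 1 /\ (forall n, chi (S n) 0 = 0) /\ (forall n, chi n T = 0) /\
  forall n s, in_itv (0, T) s -> Rabs (chi n s) <= A * (4 ^ n * rfact (2 * n)).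
Proof.
  intros HT.
  set (f := flat_jet 1 0).
  set (g := fun n s => (-1) ^ n * flat_jet 1 0 n (T - s)).
  set (psi := fun n => jet_mul f g n 0 0).
  assert (Jf : jet1 (0, T) f)
    by (intros n s Hs; apply is_derive_deriv_on; auto; apply is_derive_flat_jet; lra).
  assert (Jg : jet1 (0, T) g) by (apply jet1_reflect, Jf).
  assert (Jp : jet1 (0, T) psi) by (apply (jet_mul_jet _ f g Jf Jg 0 0)).
  assert (Bf : forall n s, Rabs (f n s) <= 1 * (2 ^ n * rfact (2 * n))).
  { intros n s; unfold f; eapply Rle_trans; [apply flat_jet_bound; lra|].
    rewrite pow1; change (0 + 2 * n)%nat with (2 * n)%nat; lra. }
  assert (Bp : forall n s, Rabs (psi n s) <= 4 ^ n * rfact (2 * n)).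
  { intros n s; unfold psi; eapply Rle_trans; [apply (jet_mul_bound f g 1 1 2); try lra|].
    - intros; apply Bf.
    - intros; unfold g; rewrite Rabs_pow_m1_mult; apply Bf.
    - change (0 + 0 + n)%nat with n; rewrite <- Rpow_mult_distr; right.
      replace (2 * 2) with 4 by ring; ring. }
  assert (Cp : cont_on (0, T) (psi O))
    by (apply deriv_cont_on with (psi 1%nat); [simpl; lra|]; apply Jp).
  set (P := fun s => RInt (fun y => psi O (clamp (0, T) y)) 0 s).
  assert (DP : forall s, is_derive P s (psi O (clamp (0, T) s))).
  { intros s; apply (is_derive_RInt (fun y => psi O (clamp (0, T) y)) P 0 s); [|apply Cp].
    apply filter_forall; intros y; apply (@RInt_correct R_CompleteNormedModule).
    apply (@ex_RInt_continuous R_CompleteNormedModule); intros; apply Cp. }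
  assert (Cpos : 0 < P T).
  { apply RInt_gt_0; auto.
    intros s Hs; rewrite clamp_id by (split; simpl; lra).
    unfold psi, f, g; simpl; rewrite !flat_pos by lra; simpl.
    generalize (exp_pos (- (1 * / s))) (exp_pos (- (1 * / (T - s)))); intros; nra. }
  assert (Pb : forall s, in_itv (0, T) s -> Rabs (P s) <= T).
  { intros s Hs; apply Rle_trans with (1 * (s - 0)); [|destruct Hs; simpl in *; lra].
    apply RInt_bound; [apply Hs| |].
    - apply (@ex_RInt_continuous R_CompleteNormedModule); intros; apply Cp.
    - intros; eapply Rle_trans; [apply Bp|]; simpl; lra. }
  assert (P0 : P 0 = 0) by (unfold P; rewrite RInt_point; reflexivity).
  exists (1 + (1 + T) / P T).
  exists (fun n s => match n with O => 1 - P s / P T | S n' => - (psi n' s / P T) end).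
  assert (Q : 0 < (1 + T) / P T) by (apply Rdiv_lt_0_compat; lra).
  assert (Z0 : forall n, psi n 0 = 0).
  { intros n; apply jet_mul_0_l; intros q; unfold f; apply flat_jet_npos; lra. }
  assert (ZT : forall n, psi n T = 0).
  { intros n; apply jet_mul_0_r; intros q; unfold g; rewrite flat_jet_npos by lra; ring. }
  split; [lra|]; split; [|split; [|split; [|split]]].
  - intros [|n] s Hs.
    + rewrite <- (clamp_id (0, T) s Hs) at 2.
      apply is_derive_deriv_on; [assumption|].
      replace (- (psi O (clamp (0, T) s) / P T)) with (0 - psi O (clamp (0, T) s) * / P T)
        by (unfold Rdiv; ring).
      apply (is_derive_minus (fun _ => 1) (fun s => P s / P T)).
      * apply (is_derive_const (1 : R_NormedModule) s).
      * apply is_derive_ext with (fun s => / P T * P s); [intros; apply Rmult_comm|].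
        rewrite Rmult_comm; apply (is_derive_scal P s (/ P T)), DP.
    + apply is_deriv_on_ext with (fun s => - / P T * psi n s); auto;
        [intros; unfold Rdiv; ring|].
      replace (- (psi (S n) s / P T)) with (- / P T * psi (S n) s) by (unfold Rdiv; ring).
      apply is_deriv_on_scal; auto.
  - rewrite P0; unfold Rdiv; ring.
  - intros n; rewrite Z0; unfold Rdiv; ring.
  - intros [|n]; [field; lra|]; rewrite ZT; unfold Rdiv; ring.
  - intros [|n] s Hs.
    + simpl (4 ^ 0 * _); rewrite !Rmult_1_r.
      unfold Rminus; eapply Rle_trans; [apply Rabs_triang|]; rewrite Rabs_R1, Rabs_Ropp.
      unfold Rdiv; rewrite Rabs_mult, Rabs_inv, (Rabs_pos_eq (P T)) by lra.
      apply Rplus_le_compat_l, Rmult_le_compat_r; [left; now apply Rinv_0_lt_compat|].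
      specialize (Pb s Hs); lra.
    + rewrite Rabs_Ropp; unfold Rdiv; rewrite Rabs_mult, Rabs_inv, (Rabs_pos_eq (P T)) by lra.
      assert (B := Bp n s).
      assert (F : 4 ^ n * rfact (2 * n) <= 4 ^ S n * rfact (2 * S n)).
      { apply Rmult_le_compat; auto using pos_INR.
        - apply pow_le; lra.
        - simpl; generalize (pow_lt 4 n ltac:(lra)); lra.
        - apply rfact_mono; lia. }
      assert (F0 : 0 <= 4 ^ n * rfact (2 * n))
        by (apply Rmult_le_pos; [apply pow_le; lra|apply pos_INR]).
      assert (I0 := Rinv_0_lt_compat _ Cpos).
      apply Rle_trans with ((4 ^ S n * rfact (2 * S n)) * / P T).
      * apply Rmult_le_compat_r; lra.
      * rewrite Rmult_comm; apply Rmult_le_compat_r; [lra|]; nra.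
Qed.

Lemma is_series_indicator n : is_series (fun k => if Nat.eqb k n then 1 else 0) 1.
Proof.
  assert (E : forall m, sum_n (fun k => if Nat.eqb k n then 1 else 0) m =
                        if Nat.leb n m then 1 else 0).
  { induction m as [|m IH].
    - rewrite sum_O; destruct n; reflexivity.
    - rewrite sum_Sn, IH; unfold plus; cbn -[Nat.eqb Nat.leb].
      destruct (Nat.leb_spec n m), (Nat.eqb_spec (S m) n), (Nat.leb_spec n (S m));
        try lia; ring. }
  apply (filterlim_ext_loc (fun _ => 1)); [|apply filterlim_const].
  exists n; intros m Hm; rewrite E.
  now rewrite (proj2 (Nat.leb_le n m) Hm).
Qed.

(** The formal solution is the sum of b_k / k!^2 times k! s^k, which diverges in general. Replacing
    k! s^k by [trunc r k] keeps all derivatives at 0 and gains r^k. The constant K depends on L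
    alone, as is required to treat all modes at once. *)
Lemma gevrey2_borel L : 0 < L -> exists K, 0 < K /\
  forall T b M, 0 <= M -> 0 < T -> (forall n, Rabs (b n) <= M * (L ^ n * rfact (2 * n))) ->
  exists f, jet1 (0, T) f /\ (forall n, f n 0 = b n) /\
    forall n s, in_itv (0, T) s -> Rabs (f n s) <= 2 * M * (K ^ n * rfact (2 * n)).
Proof.
  intros HL.
  (* The ratio of the series is 8 L r: 4 L bounds the growth of [beta], 2 comes from (k + 2m)! / k!,
     and r from [trunc_jet_bound]. This choice makes it at most 1/4 and also gives r <= 1. *)
  set (r := / (1 + 32 * L)).
  assert (Hr : 0 < r) by (apply Rinv_0_lt_compat; lra).
  assert (Hr1 : r <= 1) by (unfold r; rewrite <- Rinv_1; apply Rinv_le_contravar; lra).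
  assert (HLr : 8 * L * r <= / 4).
  { unfold r; apply Rmult_le_reg_r with (1 + 32 * L); [lra|].
    rewrite Rmult_assoc, Rinv_l by lra; lra. }
  (* 3 comes from [trunc_jet_bound], 4 from the factor 2^(2m) in the quotient of factorials, and 1 /
     r^2 from r^(-2m). *)
  exists (12 / (r * r)); split; [apply Rdiv_lt_0_compat; nra|].
  intros T b M HM HT Hb.
  set (beta := fun n => b n / rfact n ^ 2).
  assert (Hbeta : forall n, Rabs (beta n) <= M * (4 * L) ^ n).
  { intros n; unfold beta, Rdiv; assert (F := rfact_pos n).
    rewrite Rabs_mult, (Rabs_pos_eq (/ _)) by (left; apply Rinv_0_lt_compat; nra).
    apply Rmult_le_reg_r with (rfact n ^ 2); [nra|].
    rewrite Rmult_assoc, Rinv_l, Rmult_1_r by nra.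
    eapply Rle_trans; [apply Hb|]; rewrite Rmult_assoc; apply Rmult_le_compat_l; [exact HM|].
    rewrite Rpow_mult_distr, (Rmult_comm (4 ^ n)), Rmult_assoc.
    apply Rmult_le_compat_l; [apply pow_le; lra|].
    assert (U := rfact_add_upper n n).
    replace (n + n)%nat with (2 * n)%nat in U by lia; rewrite pow_mult in U.
    replace (2 ^ 2) with 4 in U by ring; simpl (rfact n ^ 2); rewrite Rmult_1_r; exact U. }
  set (W := fun m => M * ((12 / (r * r)) ^ m * rfact (2 * m))).
  assert (B : forall k m s, in_itv (0, T) s ->
    Rabs (beta k * trunc_jet r k m s) <= W m * (/ 4) ^ k).
  { intros k m s [Hs _]; simpl in Hs; rewrite Rabs_mult.
    eapply Rle_trans; [apply Rmult_le_compat; [apply Rabs_pos|apply Rabs_pos|apply Hbeta|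
       apply trunc_jet_bound; auto]|].
    assert (Fk := rfact_pos k); assert (Rk := pow_lt r k Hr).
    assert (R2 := pow_lt r (2 * m) Hr).
    assert (U : rfact (k + 2 * m) / rfact k <= 2 ^ (k + 2 * m) * rfact (2 * m)).
    { apply Rmult_le_reg_r with (rfact k); [assumption|].
      unfold Rdiv; rewrite Rmult_assoc, Rinv_l, Rmult_1_r by lra.
      eapply Rle_trans; [apply rfact_add_upper|]; right; ring. }
    apply Rle_trans with (M * (4 * L) ^ k *
      (3 ^ m * (2 ^ (k + 2 * m) * rfact (2 * m)) * (r ^ k / r ^ (2 * m)))).
    { apply Rmult_le_compat_l; [apply Rmult_le_pos; [exact HM|apply pow_le; lra]|].
      apply Rmult_le_compat_r; [apply Rlt_le, Rdiv_lt_0_compat; assumption|].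
      apply Rmult_le_compat_l; [apply pow_le; lra|exact U]. }
    replace (M * (4 * L) ^ k *
      (3 ^ m * (2 ^ (k + 2 * m) * rfact (2 * m)) * (r ^ k / r ^ (2 * m))))
      with (W m * (8 * L * r) ^ k).
    - apply Rmult_le_compat_l.
      + apply Rmult_le_pos; [exact HM|]; apply Rmult_le_pos; [|apply pos_INR].
        apply pow_le, Rdiv_le_0_compat; nra.
      + apply pow_incr; split; [|exact HLr]; nra.
    - unfold W, Rdiv; rewrite pow_add, !pow_mult.
      replace (12 * / (r * r)) with (3 * 2 ^ 2 * / (r ^ 2)) by (field; lra).
      replace (8 * L * r) with (4 * L * 2 * r) by ring.
      rewrite !Rpow_mult_distr, pow_inv; ring. }
  exists (fun m s => Series (fun k => beta k * trunc_jet r k m s)).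
  split; [|split].
  - apply (jet1_Series (0, T) (fun k m s => beta k * trunc_jet r k m s) W (fun k => (/ 4) ^ k)).
    + intros k n s Hs; apply is_deriv_on_scal; auto.
      apply is_derive_deriv_on; auto; now apply is_derive_trunc_jet.
    + apply ex_series_quarter.
    + exact B.
  - intros n.
    rewrite (Series_ext _ (fun k => beta n * (rfact n ^ 2 * (if Nat.eqb k n then 1 else 0)))).
    2: { intros k; rewrite trunc_jet_0; destruct (Nat.eqb_spec k n) as [->|]; ring. }
    rewrite !Series_scal_l.
    replace (Series (fun k => if Nat.eqb k n then 1 else 0)) with 1.
    { unfold beta; field; generalize (rfact_pos n); lra. }
    symmetry; apply is_series_unique, is_series_indicator.
  - intros n s Hs; eapply Rle_trans.
    + apply (Series_dom _ (fun k => W n * (/ 4) ^ k)); [intros; now apply B|].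
      apply (ex_series_scal_l (W n) _ ex_series_quarter).
    + rewrite (Series_scal_l _ (fun k => (/ 4) ^ k)), Series_quarter.
      unfold W; assert (0 <= M * ((12 / (r * r)) ^ n * rfact (2 * n))); [|lra].
      apply Rmult_le_pos; [exact HM|]; apply Rmult_le_pos; [|apply pos_INR].
      apply pow_le, Rdiv_le_0_compat; nra.
Qed.

(** Time is reversed: a Borel function with data (-1)^n b_n at 0, times a cutoff equal to 1 to
    infinite order at 0 and flat at T, is composed with T - t. The constants A and K are chosen
    before b and M, so they serve every mode. *)
Lemma gevrey2_interpolation T L : 0 < T -> 0 < L -> exists A K, 0 < A /\ 0 < K /\
  forall b M, 0 <= M -> (forall n, Rabs (b n) <= M * (L ^ n * rfact (2 * n))) ->
  exists z, jet1 (0, T) z /\ (forall n, z n T = b n) /\ (forall n, z n 0 = 0) /\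
    forall n t, in_itv (0, T) t -> Rabs (z n t) <= M * A * (K ^ n * rfact (2 * n)).
Proof.
  intros HT HL.
  destruct (gevrey2_cutoff T HT) as [Ac [chi [HA [Jc [C0 [CS [CT Bc]]]]]]].
  destruct (gevrey2_borel L HL) as [K0 [HK0 Hborel]].
  set (K := 4 + K0).
  exists (2 * Ac), (2 * K); split; [lra|]; split; [unfold K; lra|].
  intros b M HM Hb.
  destruct (Hborel T (fun n => (-1) ^ n * b n) M HM HT) as [f [Jf [F0 Bf]]].
  { intros n; rewrite Rabs_pow_m1_mult; apply Hb. }
  exists (fun n t => (-1) ^ n * jet_mul f chi n 0 0 (T - t)).
  split; [apply (jet1_reflect T (fun n => jet_mul f chi n 0 0)), (jet_mul_jet _ f chi Jf Jc)|].
  split; [|split].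
  - intros n; rewrite Rminus_diag, jet_mul_1_r by assumption.
    change (0 + n)%nat with n; rewrite F0, <- Rmult_assoc, <- Rpow_mult_distr.
    replace (-1 * -1) with 1 by ring; rewrite pow1; ring.
  - intros n; rewrite Rminus_0_r, jet_mul_0_r by assumption; ring.
  - intros n t Ht; rewrite Rabs_pow_m1_mult.
    assert (Ht' : in_itv (0, T) (T - t)) by (destruct Ht; simpl in *; split; simpl; lra).
    assert (Kp : forall c, 0 <= c <= K -> forall n, c ^ n * rfact (2 * n) <= K ^ n * rfact (2 * n)).
    { intros c Hc m; apply Rmult_le_compat_r; [apply pos_INR|]; now apply pow_incr. }
    eapply Rle_trans.
    + apply (jet_mul_bound f chi (2 * M) Ac K); try lra; [unfold K; lra| |].
      * intros m; eapply Rle_trans; [now apply Bf|].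
        apply Rmult_le_compat_l; [lra|]; apply Kp; unfold K; lra.
      * intros m; eapply Rle_trans; [now apply Bc|].
        apply Rmult_le_compat_l; [lra|]; apply Kp; unfold K; lra.
    + change (0 + 0 + n)%nat with n; rewrite Rpow_mult_distr; right; ring.
Qed.

(** * Parametric integrals *)

(** Tube argument: compactness of [a, b] extracts one radius from the local ones. Both f p y and f
    p0 y are compared with f p0 t at a centre t of the cover, whence the halves of eps. *)
Lemma uniform_in_parameter {U : UniformSpace} (D : U -> Prop) (f : U -> R -> R) p0 a b :
  D p0 ->
  (forall y, a <= y <= b -> forall eps, 0 < eps -> exists d, 0 < d /\
     forall p y', D p -> a <= y' <= b -> ball p0 d p -> Rabs (y' - y) < d ->
       Rabs (f p y' - f p0 y) < eps) ->
  forall eps, 0 < eps -> exists d, 0 < d /\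
    forall p y, D p -> a <= y <= b -> ball p0 d p -> Rabs (f p y - f p0 y) < eps.
Proof.
  intros HD0 H eps Heps.
  (* The covering theorem takes a gauge defined on all reals. Outside [a, b] the value 1 is a
     placeholder. *)
  assert (C : forall y, exists d : posreal, a <= y <= b ->
     forall p y', D p -> a <= y' <= b -> ball p0 d p -> Rabs (y' - y) < d ->
       Rabs (f p y' - f p0 y) < eps / 2).
  { intros y; destruct (excluded_middle_informative (a <= y <= b)) as [Hy|Hy].
    - destruct (H y Hy (eps / 2) ltac:(lra)) as [d [Hd Hd']].
      exists (mkposreal d Hd); intros _; exact Hd'.
    - exists (mkposreal 1 Rlt_0_1); intros; contradiction. }
  set (delta := fun y => proj1_sig (constructive_indefinite_description _ (C y))).
  assert (Hdelta : forall y, a <= y <= b -> forall p y', D p -> a <= y' <= b ->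
     ball p0 (delta y) p -> Rabs (y' - y) < delta y -> Rabs (f p y' - f p0 y) < eps / 2)
    by (intros y; apply (proj2_sig (constructive_indefinite_description _ (C y)))).
  destruct (compactness_value_1d a b delta) as [d Hd].
  exists d; split; [apply cond_pos|]; intros p y HD Hy Hp.
  apply NNPP; intros Hn; apply (Hd y Hy); intros [t [Ht [Hyt Hdt]]]; apply Hn.
  assert (A := Hdelta t Ht p y HD Hy (ball_le _ _ _ Hdt _ Hp) Hyt).
  assert (B := Hdelta t Ht p0 y HD0 Hy (ball_center _ _) Hyt).
  replace (f p y - f p0 y) with ((f p y - f p0 t) - (f p0 y - f p0 t)) by ring.
  eapply Rle_lt_trans; [apply Rabs_triang|]; rewrite Rabs_Ropp; lra.
Qed.

Lemma cont2_eps X Y u : cont2 X Y u -> forall x y, in_itv X x -> in_itv Y y ->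
  forall eps, 0 < eps -> exists d, 0 < d /\ forall x' y', in_itv X x' -> in_itv Y y' ->
    Rabs (x' - x) < d -> Rabs (y' - y) < d -> Rabs (u x' y' - u x y) < eps.
Proof.
  intros C x y Hx Hy eps Heps.
  destruct (proj1 (filterlim_locally _ _) (C (x, y) (conj Hx Hy)) (mkposreal eps Heps)) as [d Hd].
  exists d; split; [apply cond_pos|]; intros x' y' Hx' Hy' Dx Dy.
  exact (Hd (x', y') (conj Dx Dy) (conj Hx' Hy')).
Qed.

Lemma cont2_eps_inv X Y u : (forall x y, in_itv X x -> in_itv Y y ->
  forall eps, 0 < eps -> exists d, 0 < d /\ forall x' y', in_itv X x' -> in_itv Y y' ->
    Rabs (x' - x) < d -> Rabs (y' - y) < d -> Rabs (u x' y' - u x y) < eps) -> cont2 X Y u.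
Proof.
  intros H [x y] [Hx Hy]; apply filterlim_locally; intros eps; simpl in *.
  destruct (H x y Hx Hy eps (cond_pos eps)) as [d [Hd H']].
  exists (mkposreal d Hd); intros [x' y'] [Dx Dy] [Hx' Hy'].
  exact (H' x' y' Hx' Hy' Dx Dy).
Qed.

Lemma cont3_eps X Y I u : cont3 X Y I u -> forall x y t,
  in_itv X x -> in_itv Y y -> in_itv I t ->
  forall eps, 0 < eps -> exists d, 0 < d /\ forall x' y' t',
    in_itv X x' -> in_itv Y y' -> in_itv I t' ->
    Rabs (x' - x) < d -> Rabs (y' - y) < d -> Rabs (t' - t) < d ->
    Rabs (u x' y' t' - u x y t) < eps.
Proof.
  intros C x y t Hx Hy Ht eps Heps.
  destruct (proj1 (filterlim_locally _ _) (C (x, y, t) (conj Hx (conj Hy Ht)))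
              (mkposreal eps Heps)) as [d Hd].
  exists d; split; [apply cond_pos|]; intros x' y' t' Hx' Hy' Ht' Dx Dy Dt.
  exact (Hd (x', y', t') (conj (conj Dx Dy) Dt) (conj Hx' (conj Hy' Ht'))).
Qed.

Lemma cont2_swap X Y u : cont2 X Y u -> cont2 Y X (fun y x => u x y).
Proof.
  intros C; apply cont2_eps_inv; intros y x Hy Hx eps Heps.
  destruct (cont2_eps X Y u C x y Hx Hy eps Heps) as [d [Hd H]].
  exists d; split; auto.
Qed.

Lemma cont2_slice X Y u x : fst Y <= snd Y -> cont2 X Y u -> in_itv X x -> cont_on Y (u x).
Proof.
  intros HY C Hx; apply cont_on_eps; auto; intros y Hy eps Heps.
  destruct (cont2_eps X Y u C x y Hx Hy eps Heps) as [d [Hd H]].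
  exists d; split; auto; intros y' Hy' D; apply H; auto.
  rewrite Rminus_diag, Rabs_R0; exact Hd.
Qed.

Lemma cont3_slice X Y I u t : cont3 X Y I u -> in_itv I t -> cont2 X Y (fun x y => u x y t).
Proof.
  intros C Ht; apply cont2_eps_inv; intros x y Hx Hy eps Heps.
  destruct (cont3_eps X Y I u C x y t Hx Hy Ht eps Heps) as [d [Hd H]].
  exists d; split; auto; intros; apply H; auto.
  rewrite Rminus_diag, Rabs_R0; exact Hd.
Qed.

Lemma continuous_on_combine {U : UniformSpace} (D : U -> Prop) (op : R -> R -> R) u v :
  (forall x y, continuous (fun p : R * R => op (fst p) (snd p)) (x, y)) ->
  continuous_on D u -> continuous_on D v -> continuous_on D (fun p => op (u p) (v p)).
Proof.
  intros Hop Hu Hv p Hp.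
  apply (filterlim_comp_2 u v op (Hu p Hp) (Hv p Hp)).
  specialize (Hop (u p) (v p)); intros P HP; specialize (Hop P HP).
  destruct Hop as [d Hd].
  exists (ball (u p) d) (ball (v p) d); [apply locally_ball|apply locally_ball|].
  intros x y Hx Hy; exact (Hd (x, y) (conj Hx Hy)).
Qed.

Lemma continuous_op_plus x y : continuous (fun p : R * R => fst p + snd p) (x, y).
Proof. apply (continuous_plus (@fst R R) (@snd R R)); [apply continuous_fst|apply continuous_snd]. Qed.

Lemma continuous_op_mult x y : continuous (fun p : R * R => fst p * snd p) (x, y).
Proof. apply (continuous_mult (@fst R R) (@snd R R)); [apply continuous_fst|apply continuous_snd]. Qed.

Lemma cont2_plus X Y u v : cont2 X Y u -> cont2 X Y v -> cont2 X Y (fun x y => u x y + v x y).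
Proof. apply (continuous_on_combine _ Rplus), continuous_op_plus. Qed.

Lemma cont2_mult X Y u v : cont2 X Y u -> cont2 X Y v -> cont2 X Y (fun x y => u x y * v x y).
Proof. apply (continuous_on_combine _ Rmult), continuous_op_mult. Qed.

Lemma cont3_plus X Y I u v : cont3 X Y I u -> cont3 X Y I v ->
  cont3 X Y I (fun x y t => u x y t + v x y t).
Proof. apply (continuous_on_combine _ Rplus), continuous_op_plus. Qed.

Lemma cont3_mult X Y I u v : cont3 X Y I u -> cont3 X Y I v ->
  cont3 X Y I (fun x y t => u x y t * v x y t).
Proof. apply (continuous_on_combine _ Rmult), continuous_op_mult. Qed.

Lemma cont2_const X Y c : cont2 X Y (fun _ _ => c).
Proof. intros p Hp; apply filterlim_const. Qed.

Lemma cont3_const X Y I c : cont3 X Y I (fun _ _ _ => c).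
Proof. intros p Hp; apply filterlim_const. Qed.

(** For each y the mean value theorem bounds the first-order remainder by the oscillation of F1 near
    x0, which is small uniformly in y. The denominator 1 + (b - a) covers the degenerate case a =
    b. *)
Lemma is_deriv_on_RInt X a b F F1 x0 : fst X < snd X -> a <= b -> in_itv X x0 ->
  (forall x y, in_itv X x -> a <= y <= b -> is_deriv_on X (fun z => F z y) x (F1 x y)) ->
  (forall x, in_itv X x -> cont_on (a, b) (F x)) ->
  cont2 X (a, b) F1 ->
  is_deriv_on X (fun x => RInt (F x) a b) x0 (RInt (F1 x0) a b).
Proof.
  intros HX Hab Hx0 HF CF C1.
  assert (Ha : in_itv (a, b) a) by (split; simpl; lra).
  assert (Hb : in_itv (a, b) b) by (split; simpl; lra).
  assert (E : forall x, in_itv X x -> ex_RInt (F x) a b)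
    by (intros; apply (ex_RInt_cont_on (a, b)); auto).
  assert (E1 : ex_RInt (F1 x0) a b)
    by (apply (ex_RInt_cont_on (a, b)); auto; now apply cont2_slice with X).
  apply is_deriv_on_eps; intros eps Heps.
  set (eta := eps / (1 + (b - a))).
  assert (Heta : 0 < eta) by (apply Rdiv_lt_0_compat; lra).
  destruct (uniform_in_parameter (in_itv X) F1 x0 a b Hx0) with (eps := eta) as [d [Hd H]]; auto.
  { intros y Hy e He; destruct (cont2_eps X (a, b) F1 C1 x0 y Hx0 Hy e He) as [d [Hd H]].
    exists d; split; [exact Hd|]; intros p y' Hp Hy' Bp Dy; apply H; auto. }
  exists d; split; [exact Hd|]; intros x Hx Dx.
  assert (HB : forall y, a <= y <= b ->
     Rabs (F x y - F x0 y - (x - x0) * F1 x0 y) <= eta * Rabs (x - x0)).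
  { intros y Hy.
    assert (K : forall c, in_itv X c -> Rabs (c - x0) <= Rabs (x - x0) ->
              F x y - F x0 y = F1 c y * (x - x0) ->
              Rabs (F x y - F x0 y - (x - x0) * F1 x0 y) <= eta * Rabs (x - x0)).
    { intros c Hc Hcx ->.
      replace (F1 c y * (x - x0) - (x - x0) * F1 x0 y) with ((F1 c y - F1 x0 y) * (x - x0)) by ring.
      rewrite Rabs_mult; apply Rmult_le_compat_r; [apply Rabs_pos|].
      left; apply H; auto.
      exact (Rle_lt_trans _ _ _ Hcx Dx). }
    destruct (Rtotal_order x0 x) as [L|[<-|L]].
    - destruct (MVT_deriv_on X (fun z => F z y) (fun z => F1 z y) x0 x) as [c [Hc E']]; auto.
      apply (K c); auto; [destruct Hx0, Hx; split; lra|rewrite !Rabs_pos_eq; lra].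
    - apply (K x0); auto; [lra|ring].
    - destruct (MVT_deriv_on X (fun z => F z y) (fun z => F1 z y) x x0) as [c [Hc E']]; auto.
      apply (K c); auto; [destruct Hx0, Hx; split; lra|rewrite !Rabs_left; lra|lra]. }
  assert (EQ : RInt (F x) a b - RInt (F x0) a b - RInt (F1 x0) a b * (x - x0) =
               RInt (fun y => F x y - F x0 y - (x - x0) * F1 x0 y) a b).
  { symmetry; apply is_RInt_unique.
    rewrite (Rmult_comm _ (x - x0)).
    apply (is_RInt_minus (fun y => F x y - F x0 y) (fun y => (x - x0) * F1 x0 y)).
    - apply (is_RInt_minus (F x) (F x0)); apply (@RInt_correct R_CompleteNormedModule); auto.
    - apply (is_RInt_scal (F1 x0)), (@RInt_correct R_CompleteNormedModule), E1. }
  rewrite EQ; eapply Rle_trans.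
  - apply RInt_bound with (M := eta * Rabs (x - x0)); auto.
    apply (ex_RInt_minus (fun y => F x y - F x0 y) (fun y => (x - x0) * F1 x0 y)).
    + apply (ex_RInt_minus (F x) (F x0)); auto.
    + apply (ex_RInt_scal (F1 x0)), E1.
  - assert (P := Rabs_pos (x - x0)).
    assert (eta * (b - a) <= eps).
    { apply Rle_trans with (eta * (1 + (b - a))); [nra|].
      unfold eta; right; field; lra. }
    nra.
Qed.

Lemma cont2_RInt X I a b u : a <= b -> cont3 X (a, b) I u ->
  cont2 X I (fun x t => RInt (fun y => u x y t) a b).
Proof.
  intros Hab C; apply cont2_eps_inv; intros x t Hx Ht eps Heps.
  set (eta := eps / (2 + (b - a))).
  assert (Heta : 0 < eta) by (apply Rdiv_lt_0_compat; lra).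
  destruct (uniform_in_parameter (fun p : R * R => in_itv X (fst p) /\ in_itv I (snd p))
    (fun p y => u (fst p) y (snd p)) (x, t) a b (conj Hx Ht)) with (eps := eta) as [d [Hd H]]; auto.
  { intros y Hy e He; destruct (cont3_eps X (a, b) I u C x y t Hx Hy Ht e He) as [d [Hd H]].
    exists d; split; [exact Hd|]; intros [x' t'] y' [Hx' Ht'] Hy' [Bx Bt] Dy; apply H; auto. }
  exists d; split; [exact Hd|]; intros x' t' Hx' Ht' Dx Dt.
  assert (Ha : in_itv (a, b) a) by (split; simpl; lra).
  assert (Hb : in_itv (a, b) b) by (split; simpl; lra).
  assert (E : forall x t, in_itv X x -> in_itv I t -> ex_RInt (fun y => u x y t) a b).
  { intros z s Hz Hs; apply (ex_RInt_cont_on (a, b)); auto.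
    apply (cont2_slice X (a, b) (fun x y => u x y s) z); auto.
    now apply cont3_slice with I. }
  replace (RInt (fun y => u x' y t') a b - RInt (fun y => u x y t) a b)
    with (RInt (fun y => u x' y t' - u x y t) a b)
    by (apply is_RInt_unique, (is_RInt_minus (fun y => u x' y t') (fun y => u x y t));
        apply (@RInt_correct R_CompleteNormedModule); auto).
  apply Rle_lt_trans with (eta * (b - a)).
  - apply RInt_bound; auto.
    + apply (ex_RInt_minus (fun y => u x' y t') (fun y => u x y t)); auto.
    + intros y Hy; left; apply (H (x', t') y (conj Hx' Ht') Hy (conj Dx Dt)).
  - apply Rlt_le_trans with (eta * (2 + (b - a))); [nra|].
    unfold eta; right; field; lra.
Qed.

(** The remainder after n terms is at most the tail of m, uniformly in y. Continuity of the sum is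
    an assumption because the intended application obtains it from termwise differentiation. *)
Lemma RInt_Series a b (h : nat -> R -> R) m : a <= b ->
  (forall k, cont_on (a, b) (h k)) -> ex_series m ->
  (forall k y, a <= y <= b -> Rabs (h k y) <= m k) ->
  cont_on (a, b) (fun y => Series (fun k => h k y)) ->
  is_series (fun k => RInt (h k) a b) (RInt (fun y => Series (fun k => h k y)) a b).
Proof.
  intros Hab Ch Hm HM CS.
  assert (Ha : in_itv (a, b) a) by (split; simpl; lra).
  assert (Hb : in_itv (a, b) b) by (split; simpl; lra).
  assert (E : forall k, ex_RInt (h k) a b) by (intros; apply (ex_RInt_cont_on (a, b)); auto).
  assert (ES := ex_RInt_cont_on (a, b) _ a b Hab Ha Hb CS).
  assert (EN : forall n, is_RInt (fun y => sum_n (fun k => h k y) n) a b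
                         (sum_n (fun k => RInt (h k) a b) n)).
  { induction n as [|n IH].
    - apply is_RInt_ext with (h O); [intros; now rewrite sum_O|].
      rewrite sum_O; now apply (@RInt_correct R_CompleteNormedModule).
    - apply is_RInt_ext with (fun y => plus (sum_n (fun k => h k y) n) (h (S n) y));
        [intros; now rewrite sum_Sn|].
      rewrite sum_Sn; apply (is_RInt_plus (fun y => sum_n (fun k => h k y) n) (h (S n))); auto.
      now apply (@RInt_correct R_CompleteNormedModule). }
  assert (Hs : is_lim_seq (fun n => Series m - sum_n m n) 0).
  { replace (Finite 0) with (Finite (Series m - Series m)) by (f_equal; ring).
    apply (is_lim_seq_minus' (fun _ => Series m)); [apply is_lim_seq_const|].
    apply (Series_correct m Hm). }
  assert (Bd : forall n, Rabs (sum_n (fun k => RInt (h k) a b) n -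
             RInt (fun y => Series (fun k => h k y)) a b) <= (Series m - sum_n m n) * (b - a)).
  { intros n; rewrite Rabs_minus_sym.
    replace (RInt (fun y => Series (fun k => h k y)) a b - sum_n (fun k => RInt (h k) a b) n)
      with (RInt (fun y => Series (fun k => h k y) - sum_n (fun k => h k y) n) a b).
    2: { apply is_RInt_unique, (is_RInt_minus (fun y => Series (fun k => h k y))); auto.
         now apply (@RInt_correct R_CompleteNormedModule). }
    apply RInt_bound; auto.
    { apply (ex_RInt_minus (fun y => Series (fun k => h k y))); auto; eexists; apply EN. }
    intros y Hy.
    assert (Ey : ex_series (fun k => h k y)) by (apply ex_series_dom with m; auto).
    rewrite (Series_incr_n (fun k => h k y) (S n)), (Series_incr_n m (S n)) by (auto; lia).
    rewrite !sum_n_Reals; simpl pred.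
    replace (sum_f_R0 (fun k => h k y) n + Series (fun k => h (S n + k)%nat y) -
       sum_f_R0 (fun k => h k y) n) with (Series (fun k => h (S n + k)%nat y)) by ring.
    replace (sum_f_R0 m n + Series (fun k => m (S n + k)%nat) - sum_f_R0 m n)
      with (Series (fun k => m (S n + k)%nat)) by ring.
    apply Series_dom; [intros; now apply HM|].
    now apply (ex_series_incr_n m (S n)). }
  change (is_lim_seq (sum_n (fun k => RInt (h k) a b)) (RInt (fun y => Series (fun k => h k y)) a b)).
  apply is_lim_seq_ext with (fun n => (sum_n (fun k => RInt (h k) a b) n -
     RInt (fun y => Series (fun k => h k y)) a b) + RInt (fun y => Series (fun k => h k y)) a b);
    [intros; ring|].
  replace (Finite (RInt (fun y => Series (fun k => h k y)) a b))
    with (Finite (0 + RInt (fun y => Series (fun k => h k y)) a b)) by (f_equal; ring).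
  apply is_lim_seq_plus'; [|apply is_lim_seq_const].
  apply is_lim_seq_abs_0.
  apply is_lim_seq_le_le with (fun _ => 0) (fun n => (Series m - sum_n m n) * (b - a)).
  - intros n; split; [apply Rabs_pos|apply Bd].
  - apply is_lim_seq_const.
  - replace (Finite 0) with (Finite (0 * (b - a))) by (f_equal; ring).
    apply is_lim_seq_mult'; [exact Hs|apply is_lim_seq_const].
Qed.

(** * Sine series *)

Lemma Iy_lt : fst Iy < snd Iy.
Proof. simpl; lra. Qed.

Definition sinj (j : nat) (y : R) : R := sin (INR j * PI * y).
Definition cosj (j : nat) (y : R) : R := cos (INR j * PI * y).

Lemma efun_sinj j y : efun j y = sqrt 2 * sinj j y.
Proof. reflexivity. Qed.

Lemma is_derive_sinj j y : is_derive (sinj j) y (INR j * PI * cosj j y).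
Proof. unfold sinj, cosj; auto_derive; auto; ring. Qed.

Lemma is_derive_cosj j y : is_derive (cosj j) y (- (INR j * PI) * sinj j y).
Proof. unfold sinj, cosj; auto_derive; auto; ring. Qed.

Lemma continuous_sinj j y : continuous (sinj j) y.
Proof. apply (ex_derive_continuous (sinj j)); eexists; apply is_derive_sinj. Qed.

Lemma continuous_cosj j y : continuous (cosj j) y.
Proof. apply (ex_derive_continuous (cosj j)); eexists; apply is_derive_cosj. Qed.

Lemma sinj_0 j : sinj j 0 = 0.
Proof. unfold sinj; rewrite Rmult_0_r; apply sin_0. Qed.

Lemma sin_INR_PI j : sin (INR j * PI) = 0.
Proof. apply sin_eq_0_1; exists (Z.of_nat j); now rewrite INR_IZR_INZ. Qed.

Lemma sinj_1 j : sinj j 1 = 0.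
Proof. unfold sinj; rewrite Rmult_1_r; apply sin_INR_PI. Qed.

Lemma sinj_bound j y : Rabs (sinj j y) <= 1.
Proof. apply Rabs_le, SIN_bound. Qed.

Lemma sinj_cos j y : sinj (S j) y * cos (PI * y) = (sinj (S (S j)) y + sinj j y) / 2.
Proof.
  unfold sinj.
  replace (INR (S (S j)) * PI * y) with (INR (S j) * PI * y + PI * y) by (rewrite !S_INR; ring).
  replace (INR j * PI * y) with (INR (S j) * PI * y - PI * y) by (rewrite !S_INR; ring).
  rewrite sin_plus, sin_minus; field.
Qed.

(** * Completeness of the sine system *)

Lemma RInt_ext_R (f g : R -> R) a b :
  (forall x, Rmin a b < x < Rmax a b -> f x = g x) -> RInt f a b = RInt g a b :> R.
Proof. intros H; now apply (RInt_ext f g). Qed.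

Lemma ex_RInt_cont (f : R -> R) a b : (forall x, continuous f x) -> ex_RInt f a b.
Proof. intros H; apply (@ex_RInt_continuous R_CompleteNormedModule); intros; apply H. Qed.

Lemma RInt_plus_cont (f g : R -> R) a b : (forall x, continuous f x) -> (forall x, continuous g x) ->
  RInt (fun x => f x + g x) a b = RInt f a b + RInt g a b :> R.
Proof. intros; apply (RInt_plus f g); now apply ex_RInt_cont. Qed.

Lemma RInt_scal_cont (f : R -> R) c a b : (forall x, continuous f x) ->
  RInt (fun x => c * f x) a b = c * RInt f a b :> R.
Proof. intros; apply (RInt_scal f); now apply ex_RInt_cont. Qed.

(** Orthogonality of d to all sines with weight m. The admissible weights contain 1 and are stable
    under linear combinations and multiplication by cos(pi y), hence contain the powers of [bump].
    The index j = 0, where the condition is trivial, is included so that multiplication by the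
    cosine may lower the index by one. *)
Definition sine_null (d m : R -> R) : Prop := (forall y, continuous m y) /\
  forall j, RInt (fun y => d y * (sinj j y * m y)) 0 1 = 0 :> R.

Lemma sine_null_cont d m j : (forall y, continuous d y) -> (forall y, continuous m y) ->
  forall y, continuous (fun y => d y * (sinj j y * m y)) y.
Proof.
  intros Hd Hm y; apply (continuous_mult d); auto.
  apply (continuous_mult (sinj j)); auto using continuous_sinj.
Qed.

Lemma sine_null_1 d :
  (forall j, (1 <= j)%nat -> RInt (fun y => d y * sinj j y) 0 1 = 0 :> R) ->
  sine_null d (fun _ => 1).
Proof.
  intros d_orth; split; [intros; apply continuous_const|]; intros j.
  destruct j as [|j].
  - rewrite (RInt_ext_R _ (fun _ => 0)).
    + rewrite RInt_const; apply Rmult_0_r.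
    + intros; unfold sinj; simpl; rewrite !Rmult_0_l, sin_0; ring.
  - etransitivity; [|apply (d_orth (S j)); lia]; apply RInt_ext_R; intros; ring.
Qed.

Lemma sine_null_plus d m1 m2 c1 c2 : (forall y, continuous d y) ->
  sine_null d m1 -> sine_null d m2 -> sine_null d (fun y => c1 * m1 y + c2 * m2 y).
Proof.
  intros Hd [C1 N1] [C2 N2]; split.
  - intros y; apply (continuous_plus (fun y => c1 * m1 y) (fun y => c2 * m2 y));
      [apply (continuous_scal_r c1 m1)|apply (continuous_scal_r c2 m2)]; auto.
  - intros j; rewrite (RInt_ext_R _ (fun y => c1 * (d y * (sinj j y * m1 y)) +
                                        c2 * (d y * (sinj j y * m2 y)))) by (intros; ring).
    assert (K1 := sine_null_cont d m1 j Hd C1); assert (K2 := sine_null_cont d m2 j Hd C2).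
    rewrite RInt_plus_cont, !RInt_scal_cont, N1, N2; try ring; auto.
    + intros y; apply (continuous_scal_r c1 (fun y => d y * (sinj j y * m1 y))); auto.
    + intros y; apply (continuous_scal_r c2 (fun y => d y * (sinj j y * m2 y))); auto.
Qed.

Lemma continuous_cos_PI y : continuous (fun y => cos (PI * y)) y.
Proof.
  apply continuous_ext with (cosj 1); [|apply continuous_cosj].
  intros t; unfold cosj; simpl; f_equal; ring.
Qed.

Lemma sine_null_cos d m : (forall y, continuous d y) ->
  sine_null d m -> sine_null d (fun y => cos (PI * y) * m y).
Proof.
  intros Hd [C N]; split.
  - intros y; apply (continuous_mult (fun y => cos (PI * y)) m); auto using continuous_cos_PI.
  - intros [|j].
    + etransitivity; [|apply (N O)]; apply RInt_ext_R; intros; unfold sinj; simpl.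
      rewrite !Rmult_0_l, sin_0; ring.
    + rewrite (RInt_ext_R _ (fun y => / 2 * (d y * (sinj (S (S j)) y * m y)) +
                                  / 2 * (d y * (sinj j y * m y)))).
      * assert (K1 := sine_null_cont d m (S (S j)) Hd C); assert (K2 := sine_null_cont d m j Hd C).
        rewrite RInt_plus_cont, !RInt_scal_cont, !N; try ring; auto.
        -- intros y; apply (continuous_scal_r (/ 2) (fun y => d y * (sinj (S (S j)) y * m y))); auto.
        -- intros y; apply (continuous_scal_r (/ 2) (fun y => d y * (sinj j y * m y))); auto.
      * intros y _; rewrite <- (Rmult_assoc (sinj (S j) y)), sinj_cos; field.
Qed.

(** For c = cos(pi y0) this is a peak function, a polynomial in cos(pi y): on [0, 1] it equals 1 at
    y0 only. Division by 4, the largest possible square, keeps it nonnegative. *)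
Definition bump (c y : R) : R := 1 - (cos (PI * y) - c) ^ 2 / 4.

Lemma sine_null_bump d c m : (forall y, continuous d y) ->
  sine_null d m -> sine_null d (fun y => bump c y * m y).
Proof.
  intros Hd H.
  assert (H1 := sine_null_cos _ _ Hd H); assert (H2 := sine_null_cos _ _ Hd H1).
  assert (H3 := sine_null_plus _ _ _ (1 - c ^ 2 / 4) (c / 2) Hd H H1).
  assert (H4 := sine_null_plus _ _ _ 1 (- / 4) Hd H3 H2); simpl in H4.
  destruct H4 as [C N]; split.
  - intros y; eapply continuous_ext; [|apply C]; intros t; unfold bump; simpl; field.
  - intros j; etransitivity; [|apply (N j)]; apply RInt_ext_R; intros t _; unfold bump; simpl; field.
Qed.

Lemma sine_null_bump_pow d c n : (forall y, continuous d y) ->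
  (forall j, (1 <= j)%nat -> RInt (fun y => d y * sinj j y) 0 1 = 0 :> R) ->
  sine_null d (fun y => bump c y ^ n).
Proof.
  intros Hd Ho.
  induction n as [|n IH]; [now apply sine_null_1 | exact (sine_null_bump d c _ Hd IH)].
Qed.

Lemma bump_bounds c y : -1 <= c <= 1 -> 0 <= bump c y <= 1.
Proof.
  intros Hc; unfold bump; assert (B := COS_bound (PI * y)).
  assert (0 <= (cos (PI * y) - c) ^ 2 <= 4) by (split; [apply pow2_ge_0|simpl; nra]).
  lra.
Qed.

(** Monotonicity of the cosine on [0, pi]: outside the e-neighbourhood of y0 the deviation from
    cos(pi y0) is at least the one at the endpoint of the neighbourhood on the same side. *)
Lemma bump_far y0 e y : 0 < e -> 0 <= y0 - e -> y0 + e <= 1 -> 0 <= y <= 1 ->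
  e <= Rabs (y - y0) ->
  bump (cos (PI * y0)) y <=
    Rmax (bump (cos (PI * y0)) (y0 - e)) (bump (cos (PI * y0)) (y0 + e)).
Proof.
  intros He H0 H1 Hy Hd; assert (P := PI_RGT_0).
  assert (M : forall u v, 0 <= u -> u <= v -> v <= 1 -> cos (PI * v) <= cos (PI * u))
    by (intros; apply cos_decr_1; nra).
  assert (A1 := M (y0 - e) y0 ltac:(lra) ltac:(lra) ltac:(lra)).
  assert (A2 := M y0 (y0 + e) ltac:(lra) ltac:(lra) ltac:(lra)).
  unfold Rabs in Hd; destruct Rcase_abs.
  - eapply Rle_trans; [|apply Rmax_l].
    assert (A := M y (y0 - e) ltac:(lra) ltac:(lra) ltac:(lra)).
    unfold bump; apply Rplus_le_compat_l, Ropp_le_contravar, Rmult_le_compat_r; [lra|].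
    simpl; nra.
  - eapply Rle_trans; [|apply Rmax_r].
    assert (A := M (y0 + e) y ltac:(lra) ltac:(lra) ltac:(lra)).
    unfold bump; apply Rplus_le_compat_l, Ropp_le_contravar, Rmult_le_compat_r; [lra|].
    simpl; nra.
Qed.

Lemma bump_lt1 y0 y : 0 <= y0 <= 1 -> 0 <= y <= 1 -> y <> y0 -> bump (cos (PI * y0)) y < 1.
Proof.
  intros H0 H1 Hne; unfold bump; assert (P := PI_RGT_0).
  assert (cos (PI * y) <> cos (PI * y0)).
  { destruct (Rtotal_order y y0) as [L|[L|L]]; [|contradiction|].
    - apply Rgt_not_eq, cos_decreasing_1; nra.
    - apply Rlt_not_eq, cos_decreasing_1; nra. }
  assert (0 < (cos (PI * y) - cos (PI * y0)) ^ 2) by (apply pow2_gt_0; lra).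
  lra.
Qed.

(* The powers of [bump] concentrate at [y0]. *)
Lemma sine_moments_nonpos d y0 : (forall y, continuous d y) ->
  (forall j, (1 <= j)%nat -> RInt (fun y => d y * sinj j y) 0 1 = 0 :> R) ->
  0 < y0 < 1 -> d y0 <= 0.
Proof.
  intros d_cont d_orth Hy0; apply Rnot_lt_le; intros Hd.
  set (c := cos (PI * y0)).
  assert (Hc : -1 <= c <= 1) by apply COS_bound.
  assert (P := PI_RGT_0).
  (* Testing against the first sine, which is positive on (0, 1), keeps the sign of d at y0. *)
  set (w := fun y => d y * sinj 1 y).
  assert (Cw : forall y, continuous w y)
    by (intros; apply (continuous_mult d); auto using continuous_sinj).
  assert (Cb : forall y, continuous (bump c) y).
  { intros y; eapply continuous_ext; [|apply (proj1 (sine_null_bump_pow d c 1 d_cont d_orth))].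
    intros; simpl; ring. }
  assert (W0 : 0 < w y0).
  { apply Rmult_lt_0_compat; auto; unfold sinj; simpl; rewrite Rmult_1_l.
    apply sin_gt_0; nra. }
  set (delta := w y0 / 2).
  assert (Hdelta : 0 < delta) by (unfold delta; lra).
  destruct (proj1 (filterlim_locally _ _) (Cw y0) (mkposreal delta Hdelta)) as [e1 He1].
  set (e := Rmin (e1 / 2) (Rmin (y0 / 2) ((1 - y0) / 2))).
  assert (He : 0 < e /\ e < e1 /\ e < y0 /\ e < 1 - y0).
  { unfold e; assert (X := cond_pos e1).
    assert (A1 := Rmin_l (e1 / 2) (Rmin (y0 / 2) ((1 - y0) / 2))).
    assert (A2 := Rmin_r (e1 / 2) (Rmin (y0 / 2) ((1 - y0) / 2))).
    assert (A3 := Rmin_l (y0 / 2) ((1 - y0) / 2)).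
    assert (A4 := Rmin_r (y0 / 2) ((1 - y0) / 2)).
    split; [repeat apply Rmin_pos; lra | lra]. }
  destruct He as [He [Ee1 [Ee2 Ee3]]].
  assert (Wd : forall y, Rabs (y - y0) <= e -> delta <= w y).
  { intros y Hy; assert (B : ball y0 e1 y) by (apply Rle_lt_trans with (1 := Hy); exact Ee1).
    specialize (He1 y B); apply Rabs_lt_between' in He1; simpl in He1.
    unfold delta in *; lra. }
  set (q := Rmax (bump c (y0 - e)) (bump c (y0 + e))).
  assert (Q0 : 0 <= q) by (eapply Rle_trans; [|apply Rmax_l]; now apply bump_bounds).
  assert (Q1 : q < 1) by (apply Rmax_lub_lt; apply bump_lt1; lra).
  (* Off the e-neighbourhood [bump] is at most q; on the smaller e'-neighbourhood it is at least q'
     > q. Hence the N-th powers have ratio at most (q / q')^N, which tends to 0. *)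
  set (q' := (1 + q) / 2).
  destruct (proj1 (filterlim_locally _ _) (Cb y0) (mkposreal ((1 - q) / 2) ltac:(lra))) as [e2 He2].
  set (e' := Rmin e (e2 / 2)).
  assert (He' : 0 < e' /\ e' <= e /\ e' < e2).
  { assert (X := cond_pos e2); unfold e'; split; [apply Rmin_pos; lra|].
    assert (A1 := Rmin_l e (e2 / 2)); assert (A2 := Rmin_r e (e2 / 2)); lra. }
  destruct He' as [He'0 [He'1 He'2]].
  assert (Bn : forall y, Rabs (y - y0) <= e' -> q' <= bump c y).
  { intros y Hy; assert (B : ball y0 e2 y) by (apply Rle_lt_trans with (1 := Hy); exact He'2).
    specialize (He2 y B); apply Rabs_lt_between' in He2; simpl in He2.
    assert (bump c y0 = 1) by (unfold bump, c; field); unfold q'; lra. }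
  destruct (continuity_ab_maj (fun y => Rabs (w y)) 0 1) as [ym [HM _]]; [lra| |].
  { intros y _; apply continuity_pt_filterlim.
    apply (continuous_comp w Rabs); [apply Cw|apply continuous_Rabs]. }
  set (M := Rabs (w ym)); fold M in HM.
  assert (M0 : 0 <= M) by apply Rabs_pos.
  assert (Q'0 : 0 < q') by (unfold q'; lra).
  destruct (pow_lt_1_zero (q / q')) with (y := 2 * e' * delta / (1 + M)) as [N HN].
  { rewrite Rabs_pos_eq by (apply Rdiv_le_0_compat; lra).
    apply Rmult_lt_reg_r with q'; [lra|]; unfold Rdiv; rewrite Rmult_assoc, Rinv_l by lra.
    unfold q'; lra. }
  { apply Rdiv_lt_0_compat; [|lra]; apply Rmult_lt_0_compat; [|exact Hdelta]; lra. }
  specialize (HN N (Nat.le_refl N)).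
  rewrite Rabs_pos_eq in HN by (apply pow_le, Rdiv_le_0_compat; lra).
  set (F := fun y => w y * bump c y ^ N).
  assert (CF : forall y, continuous F y).
  { intros y; apply (continuous_mult w); auto; apply (proj1 (sine_null_bump_pow d c N d_cont d_orth)). }
  assert (I0 : RInt F 0 1 = 0).
  { etransitivity; [|apply (proj2 (sine_null_bump_pow d c N d_cont d_orth) 1%nat)].
    apply RInt_ext_R; intros; unfold F, w; simpl; ring. }
  (* This lower bound holds on any subinterval: where y is within e of y0 the integrand is
     nonnegative, elsewhere [bump] is at most q. It is used on both sides of the
     e'-neighbourhood. *)
  assert (Lo : forall u v, 0 <= u -> u <= v -> v <= 1 -> - (M * q ^ N) * (v - u) <= RInt F u v).
  { intros u v Hu Huv Hv.
    replace (- (M * q ^ N) * (v - u)) with (RInt (fun _ => - (M * q ^ N)) u v)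
      by (rewrite RInt_const; apply Rmult_comm).
    apply RInt_le; auto; [apply ex_RInt_const|now apply ex_RInt_cont|].
    intros y Hy; assert (B := bump_bounds c y Hc); unfold F.
    assert (0 <= M * q ^ N) by (apply Rmult_le_pos; auto; now apply pow_le).
    destruct (Rle_lt_dec (Rabs (y - y0)) e) as [Hn|Hn].
    - apply Rle_trans with 0; [lra|]; apply Rmult_le_pos; [|apply pow_le; lra].
      specialize (Wd y Hn); lra.
    - assert (Bq : bump c y ^ N <= q ^ N)
        by (apply pow_incr; split; [lra|]; apply bump_far; lra).
      specialize (HM y ltac:(lra)).
      assert (W := Rabs_le_between (w y) (Rabs (w y))); destruct W as [W _].
      specialize (W (Rle_refl _)).
      assert (0 <= bump c y ^ N) by (apply pow_le; lra).
      nra. }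
  assert (Mid : delta * q' ^ N * (2 * e') <= RInt F (y0 - e') (y0 + e')).
  { replace (delta * q' ^ N * (2 * e')) with (RInt (fun _ => delta * q' ^ N) (y0 - e') (y0 + e')).
    2: { rewrite RInt_const; unfold scal; simpl; unfold mult; simpl; ring. }
    apply RInt_le; [lra|apply ex_RInt_const|now apply ex_RInt_cont|].
    intros y Hy; assert (Hy' : Rabs (y - y0) <= e') by (apply Rabs_le; lra).
    unfold F; apply Rmult_le_compat; [lra|apply pow_le; lra|apply Wd; lra|].
    apply pow_incr; split; [lra|now apply Bn]. }
  assert (L1 := Lo 0 (y0 - e') ltac:(lra) ltac:(lra) ltac:(lra)).
  assert (L2 := Lo (y0 + e') 1 ltac:(lra) ltac:(lra) ltac:(lra)).
  assert (Sp : RInt F 0 1 = RInt F 0 (y0 - e') + RInt F (y0 - e') (y0 + e') + RInt F (y0 + e') 1 :> R).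
  { rewrite <- (RInt_Chasles F 0 (y0 + e') 1), <- (RInt_Chasles F 0 (y0 - e') (y0 + e'))
      by now apply ex_RInt_cont.
    reflexivity. }
  assert (QN : 0 < q' ^ N) by now apply pow_lt.
  assert (K : M * q ^ N < delta * q' ^ N * (2 * e')).
  { replace (q ^ N) with ((q / q') ^ N * q' ^ N)
      by (rewrite <- Rpow_mult_distr; f_equal; field; lra).
    assert (R0 : 0 <= (q / q') ^ N) by (apply pow_le, Rdiv_le_0_compat; lra).
    apply (Rmult_lt_compat_r (1 + M)) in HN; [|lra].
    unfold Rdiv in HN at 2; rewrite Rmult_assoc, Rinv_l in HN by lra.
    nra. }
  assert (0 <= M * q ^ N) by (apply Rmult_le_pos; auto; now apply pow_le).
  rewrite I0 in Sp; nra.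
Qed.

(** The one-sided statement is applied to d and to its opposite, after d has been extended by
    constants to a continuous function on the line. *)
Lemma sine_complete d : cont_on Iy d ->
  (forall j, (1 <= j)%nat -> RInt (fun y => d y * efun j y) 0 1 = 0 :> R) ->
  forall y, 0 < y < 1 -> d y = 0.
Proof.
  intros Cd Od y Hy.
  set (dc := fun y => d (clamp Iy y)).
  assert (E : forall z, 0 < z < 1 -> dc z = d z)
    by (intros; unfold dc; rewrite clamp_id; [reflexivity|split; simpl; lra]).
  assert (S2 : 0 < sqrt 2) by (apply sqrt_lt_R0; lra).
  assert (O : forall j, (1 <= j)%nat -> RInt (fun y => dc y * sinj j y) 0 1 = 0 :> R).
  { intros j Hj; apply Rmult_eq_reg_l with (sqrt 2); [|lra].
    rewrite <- RInt_scal_cont.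
    - rewrite Rmult_0_r; etransitivity; [|apply (Od j Hj)]; apply RInt_ext_R; intros z Hz.
      rewrite Rmin_left, Rmax_right in Hz by lra.
      rewrite E by assumption; rewrite efun_sinj; ring.
    - intros z; apply (continuous_mult dc); [apply Cd|apply continuous_sinj]. }
  rewrite <- (E y Hy); apply Rle_antisym.
  - apply (sine_moments_nonpos dc); auto; intros z; apply Cd.
  - apply Ropp_le_cancel; rewrite Ropp_0.
    apply (sine_moments_nonpos (fun y => - dc y)); auto.
    + intros z; apply (continuous_opp dc), Cd.
    + intros j Hj; transitivity ((-1) * RInt (fun y => dc y * sinj j y) 0 1);
        [|rewrite (O j Hj); ring].
      rewrite <- RInt_scal_cont.
      * apply RInt_ext_R; intros; ring.
      * intros z; apply (continuous_mult dc); [apply Cd|apply continuous_sinj].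
Qed.

(** * Orthonormality and pointwise sine series *)

Lemma lambda_sq j : lambda j = (INR j * PI) ^ 2.
Proof. reflexivity. Qed.

Lemma efun_orth j k : (1 <= j)%nat -> (1 <= k)%nat ->
  RInt (fun y => efun j y * efun k y) 0 1 = (if Nat.eqb j k then 1 else 0) :> R.
Proof.
  intros Hj Hk; assert (P := PI_RGT_0).
  assert (Nj : 0 < INR j) by (apply lt_0_INR; lia).
  assert (Nk : 0 < INR k) by (apply lt_0_INR; lia).
  assert (S2 : sqrt 2 * sqrt 2 = 2) by (apply sqrt_sqrt; lra).
  assert (Cc : cont_on (0, 1) (fun y => efun j y * efun k y)).
  { apply continuous_cont_on; [simpl; lra|]; intros y.
    apply (continuous_mult (efun j) (efun k)).
    - apply (continuous_scal_r (sqrt 2) (sinj j)), continuous_sinj.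
    - apply (continuous_scal_r (sqrt 2) (sinj k)), continuous_sinj. }
  destruct (Nat.eqb_spec j k) as [->|Hne].
  - set (G := fun y => y - sinj k y * cosj k y / (INR k * PI)).
    rewrite (FTC_on G _ 0 1); auto; [|lra| |].
    + unfold G; rewrite !sinj_0, sinj_1; field; lra.
    + apply continuous_cont_on; [simpl; lra|]; intros y.
      apply (ex_derive_continuous G); unfold G, sinj, cosj; auto_derive; auto.
    + intros y _; unfold G; rewrite !efun_sinj.
      replace (sqrt 2 * sinj k y * (sqrt 2 * sinj k y)) with ((sqrt 2 * sqrt 2) * sinj k y ^ 2)
        by ring; rewrite S2.
      unfold sinj, cosj; auto_derive; auto.
      assert (X := sin2_cos2 (INR k * PI * y)); unfold Rsqr in X.
      set (s := sin (INR k * PI * y)) in *; set (c := cos (INR k * PI * y)) in *.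
      replace (2 * s ^ 2) with (2 * (s * s)) by ring.
      replace (s * s) with (1 - c * c) by lra.
      field_simplify; [|lra]; replace (s ^ 2) with (1 - c * c) by (simpl; lra).
      field; lra.
  - assert (D : INR j - INR k <> 0)
      by (intros X; apply Hne, INR_eq; lra).
    (* Up to a factor this is the Wronskian of the two sines, whose derivative is proportional to
       their product with factor the difference of the eigenvalues. *)
    set (G := fun y => 2 * (INR k * (sinj j y * cosj k y) - INR j * (cosj j y * sinj k y))
                       / ((INR j - INR k) * (INR j + INR k) * PI)).
    rewrite (FTC_on G _ 0 1); auto; [|lra| |].
    + unfold G; rewrite !sinj_0, !sinj_1; field; lra.
    + apply continuous_cont_on; [simpl; lra|]; intros y.
      apply (ex_derive_continuous G); unfold G, sinj, cosj; auto_derive; auto.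
    + intros y _; unfold G; rewrite !efun_sinj.
      replace (sqrt 2 * sinj j y * (sqrt 2 * sinj k y)) with ((sqrt 2 * sqrt 2) * (sinj j y * sinj k y))
        by ring; rewrite S2.
      unfold sinj, cosj; auto_derive; auto.
      field; lra.
Qed.

Lemma is_derive_efun_jet j y :
  is_derive (efun j) y (sqrt 2 * (INR j * PI * cosj j y)).
Proof. apply (is_derive_scal (sinj j)), is_derive_sinj. Qed.

Lemma sqrt_2_le_2 : sqrt 2 <= 2.
Proof. rewrite <- (sqrt_pow2 2) at 2 by lra; apply sqrt_le_1; lra. Qed.

Lemma efun_bound j y : Rabs (efun j y) <= 2.
Proof.
  rewrite efun_sinj, Rabs_mult, (Rabs_pos_eq (sqrt 2)) by apply sqrt_pos.
  assert (S2 := sqrt_2_le_2); assert (B := sinj_bound j y); assert (0 <= Rabs (sinj j y)) by apply Rabs_pos.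
  generalize (sqrt_pos 2); nra.
Qed.

(** The quadratic weight on the coefficients allows one termwise differentiation, so the sum is
    continuous. Integrating termwise shows that it has the coefficients of phi, and completeness
    removes the difference on the open interval. *)
Lemma sine_series (phi : R -> R) (c m : nat -> R) : cont_on Iy phi ->
  (forall j, (1 <= j)%nat -> c j = RInt (fun y => phi y * efun j y) 0 1) ->
  ex_series m ->
  (forall j, Rabs (c (S j)) * (1 + (INR (S j) * PI) ^ 2) <= m j) ->
  forall y, 0 < y < 1 -> phi y = Series (fun j => c (S j) * efun (S j) y).
Proof.
  intros Cphi Hc Hm HM y Hy.
  assert (L01 : 0 <= 1) by lra.
  assert (Hm' : ex_series (fun j => 2 * m j)) by apply (ex_series_scal_l 2 m Hm).
  assert (CB : forall j, Rabs (c (S j)) <= m j /\ Rabs (c (S j)) * (INR (S j) * PI) ^ 2 <= m j).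
  { intros j; specialize (HM j); assert (A := Rabs_pos (c (S j))).
    assert (B := pow2_ge_0 (INR (S j) * PI)); split; nra. }
  assert (JP : forall j, 0 <= INR (S j) * PI)
    by (intros; apply Rmult_le_pos; [apply pos_INR|left; apply PI_RGT_0]).
  assert (S2 : 0 <= sqrt 2 <= 2) by (split; [apply sqrt_pos|apply sqrt_2_le_2]).
  assert (Bd : forall j k z, Rabs z <= 1 -> 0 <= k -> Rabs (c (S j)) * k <= m j ->
                 Rabs (c (S j) * (sqrt 2 * (k * z))) <= 2 * m j).
  { intros j k z Hz Hk H; rewrite !Rabs_mult, (Rabs_pos_eq k), (Rabs_pos_eq (sqrt 2)) by lra.
    replace (Rabs (c (S j)) * (sqrt 2 * (k * Rabs z)))
      with (sqrt 2 * ((Rabs (c (S j)) * k) * Rabs z)) by ring.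
    assert (0 <= Rabs z) by apply Rabs_pos.
    assert (0 <= Rabs (c (S j)) * k) by (apply Rmult_le_pos; [apply Rabs_pos|lra]).
    apply Rmult_le_compat; try lra; nra. }
  assert (CosB : forall j z, Rabs (cosj j z) <= 1) by (intros; apply Rabs_le, COS_bound).
  assert (Tail0 : forall j z, Rabs (c (S j) * efun (S j) z) <= 2 * m j).
  { intros j z; replace (c (S j) * efun (S j) z) with (c (S j) * (sqrt 2 * (1 * sinj (S j) z)))
      by (rewrite efun_sinj; ring).
    apply Bd; [apply sinj_bound|lra|]; rewrite Rmult_1_r; apply CB. }
  assert (CS : cont_on Iy (fun y => Series (fun j => c (S j) * efun (S j) y))).
  { apply deriv_cont_on with
      (fun y => Series (fun j => c (S j) * (sqrt 2 * (INR (S j) * PI * cosj (S j) y)))); [simpl; lra|].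
    intros z Hz.
    apply (is_deriv_on_Series Iy (fun j z => c (S j) * efun (S j) z)
      (fun j z => c (S j) * (sqrt 2 * (INR (S j) * PI * cosj (S j) z)))
      (fun j z => c (S j) * (sqrt 2 * (INR (S j) * PI * (- (INR (S j) * PI) * sinj (S j) z))))
      (fun j => 2 * m j)); auto.
    - intros j t Ht; apply is_derive_deriv_on; auto.
      apply (is_derive_scal (efun (S j))), is_derive_efun_jet.
    - intros j t Ht; apply is_derive_deriv_on; auto.
      apply (is_derive_scal (fun t => sqrt 2 * (INR (S j) * PI * cosj (S j) t))).
      apply (is_derive_scal (fun t => INR (S j) * PI * cosj (S j) t)).
      apply (is_derive_scal (cosj (S j))), is_derive_cosj.
    - intros j t Ht.
      replace (INR (S j) * PI * (- (INR (S j) * PI) * sinj (S j) t))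
        with ((INR (S j) * PI) ^ 2 * (- sinj (S j) t)) by ring.
      apply Bd; [rewrite Rabs_Ropp; apply sinj_bound|apply pow2_ge_0|apply CB].
    - intros t Ht; apply ex_series_dom with (fun j => 2 * m j); auto.
    - intros t Ht; apply ex_series_dom with (fun j => 2 * m j); auto.
      intros j; apply Bd; auto.
      destruct (CB j) as [C1 C2]; specialize (HM j); specialize (JP j).
      nra. }
  apply Rminus_diag_uniq.
  apply (sine_complete (fun y => phi y - Series (fun j => c (S j) * efun (S j) y))); auto.
  { now apply cont_on_minus. }
  intros k Hk.
  assert (Ce : forall j, cont_on Iy (efun j)).
  { intros j; apply continuous_cont_on; [simpl; lra|]; intros z.
    apply (ex_derive_continuous (efun j)); eexists; apply is_derive_efun_jet. }
  assert (Ie : forall f, cont_on Iy f -> ex_RInt (fun y => f y * efun k y) 0 1).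
  { intros f Hf; apply (ex_RInt_cont_on Iy); try (split; simpl; lra); [simpl; lra|].
    now apply cont_on_mult. }
  rewrite (RInt_ext_R _ (fun y => minus (phi y * efun k y)
      (Series (fun j => c (S j) * efun (S j) y) * efun k y)))
    by (intros; unfold minus, plus, opp; simpl; ring).
  rewrite (RInt_minus (fun y => phi y * efun k y)
    (fun y => Series (fun j => c (S j) * efun (S j) y) * efun k y)) by now apply Ie.
  rewrite <- (Hc k Hk).
  assert (IS : is_series (fun j => RInt (fun y => c (S j) * efun (S j) y * efun k y) 0 1)
     (RInt (fun y => Series (fun j => c (S j) * efun (S j) y * efun k y)) 0 1)).
  { apply (RInt_Series 0 1 (fun j y => c (S j) * efun (S j) y * efun k y) (fun j => 2 * (2 * m j)));
      auto.
    - intros j; apply (cont_on_mult Iy (fun y => c (S j) * efun (S j) y)); auto.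
      apply (cont_on_mult Iy (fun _ => c (S j))); auto using cont_on_const.
    - apply (ex_series_scal_l 2 _ Hm').
    - intros j z _; rewrite Rabs_mult, Rmult_comm.
      apply Rmult_le_compat; auto using Rabs_pos, efun_bound.
    - apply (cont_on_ext Iy (fun y => Series (fun j => c (S j) * efun (S j) y) * efun k y));
        [simpl; lra| |].
      + intros z Hz; now rewrite Series_scal_r.
      + apply (cont_on_mult Iy _ (efun k)); auto. }
  assert (IS2 : is_series (fun j => RInt (fun y => c (S j) * efun (S j) y * efun k y) 0 1) (c k)).
  { destruct k as [|k]; [lia|].
    apply is_series_ext with (fun j => c (S k) * (if Nat.eqb j k then 1 else 0)).
    - intros j; refine (_ : _ = _ :> R); rewrite (RInt_ext_R _ (fun y => c (S j) * (efun (S j) y * efun (S k) y)))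
        by (intros; ring).
      rewrite RInt_scal_cont.
      + rewrite efun_orth by lia; simpl Nat.eqb.
        destruct (Nat.eqb_spec j k) as [->|]; ring.
      + intros z; apply (continuous_mult (efun (S j)) (efun (S k)));
          [apply (ex_derive_continuous (efun (S j)))|apply (ex_derive_continuous (efun (S k)))];
          eexists; apply is_derive_efun_jet.
    - assert (X := is_series_scal_l (c (S k)) _ _ (is_series_indicator k)).
      rewrite Rmult_1_r in X; exact X. }
  assert (U1 := is_series_unique _ _ IS); assert (U2 := is_series_unique _ _ IS2).
  rewrite U2 in U1; clear IS IS2.
  rewrite (RInt_ext_R (fun y => Series (fun j => c (S j) * efun (S j) y) * efun k y)
    (fun y => Series (fun j => c (S j) * efun (S j) y * efun k y)))
    by (intros; now rewrite Series_scal_r).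
  rewrite <- U1; unfold minus, plus, opp; simpl; ring.
Qed.

(** * The iterates of the operator on [u1] *)

Lemma close_pair I x d : fst I < snd I -> in_itv I x -> 0 < d ->
  exists u v, in_itv I u /\ in_itv I v /\ u < v /\
    forall c, u < c < v -> in_itv I c /\ Rabs (c - x) < d.
Proof.
  intros HI [H1 H2] Hd.
  exists (Rmax (fst I) (x - d)), (Rmin (snd I) (x + d)).
  assert (A1 := Rmax_l (fst I) (x - d)); assert (A2 := Rmax_r (fst I) (x - d)).
  assert (A3 := Rmin_l (snd I) (x + d)); assert (A4 := Rmin_r (snd I) (x + d)).
  assert (L : Rmax (fst I) (x - d) < Rmin (snd I) (x + d))
    by (apply Rmax_lub_lt; apply Rmin_glb_lt; lra).
  unfold in_itv; repeat split; try lra.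
  apply Rabs_lt_between; lra.
Qed.

(** The second difference over a small rectangle, evaluated by mean values in the two possible
    orders, equals both mixed derivatives at nearby points. The rectangle comes from [close_pair],
    which keeps it in the closed box even when (x, y) lies on the boundary. *)
Lemma mixed_partials X Y u p q r s : fst X < snd X -> fst Y < snd Y ->
  (forall x y, in_itv X x -> in_itv Y y ->
     is_deriv_on X (fun z => u z y) x (p x y) /\ is_deriv_on Y (fun z => u x z) y (q x y) /\
     is_deriv_on Y (fun z => p x z) y (r x y) /\ is_deriv_on X (fun z => q z y) x (s x y)) ->
  cont2 X Y r -> cont2 X Y s ->
  forall x y, in_itv X x -> in_itv Y y -> r x y = s x y.
Proof.
  intros HX HY H Cr Cs x y Hx Hy.
  apply Rminus_diag_uniq, Rabs_eq_0, Rle_antisym; [|apply Rabs_pos].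
  apply le_epsilon; intros eps Heps; rewrite Rplus_0_l.
  destruct (cont2_eps X Y r Cr x y Hx Hy (eps / 2) ltac:(lra)) as [d1 [D1 E1]].
  destruct (cont2_eps X Y s Cs x y Hx Hy (eps / 2) ltac:(lra)) as [d2 [D2 E2]].
  assert (Dp : 0 < Rmin d1 d2) by now apply Rmin_pos.
  destruct (close_pair X x _ HX Hx Dp) as [a [b [Ha [Hb [Hab Nx]]]]].
  destruct (close_pair Y y _ HY Hy Dp) as [c [e [Hc [He [Hce Ny]]]]].
  assert (M1 := Rmin_l d1 d2); assert (M2 := Rmin_r d1 d2).
  destruct (MVT_deriv_on X (fun z => u z e - u z c) (fun z => p z e - p z c) a b)
    as [xi [Hxi F1]]; auto.
  { intros z Hz; apply is_deriv_on_minus; auto; now apply H. }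
  destruct (Nx xi Hxi) as [Ixi Bxi].
  destruct (MVT_deriv_on Y (fun z => p xi z) (fun z => r xi z) c e) as [eta [Heta F2]]; auto.
  { intros z Hz; now apply H. }
  destruct (Ny eta Heta) as [Ieta Beta].
  destruct (MVT_deriv_on Y (fun z => u b z - u a z) (fun z => q b z - q a z) c e)
    as [eta' [Heta' G1]]; auto.
  { intros z Hz; apply is_deriv_on_minus; auto; now apply H. }
  destruct (Ny eta' Heta') as [Ieta' Beta'].
  destruct (MVT_deriv_on X (fun z => q z eta') (fun z => s z eta') a b) as [xi' [Hxi' G2]]; auto.
  { intros z Hz; now apply H. }
  destruct (Nx xi' Hxi') as [Ixi' Bxi'].
  assert (E : r xi eta = s xi' eta').
  { rewrite F2 in F1; rewrite G2 in G1.
    apply Rmult_eq_reg_r with ((e - c) * (b - a)); [lra|].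
    apply Rmult_integral_contrapositive; lra. }
  specialize (E1 xi eta Ixi Ieta ltac:(lra) ltac:(lra)).
  specialize (E2 xi' eta' Ixi' Ieta' ltac:(lra) ltac:(lra)).
  replace (r x y - s x y) with ((s xi' eta' - s x y) - (r xi eta - r x y)) by (rewrite E; ring).
  eapply Rle_trans; [apply Rabs_triang|]; rewrite Rabs_Ropp; lra.
Qed.

Lemma schwarz2 X Y u : fst X < snd X -> fst Y < snd Y -> Ck2 2 X Y u ->
  forall x y, in_itv X x -> in_itv Y y -> d2_2 Y (d1_2 X u) x y = d1_2 X (d2_2 Y u) x y.
Proof.
  intros HX HY [_ [E [[_ [E1 [_ [C1 _]]]] [_ [E2 [[C2 _] _]]]]]].
  apply (mixed_partials X Y u (d1_2 X u) (d2_2 Y u)); auto.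
  intros x y Hx Hy; destruct (E x y Hx Hy) as [A1 A2].
  destruct (E1 x y Hx Hy) as [_ A3]; destruct (E2 x y Hx Hy) as [A4 _].
  repeat split; apply ex_deriv_on_correct; auto.
Qed.

Lemma Cinf2_d1 X Y u : Cinf2 X Y u -> Cinf2 X Y (d1_2 X u).
Proof. intros H k; apply (H (S k)). Qed.

Lemma Cinf2_d2 X Y u : Cinf2 X Y u -> Cinf2 X Y (d2_2 Y u).
Proof. intros H k; apply (H (S k)). Qed.

Lemma Cinf2_dpart2 X Y u p q : Cinf2 X Y u -> Cinf2 X Y (dpart2 X Y p q u).
Proof.
  intros H; unfold dpart2; induction p as [|p IH]; simpl; [|now apply Cinf2_d1].
  induction q as [|q IH]; simpl; [exact H|now apply Cinf2_d2].
Qed.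

(** [dpart2] differentiates in y before x, so its x-derivatives are immediate, while a further
    y-derivative has to be commuted past all p derivatives in x. *)
Lemma Cinf2_jet2 X Y u : fst X < snd X -> fst Y < snd Y -> Cinf2 X Y u ->
  jet2 X Y (fun p q => dpart2 X Y p q u).
Proof.
  intros HX HY H.
  assert (D1 : forall v, Cinf2 X Y v -> forall x y, in_itv X x -> in_itv Y y ->
    is_deriv_on X (fun z => v z y) x (d1_2 X v x y) /\
    is_deriv_on Y (fun z => v x z) y (d2_2 Y v x y)).
  { intros v Hv x y Hx Hy; destruct (Hv 1%nat) as [_ [E _]].
    destruct (E x y Hx Hy) as [E1 E2]; split; apply ex_deriv_on_correct; auto. }
  assert (Comm : forall p q x y, in_itv X x -> in_itv Y y ->
    d2_2 Y (dpart2 X Y p q u) x y = dpart2 X Y p (S q) u x y).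
  { intros p q; induction p as [|p IH]; intros x y Hx Hy; [reflexivity|].
    assert (C := Cinf2_dpart2 X Y u p q H).
    change (dpart2 X Y (S p) q u) with (d1_2 X (dpart2 X Y p q u)).
    rewrite (schwarz2 X Y _ HX HY (C 2%nat) x y Hx Hy).
    apply deriv_on_eq; auto.
    apply is_deriv_on_ext with (fun z => dpart2 X Y p (S q) u z y); auto.
    - intros; symmetry; auto.
    - exact (proj1 (D1 _ (Cinf2_dpart2 X Y u p (S q) H) x y Hx Hy)). }
  intros p q x y Hx Hy.
  rewrite <- Comm by assumption; exact (D1 _ (Cinf2_dpart2 X Y u p q H) x y Hx Hy).
Qed.

(* Jets of the iterates [P^n u], in terms of a jet [D] of [u]. *)
Fixpoint jetP (a : R) (D : nat -> nat -> R -> R -> R) (n p q : nat) (x y : R) {struct n} : R :=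
  match n with
  | O => D p q x y
  | S n' => jetP a D n' (S (S (S p))) q x y + jetP a D n' (S p) (S (S q)) x y
            + a * jetP a D n' (S p) q x y
  end.

Lemma jetP_jet2 a D : jet2 Ix Iy D -> forall n, jet2 Ix Iy (jetP a D n).
Proof.
  intros J n; induction n as [|n IH]; intros p q x y Hx Hy; [now apply J|].
  split.
  - apply (is_deriv_on_plus Ix (fun x => jetP a D n (S (S (S p))) q x y + jetP a D n (S p) (S (S q)) x y)
       (fun x => a * jetP a D n (S p) q x y)); auto.
    + apply (is_deriv_on_plus Ix (fun x => jetP a D n (S (S (S p))) q x y)); auto; now apply IH.
    + apply (is_deriv_on_scal Ix (fun x => jetP a D n (S p) q x y)); auto; now apply IH.
  - apply (is_deriv_on_plus Iy (fun y => jetP a D n (S (S (S p))) q x y + jetP a D n (S p) (S (S q)) x y)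
       (fun y => a * jetP a D n (S p) q x y)); auto.
    + apply (is_deriv_on_plus Iy (fun y => jetP a D n (S (S (S p))) q x y)); auto; now apply IH.
    + apply (is_deriv_on_scal Iy (fun y => jetP a D n (S p) q x y)); auto; now apply IH.
Qed.

Lemma jetP_cont2 a D : (forall p q, cont2 Ix Iy (D p q)) ->
  forall n p q, cont2 Ix Iy (jetP a D n p q).
Proof.
  intros C n; induction n as [|n IH]; intros p q; [apply C|].
  apply (cont2_plus Ix Iy (fun x y => jetP a D n (S (S (S p))) q x y + jetP a D n (S p) (S (S q)) x y)
       (fun x y => a * jetP a D n (S p) q x y)).
  - apply cont2_plus; apply IH.
  - apply (cont2_mult Ix Iy (fun _ _ => a)); [apply cont2_const|apply IH].
Qed.

Lemma opP_jet a v U : jet2 Ix Iy U ->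
  (forall x y, in_itv Ix x -> in_itv Iy y -> v x y = U O O x y) ->
  forall x y, in_itv Ix x -> in_itv Iy y ->
    opP a v x y = U 3%nat O x y + U 1%nat 2%nat x y + a * U 1%nat O x y.
Proof.
  intros J E x y Hx Hy; unfold opP.
  assert (HX := Ix_lt); assert (HY := Iy_lt).
  assert (H1 := jet2_d1_eq Ix Iy U v O O HX HY J E).
  assert (H2 := jet2_d1_eq Ix Iy U _ 1 O HX HY J H1).
  assert (H3 := jet2_d1_eq Ix Iy U _ 2 O HX HY J H2).
  assert (H4 := jet2_d2_eq Ix Iy U _ 1 O HX HY J H1).
  assert (H5 := jet2_d2_eq Ix Iy U _ 1 1 HX HY J H4).
  rewrite (H1 x y Hx Hy), <- (H3 x y Hx Hy), <- (H5 x y Hx Hy); reflexivity.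
Qed.

Lemma opP_n_jetP a D u : jet2 Ix Iy D ->
  (forall x y, in_itv Ix x -> in_itv Iy y -> u x y = D O O x y) ->
  forall n x y, in_itv Ix x -> in_itv Iy y -> opP_n a n u x y = jetP a D n O O x y.
Proof.
  intros J E n; induction n as [|n IH]; intros x y Hx Hy; [now apply E|].
  exact (opP_jet a (opP_n a n u) (jetP a D n) (jetP_jet2 a D J n) IH x y Hx Hy).
Qed.

(** * Estimates on factorials to the power 2/3 *)

Lemma factpow_pos n s : 0 < factpow n s.
Proof. apply exp_pos. Qed.

(** Cubing removes the fractional exponent. With [cube_le_reg], inequalities on [factpow] reduce to
    inequalities on factorials. *)
Lemma factpow_cube n : factpow n (2 / 3) ^ 3 = rfact n ^ 2.
Proof.
  unfold factpow; rewrite <- Rpower_pow by apply exp_pos.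
  rewrite Rpower_mult, <- Rpower_pow by apply rfact_pos.
  f_equal; simpl; field.
Qed.

Lemma cube_le_reg x y : 0 <= y -> x ^ 3 <= y ^ 3 -> x <= y.
Proof.
  intros Hy H; destruct (Rle_lt_dec x y) as [|L]; [assumption|exfalso].
  assert (0 < x ^ 2) by (apply pow_lt; lra).
  assert (y ^ 2 <= x ^ 2) by (apply pow_incr; lra).
  assert (y * y ^ 2 < x * x ^ 2) by nra.
  simpl in *; lra.
Qed.

Lemma factpow_le m n : (m <= n)%nat -> factpow m (2 / 3) <= factpow n (2 / 3).
Proof.
  intros H; apply cube_le_reg; [left; apply factpow_pos|]; rewrite !factpow_cube.
  apply pow_incr; split; [apply pos_INR|now apply rfact_mono].
Qed.

Lemma factpow_mult_le m n : factpow m (2 / 3) * factpow n (2 / 3) <= factpow (m + n) (2 / 3).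
Proof.
  apply cube_le_reg; [left; apply factpow_pos|].
  rewrite Rpow_mult_distr, !factpow_cube, <- Rpow_mult_distr.
  apply pow_incr; split; [apply Rmult_le_pos; apply pos_INR|apply rfact_add_lower].
Qed.

(** This separates the growth in n, of Gevrey order 2, from the growth in j, which stays below j!^2
    B^(-j). After cubing, the left side carries j!^4 and the right side j!^6: the spare j!^2 pays
    for all geometric factors in j. *)
Lemma factpow_split B j n : 1 <= B ->
  factpow (2 + 2 * j + 3 * n) (2 / 3) <=
    16 * (64 ^ n * rfact (2 * n)) * (rfact j ^ 2 * exp (16 * B ^ 2) / B ^ j).
Proof.
  intros HB.
  assert (Fj := rfact_pos j); assert (F2n := rfact_pos (2 * n)).
  assert (F3n := rfact_pos (3 * n)).
  assert (Bj : 0 < B ^ j) by (apply pow_lt; lra).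
  assert (P64 : 0 < 64 ^ n) by (apply pow_lt; lra).
  assert (P4 : 0 < 4 ^ j) by (apply pow_lt; lra).
  assert (X1 : 1 <= exp (16 * B ^ 2)).
  { generalize (exp_ineq1_le (16 * B ^ 2)) (pow2_ge_0 B); lra. }
  apply cube_le_reg.
  { apply Rmult_le_pos; [nra|]; apply Rdiv_le_0_compat; [|assumption].
    apply Rmult_le_pos; [apply pow2_ge_0|lra]. }
  rewrite factpow_cube.
  (* From (3n)! <= 8^n n! (2n)! and n! squared at most (2n)!. *)
  assert (E3 : rfact (3 * n) ^ 2 <= 64 ^ n * rfact (2 * n) ^ 3).
  { assert (U := rfact_add_upper n (2 * n)).
    replace (n + 2 * n)%nat with (3 * n)%nat in U by lia; rewrite pow_mult in U.
    replace (2 ^ 3) with 8 in U by ring.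
    assert (L := rfact_add_lower n n); replace (n + n)%nat with (2 * n)%nat in L by lia.
    apply Rle_trans with ((8 ^ n * (rfact n * rfact (2 * n))) ^ 2).
    - apply pow_incr; split; [lra|exact U].
    - replace (64 ^ n) with (8 ^ n * 8 ^ n) by (rewrite <- Rpow_mult_distr; f_equal; ring).
      replace ((8 ^ n * (rfact n * rfact (2 * n))) ^ 2)
        with (8 ^ n * 8 ^ n * (rfact (2 * n) ^ 2 * (rfact n * rfact n))) by ring.
      replace (8 ^ n * 8 ^ n * rfact (2 * n) ^ 3)
        with (8 ^ n * 8 ^ n * (rfact (2 * n) ^ 2 * rfact (2 * n))) by ring.
      apply Rmult_le_compat_l; [nra|]; apply Rmult_le_compat_l; [apply pow2_ge_0|exact L]. }
  assert (E1 : rfact (2 + 2 * j + 3 * n) <= 32 * (64 ^ n * 16 ^ j * (rfact (3 * n) * rfact j ^ 2))).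
  { replace (2 + 2 * j + 3 * n)%nat with ((2 + 3 * n) + 2 * j)%nat by lia.
    assert (U1 := rfact_add_upper (2 + 3 * n) (2 * j)).
    assert (U2 := rfact_add_upper 2 (3 * n)).
    assert (U3 := rfact_add_upper j j); replace (j + j)%nat with (2 * j)%nat in U3 by lia.
    rewrite (pow_add 2 (2 + 3 * n)), (pow_add 2 2), !pow_mult in U1.
    rewrite (pow_add 2 2), !pow_mult in U2; rewrite pow_mult in U3.
    replace (2 ^ 3) with 8 in U1, U2 by ring; replace (2 ^ 2) with 4 in U1, U2, U3 by ring.
    simpl (rfact 2) in U2; replace (1 + 1) with 2 in U2 by ring.
    assert (F23 := rfact_pos (2 + 3 * n)).
    eapply Rle_trans; [exact U1|].
    apply Rle_trans with (4 * 8 ^ n * 4 ^ j *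
      ((4 * 8 ^ n * (2 * rfact (3 * n))) * (4 ^ j * (rfact j * rfact j)))).
    - apply Rmult_le_compat_l; [nra|]; apply Rmult_le_compat; try lra; auto using pos_INR.
    - right; replace 64 with (8 * 8) by ring; replace 16 with (4 * 4) by ring.
      rewrite !Rpow_mult_distr; ring. }
  apply Rle_trans with ((32 * (64 ^ n * 16 ^ j * (rfact (3 * n) * rfact j ^ 2))) ^ 2).
  { apply pow_incr; split; [apply pos_INR|exact E1]. }
  (* Here the spare j!^2 is spent: (16 B^2)^j <= j! exp(16 B^2), and the square of 16 B^2 dominates
     256 B^3 since B >= 1. *)
  assert (Ej : (256 * B ^ 3) ^ j <= rfact j ^ 2 * exp (16 * B ^ 2) ^ 3).
  { assert (T := pow_fact_le_exp j (16 * B ^ 2) ltac:(generalize (pow2_ge_0 B); lra)).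
    apply (Rmult_le_compat_r (rfact j)) in T; [|lra].
    unfold Rdiv in T; rewrite Rmult_assoc, Rinv_l, Rmult_1_r in T by lra.
    apply Rle_trans with (((16 * B ^ 2) ^ j) ^ 2).
    - rewrite <- pow_mult, Nat.mul_comm, pow_mult.
      assert (0 < B ^ 3) by (apply pow_lt; lra).
      apply pow_incr; split; [lra|].
      replace ((16 * B ^ 2) ^ 2) with (256 * (B ^ 3 * B)) by ring; nra.
    - apply Rle_trans with ((exp (16 * B ^ 2) * rfact j) ^ 2).
      + apply pow_incr; split; [apply pow_le; generalize (pow2_ge_0 B); lra|exact T].
      + replace ((exp (16 * B ^ 2) * rfact j) ^ 2)
          with (rfact j ^ 2 * exp (16 * B ^ 2) ^ 2 * 1) by ring.
        replace (rfact j ^ 2 * exp (16 * B ^ 2) ^ 3)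
          with (rfact j ^ 2 * exp (16 * B ^ 2) ^ 2 * exp (16 * B ^ 2)) by ring.
        apply Rmult_le_compat_l; [|exact X1].
        apply Rmult_le_pos; apply pow2_ge_0. }
  assert (N3 : (64 ^ n * 64 ^ n * 64 ^ n * rfact (2 * n) ^ 3) * rfact j ^ 4 >= 0).
  { apply Rle_ge, Rmult_le_pos; [|apply pow_le; lra].
    apply Rmult_le_pos; [|apply pow_le; lra]; repeat apply Rmult_le_pos; lra. }
  apply Rle_trans with (1024 * ((64 ^ n * 64 ^ n * 64 ^ n * rfact (2 * n) ^ 3) * rfact j ^ 4) * 256 ^ j).
  { replace ((32 * (64 ^ n * 16 ^ j * (rfact (3 * n) * rfact j ^ 2))) ^ 2)
      with (1024 * ((64 ^ n * 64 ^ n * rfact (3 * n) ^ 2) * rfact j ^ 4) * (16 ^ j * 16 ^ j)) by ring.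
    rewrite <- (Rpow_mult_distr 16 16); replace (16 * 16) with 256 by ring.
    apply Rmult_le_compat_r; [apply pow_le; lra|].
    apply Rmult_le_compat_l; [lra|]; apply Rmult_le_compat_r; [apply pow_le; lra|].
    rewrite !(Rmult_assoc (64 ^ n * 64 ^ n)); apply Rmult_le_compat_l; [nra|exact E3]. }
  replace ((16 * (64 ^ n * rfact (2 * n)) * (rfact j ^ 2 * exp (16 * B ^ 2) / B ^ j)) ^ 3)
    with (4096 * ((64 ^ n * 64 ^ n * 64 ^ n * rfact (2 * n) ^ 3) * rfact j ^ 4) *
          ((rfact j ^ 2 * exp (16 * B ^ 2) ^ 3) * / (B ^ j) ^ 3)) by (field; lra).
  rewrite Rpow_mult_distr in Ej.
  assert (Eb : (B ^ 3) ^ j = (B ^ j) ^ 3) by (rewrite <- !pow_mult; f_equal; lia).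
  rewrite Eb in Ej.
  assert (B3 : 0 < (B ^ j) ^ 3) by now apply pow_lt.
  assert (Ej' : 256 ^ j <= rfact j ^ 2 * exp (16 * B ^ 2) ^ 3 * / (B ^ j) ^ 3).
  { apply Rmult_le_reg_r with ((B ^ j) ^ 3); [assumption|].
    rewrite (Rmult_assoc _ (/ _)), Rinv_l, Rmult_1_r by lra; exact Ej. }
  assert (P256 : 0 < 256 ^ j) by (apply pow_lt; lra).
  apply Rmult_le_compat; lra.
Qed.

(** The threshold is the exponential of a sum of two positive numbers. The bound makes the powers of
    the radii in [space_R] at least 1. *)
Lemma R_threshold_ge1 a : 0 < a -> 1 <= R_threshold a.
Proof.
  intros Ha; unfold R_threshold, Rpower; rewrite <- exp_plus.
  assert (L : 0 < ln (9 * (a + 2))) by (rewrite <- ln_1; apply ln_increasing; lra).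
  assert (I : 0 < / (3 * exp 1)) by (apply Rinv_0_lt_compat; generalize (exp_pos 1); lra).
  assert (X := exp_ineq1_le (1 / 3 * ln (9 * (a + 2)) + / (3 * exp 1))); lra.
Qed.

(** Each application of the operator gives three terms of weights 1, 1 and a, of total a + 2, and
    raises the order of derivation by at most 3. *)
Lemma jetP_bound a D C : 0 < a ->
  (forall p q x y, in_itv Ix x -> in_itv Iy y -> Rabs (D p q x y) <= C * factpow (p + q) (2 / 3)) ->
  forall n p q x y, in_itv Ix x -> in_itv Iy y ->
    Rabs (jetP a D n p q x y) <= C * (a + 2) ^ n * factpow (p + q + 3 * n) (2 / 3).
Proof.
  intros Ha HD.
  assert (HC : 0 <= C).
  { assert (B := HD O O 0 0 Ix_0 ltac:(split; simpl; lra)).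
    assert (P := factpow_pos (0 + 0) (2 / 3)).
    apply Rmult_le_reg_r with (factpow (0 + 0) (2 / 3)); [assumption|].
    rewrite Rmult_0_l; eapply Rle_trans; [apply Rabs_pos|exact B]. }
  induction n as [|n IH]; intros p q x y Hx Hy.
  - rewrite Nat.mul_0_r, Nat.add_0_r, pow_O, Rmult_1_r; now apply HD.
  - simpl jetP.
    eapply Rle_trans; [apply Rabs_triang|].
    eapply Rle_trans; [apply Rplus_le_compat_r, Rabs_triang|].
    rewrite Rabs_mult, (Rabs_pos_eq a) by lra.
    assert (K : 0 <= C * (a + 2) ^ n) by (apply Rmult_le_pos; [|apply pow_le]; lra).
    assert (M : forall p' q', (p' + q' + 3 * n <= p + q + 3 * S n)%nat ->
       Rabs (jetP a D n p' q' x y) <= C * (a + 2) ^ n * factpow (p + q + 3 * S n) (2 / 3)).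
    { intros p' q' H; eapply Rle_trans; [now apply IH|].
      apply Rmult_le_compat_l; [exact K|now apply factpow_le]. }
    assert (M1 := M (S (S (S p))) q ltac:(lia)).
    assert (M2 := M (S p) (S (S q)) ltac:(lia)).
    assert (M3 := M (S p) q ltac:(lia)).
    simpl (_ ^ S n); nra.
Qed.

(* [P n p q] stands for the partial derivative of order [(p, q)] of the [n]-th iterate of
   the operator applied to a fixed function. *)
Definition null_jets (a : R) (P : nat -> nat -> nat -> R -> R -> R) : Prop :=
  (forall n, jet2 Ix Iy (P n)) /\
  (forall n p q, cont2 Ix Iy (P n p q)) /\
  (forall n p q x y, P (S n) p q x y =
     P n (S (S (S p))) q x y + P n (S p) (S (S q)) x y + a * P n (S p) q x y) /\
  (forall n x y, in_itv Ix x -> in_itv Iy y ->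
     P n 0%nat 0%nat 0 y = 0 /\ P n 1%nat 0%nat 0 y = 0 /\
     P n 0%nat 0%nat x 0 = 0 /\ P n 0%nat 0%nat x 1 = 0).

(** * Sine coefficients of the target state *)

Lemma Iy_0 : in_itv Iy 0.
Proof. split; simpl; lra. Qed.

Lemma Iy_1 : in_itv Iy 1.
Proof. split; simpl; lra. Qed.

Lemma deriv_on_zero I f x l : fst I < snd I -> in_itv I x ->
  (forall y, in_itv I y -> f y = 0) -> is_deriv_on I f x l -> l = 0.
Proof.
  intros HI Hx Z H; apply (is_deriv_on_unique I f x); auto.
  apply is_deriv_on_ext with (fun _ => 0); auto using is_deriv_on_const.
  intros; symmetry; auto.
Qed.

Section NullJets.

Variables (a : R) (P : nat -> nat -> nat -> R -> R -> R).
Hypothesis HP : null_jets a P.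

Lemma null_jets_left n q y : in_itv Iy y -> P n 0%nat q 0 y = 0.
Proof.
  destruct HP as [J [_ [_ B]]]; revert y; induction q as [|q IH]; intros y Hy.
  - apply (B n 0 y Ix_0 Hy).
  - apply (deriv_on_zero Iy (fun y => P n 0%nat q 0 y) y); auto using Iy_lt.
    exact (proj2 (J n O q 0 y Ix_0 Hy)).
Qed.

Lemma null_jets_x n p q y0 : in_itv Iy y0 ->
  (forall x, in_itv Ix x -> P n p q x y0 = 0) ->
  forall x, in_itv Ix x -> P n (S p) q x y0 = 0.
Proof.
  destruct HP as [J _]; intros Hy Z x Hx.
  apply (deriv_on_zero Ix (fun x => P n p q x y0) x); auto using Ix_lt.
  exact (proj1 (J n p q x y0 Hx Hy)).
Qed.

(* The boundary condition for [P^(n+1) u] controls two more [y]-derivatives of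
   [P^n u_x]; then integrate from [x = 0]. *)
Lemma null_jets_even y0 k : y0 = 0 \/ y0 = 1 ->
  forall n p x, in_itv Ix x -> P n p (2 * k)%nat x y0 = 0.
Proof.
  intros Hy0.
  assert (Iy0 : in_itv Iy y0) by (destruct Hy0 as [->| ->]; auto using Iy_0, Iy_1).
  destruct HP as [J [_ [Rec B]]].
  induction k as [|k IH]; intros n p.
  - simpl (2 * 0)%nat; induction p as [|p IHp]; intros x Hx; [|now apply null_jets_x].
    destruct (B n x y0 Hx Iy0) as [_ [_ [B0 B1]]]; destruct Hy0 as [->| ->]; assumption.
  - replace (2 * S k)%nat with (S (S (2 * k))) by lia.
    assert (A : forall p' x, in_itv Ix x -> P n (S p') (S (S (2 * k))) x y0 = 0).
    { intros p' x Hx; assert (R := Rec n p' (2 * k)%nat x y0).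
      rewrite !IH in R by assumption; lra. }
    destruct p as [|p]; [|apply A].
    intros x Hx; rewrite <- (null_jets_left n (S (S (2 * k))) y0 Iy0).
    apply (deriv_on_const Ix (fun x => P n 0%nat (S (S (2 * k))) x y0)); auto using Ix_0.
    intros z Hz; rewrite <- (A O z Hz); exact (proj1 (J n O _ z y0 Hz Iy0)).
Qed.

Lemma cont_on_efun j : cont_on Iy (efun j).
Proof.
  apply continuous_cont_on; [simpl; lra|]; intros z.
  apply (ex_derive_continuous (efun j)); eexists; apply is_derive_efun_jet.
Qed.

Lemma ex_RInt_Iy f : cont_on Iy f -> ex_RInt f 0 1.
Proof.
  intros H; apply (ex_RInt_cont_on Iy); auto using Iy_0, Iy_1; simpl; lra.
Qed.

Lemma RInt_zero_Iy f : (forall y, 0 < y < 1 -> f y = 0) -> RInt f 0 1 = 0 :> R.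
Proof.
  intros Hf; transitivity (RInt (fun _ => 0) 0 1 : R).
  - apply RInt_ext_R; intros y Hy; rewrite Rmin_left, Rmax_right in Hy by lra; auto.
  - rewrite RInt_const; apply Rmult_0_r.
Qed.

Lemma RInt_plus_Iy f g : cont_on Iy f -> cont_on Iy g ->
  RInt (fun x => f x + g x) 0 1 = RInt f 0 1 + RInt g 0 1 :> R.
Proof. intros; apply (RInt_plus f g); now apply ex_RInt_Iy. Qed.

Lemma RInt_scal_Iy f c : cont_on Iy f ->
  RInt (fun x => c * f x) 0 1 = c * RInt f 0 1 :> R.
Proof. intros; apply (RInt_scal f); now apply ex_RInt_Iy. Qed.

(** Green's formula in y: the boundary terms vanish because f and [efun j] are both zero at 0 and
    1. *)
Lemma sine_coef_second_derivative j f f1 f2 :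
  (forall y, in_itv Iy y -> is_deriv_on Iy f y (f1 y)) ->
  (forall y, in_itv Iy y -> is_deriv_on Iy f1 y (f2 y)) ->
  cont_on Iy f2 -> f 0 = 0 -> f 1 = 0 ->
  RInt (fun y => f2 y * efun j y) 0 1 = - lambda j * RInt (fun y => f y * efun j y) 0 1 :> R.
Proof.
  intros D0 D1 C2 Z0 Z1.
  assert (C0 : cont_on Iy f) by (apply deriv_cont_on with f1; auto; simpl; lra).
  assert (Ce := cont_on_efun j).
  set (e1 := fun y => sqrt 2 * (INR j * PI * cosj j y)).
  assert (De : forall y, in_itv Iy y -> is_deriv_on Iy (efun j) y (e1 y))
    by (intros; apply is_derive_deriv_on; auto using is_derive_efun_jet).
  assert (De1 : forall y, in_itv Iy y -> is_deriv_on Iy e1 y (- lambda j * efun j y)).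
  { intros y Hy; apply is_derive_deriv_on; auto.
    replace (- lambda j * efun j y)
      with (sqrt 2 * (INR j * PI * (- (INR j * PI) * sinj j y)))
      by (rewrite lambda_sq, efun_sinj; ring).
    apply (is_derive_scal (fun y => INR j * PI * cosj j y)).
    apply (is_derive_scal (cosj j)), is_derive_cosj. }
  set (H := fun y => f1 y * efun j y - f y * e1 y).
  assert (Eq : RInt (fun y => f2 y * efun j y + lambda j * (f y * efun j y)) 0 1 = H 1 - H 0 :> R).
  { apply FTC_deriv_on; [lra| |].
    - apply (cont_on_plus Iy (fun y => f2 y * efun j y)); [now apply cont_on_mult|].
      apply (cont_on_mult Iy (fun _ => lambda j)); [apply cont_on_const|now apply cont_on_mult].
    - intros y Hy; replace (f2 y * efun j y + lambda j * (f y * efun j y))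
        with ((f2 y * efun j y + f1 y * e1 y) - (f1 y * e1 y + f y * (- lambda j * efun j y))) by ring.
      apply (is_deriv_on_minus Iy (fun y => f1 y * efun j y) (fun y => f y * e1 y)); auto.
      + apply (is_deriv_on_mult Iy f1 (efun j)); auto.
      + apply (is_deriv_on_mult Iy f e1); auto. }
  rewrite RInt_plus_Iy, RInt_scal_Iy in Eq.
  - unfold H in Eq; rewrite Z0, Z1 in Eq.
    rewrite !efun_sinj, sinj_0, sinj_1 in Eq; lra.
  - now apply cont_on_mult.
  - now apply cont_on_mult.
  - apply (cont_on_mult Iy (fun _ => lambda j)); [apply cont_on_const|now apply cont_on_mult].
Qed.

Definition coef (n p q j : nat) (x : R) : R := RInt (fun y => P n p q x y * efun j y) 0 1.

Lemma null_jets_slice n p q x : in_itv Ix x -> cont_on Iy (P n p q x).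
Proof.
  intros Hx; destruct HP as [_ [C _]]; apply (cont2_slice Ix); auto; simpl; lra.
Qed.

Lemma coef_jet n q j : jet1 Ix (fun p x => coef n p q j x).
Proof.
  intros p x Hx; destruct HP as [J [C _]]; unfold coef.
  apply (is_deriv_on_RInt Ix 0 1 (fun x y => P n p q x y * efun j y)
           (fun x y => P n (S p) q x y * efun j y)); auto using Ix_lt; [lra| | |].
  - intros z y Hz Hy.
    apply is_deriv_on_ext with (fun z => efun j y * P n p q z y); auto; [intros; apply Rmult_comm|].
    rewrite Rmult_comm; apply (is_deriv_on_scal Ix (fun z => P n p q z y)); auto.
    exact (proj1 (J n p q z y Hz Hy)).
  - intros z Hz; apply (cont_on_mult Iy (P n p q z)); auto using null_jets_slice, cont_on_efun.
  - apply (cont2_mult Ix Iy (P n (S p) q) (fun _ y => efun j y)); auto.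
    apply cont2_eps_inv; intros z y _ Hy eps Heps.
    destruct (proj1 (cont_on_eps Iy (efun j) ltac:(simpl; lra)) (cont_on_efun j) y Hy eps Heps)
      as [d [Hd H]]; exists d; split; auto.
Qed.

(** The vanishing of all even y-derivatives on the sides allows Green's formula to be repeated, each
    time with factor - lambda j. Read backwards, it divides the coefficient by lambda j to the power
    q. *)
Lemma coef_even n p q j x : in_itv Ix x ->
  coef n p (2 * q) j x = (- lambda j) ^ q * coef n p 0 j x.
Proof.
  intros Hx; destruct HP as [J _]; induction q as [|q IH]; [simpl; ring|].
  replace (2 * S q)%nat with (S (S (2 * q))) by lia.
  rewrite <- (tech_pow_Rmult (- lambda j) q), Rmult_assoc, <- IH; unfold coef.
  apply (sine_coef_second_derivative j _ (P n p (S (2 * q)) x)).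
  - intros y Hy; exact (proj2 (J n p (2 * q)%nat x y Hx Hy)).
  - intros y Hy; exact (proj2 (J n p (S (2 * q)) x y Hx Hy)).
  - now apply null_jets_slice.
  - apply null_jets_even; auto.
  - apply null_jets_even; auto.
Qed.

(** On the j-th sine the operator acts as the ordinary operator whose equation defines the
    generating functions. *)
Lemma coef_rec n j x : in_itv Ix x ->
  coef (S n) 0 0 j x = coef n 3 0 j x - (lambda j - a) * coef n 1 0 j x.
Proof.
  intros Hx; assert (E := coef_even n 1 1 j x Hx); change (2 * 1)%nat with 2%nat in E.
  replace (coef n 3 0 j x - (lambda j - a) * coef n 1 0 j x)
    with ((coef n 3 0 j x + coef n 1 2 j x) + a * coef n 1 0 j x) by (rewrite E; ring).
  unfold coef; destruct HP as [_ [_ [Rec _]]].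
  assert (K : forall n p q, cont_on Iy (fun y => P n p q x y * efun j y))
    by (intros; apply cont_on_mult; auto using null_jets_slice, cont_on_efun).
  assert (K31 := cont_on_plus Iy _ _ (K n 3%nat 0%nat) (K n 1%nat 2%nat)).
  assert (K1 := cont_on_mult Iy _ _ (cont_on_const Iy a) (K n 1%nat 0%nat)).
  rewrite <- (RInt_scal_Iy _ a (K n 1%nat 0%nat)).
  rewrite <- (RInt_plus_Iy _ _ (K n 3%nat 0%nat) (K n 1%nat 2%nat)).
  rewrite <- (RInt_plus_Iy _ _ K31 K1).
  apply RInt_ext_R; intros; rewrite Rec; ring.
Qed.

Lemma coef_0 n j : coef n 0 0 j 0 = 0 /\ coef n 1 0 j 0 = 0.
Proof.
  destruct HP as [_ [_ [_ B]]].
  split; apply RInt_zero_Iy; intros y Hy; destruct (B n 0 y Ix_0 ltac:(split; simpl; lra)) as [B1 [B2 _]].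
  - rewrite B1; ring.
  - rewrite B2; ring.
Qed.

Variable C : R.
Hypothesis a_pos : 0 < a.
Hypothesis HC : forall n p q x y, in_itv Ix x -> in_itv Iy y ->
  Rabs (P n p q x y) <= C * (a + 2) ^ n * factpow (p + q + 3 * n) (2 / 3).

Lemma C_nonneg : 0 <= C.
Proof.
  assert (B := HC 0 0 0 0 0 Ix_0 Iy_0).
  assert (F := factpow_pos (0 + 0 + 3 * 0) (2 / 3)).
  rewrite pow_O, Rmult_1_r in B.
  apply Rmult_le_reg_r with (1 := F).
  rewrite Rmult_0_l; eapply Rle_trans; [apply Rabs_pos|exact B].
Qed.

Lemma lambda_ge j : INR j ^ 2 <= lambda j.
Proof.
  rewrite lambda_sq; apply pow_incr; split; [apply pos_INR|].
  assert (X := PI2_1); assert (Y := pos_INR j); nra.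
Qed.

(** j! <= j^j and j^2 <= lambda j. This is the gain of j double integrations by parts against the
    frequency j. *)
Lemma fact_sq_le_lambda_pow j : rfact j ^ 2 <= lambda j ^ j.
Proof.
  assert (F : rfact j <= INR j ^ j).
  { assert (G : forall m, (m <= j)%nat -> rfact m <= INR j ^ m).
    2: now apply G.
    induction m as [|m IH]; intros Hm; [simpl; lra|].
    rewrite rfact_S; simpl pow; apply Rmult_le_compat; auto using pos_INR.
    - now apply le_INR.
    - apply IH; lia. }
  apply Rle_trans with ((INR j ^ 2) ^ j).
  - rewrite <- pow_mult, Nat.mul_comm, pow_mult; apply pow_incr; split; [apply pos_INR|exact F].
  - apply pow_incr; split; [apply pow2_ge_0|apply lambda_ge].
Qed.

(** The coefficient is compared with its y-derivative of order 2(j + k): the order 2j yields B^(-j)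
    through [factpow_split], and k = 1 adds the factor lambda j wanted by [sine_series]. The
    condition p + 2k <= 2 keeps the total order below 2 + 2j + 3n. The constant 32 is 16 times the
    bound 2 on [efun]. *)
Lemma coef_decay B n p k j x : (p <= 2)%nat -> (k <= 1)%nat -> (1 <= j)%nat -> 1 <= B ->
  (p + 2 * k <= 2)%nat -> in_itv Ix x ->
  lambda j ^ k * Rabs (coef n p 0 j x) <=
    32 * C * exp (16 * B ^ 2) / B ^ j * ((64 * (a + 2)) ^ n * rfact (2 * n)).
Proof.
  intros Hp Hk Hj HB Hpk Hx.
  assert (C0 := C_nonneg).
  assert (L1 : 0 < lambda j).
  { apply Rlt_le_trans with (INR j ^ 2); [|apply lambda_ge].
    apply pow_lt, lt_0_INR; lia. }
  assert (Lj := fact_sq_le_lambda_pow j); assert (Fj := rfact_pos j).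
  assert (Bj : 0 < B ^ j) by (apply pow_lt; lra).
  assert (Fj2 : 0 < rfact j ^ 2) by (apply pow_lt, Fj).
  assert (A2 : 0 <= (a + 2) ^ n) by (apply pow_le; lra).
  assert (E := coef_even n p (j + k) j x Hx).
  assert (U : Rabs (coef n p (2 * (j + k)) j x) <=
              C * (a + 2) ^ n * factpow (2 + 2 * j + 3 * n) (2 / 3) * 2).
  { apply Rle_trans with (C * (a + 2) ^ n * factpow (2 + 2 * j + 3 * n) (2 / 3) * 2 * (1 - 0));
      [|right; ring].
    unfold coef; apply RInt_bound; [lra| |].
    - apply ex_RInt_Iy, (cont_on_mult Iy); auto using null_jets_slice, cont_on_efun.
    - intros y Hy; rewrite Rabs_mult; apply Rmult_le_compat; auto using Rabs_pos, efun_bound.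
      eapply Rle_trans; [apply HC; auto|].
      apply Rmult_le_compat_l; [now apply Rmult_le_pos|].
      apply factpow_le; lia. }
  rewrite E, Rabs_mult, <- RPow_abs, Rabs_Ropp, (Rabs_pos_eq (lambda j)), pow_add in U by lra.
  assert (S := factpow_split B j n HB).
  assert (Lk : 0 < lambda j ^ k) by now apply pow_lt.
  apply Rmult_le_reg_l with (rfact j ^ 2); [assumption|].
  apply Rle_trans with (lambda j ^ j * lambda j ^ k * Rabs (coef n p 0 j x)).
  { rewrite <- Rmult_assoc; apply Rmult_le_compat_r; [apply Rabs_pos|].
    apply Rmult_le_compat_r; lra. }
  eapply Rle_trans; [exact U|].
  apply Rle_trans with (C * (a + 2) ^ n *
    (16 * (64 ^ n * rfact (2 * n)) * (rfact j ^ 2 * exp (16 * B ^ 2) / B ^ j)) * 2).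
  - apply Rmult_le_compat_r; [lra|]; apply Rmult_le_compat_l; [now apply Rmult_le_pos|exact S].
  - right; rewrite Rpow_mult_distr; field; lra.
Qed.

Lemma null_jets_sine_series x y : in_itv Ix x -> in_itv Iy y ->
  P 0%nat 0%nat 0%nat x y = Series (fun j => coef 0 0 0 (S j) x * efun (S j) y).
Proof.
  intros Hx Hy.
  destruct HP as [_ [_ [_ Bd]]]; destruct (Bd O x y Hx Hy) as [_ [_ [B0 B1]]].
  destruct (Req_dec y 0) as [->|N0].
  { rewrite B0, Series_zero; [reflexivity|]; intros; rewrite efun_sinj, sinj_0; ring. }
  destruct (Req_dec y 1) as [->|N1].
  { rewrite B1, Series_zero; [reflexivity|]; intros; rewrite efun_sinj, sinj_1; ring. }
  (* Taking B = 4 bounds both parts of the weight 1 + lambda by multiples of (1/4)^j. The two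
     boundary values of y were treated apart since the sine series is known to represent the
     function on the open interval only. *)
  apply (sine_series (P 0%nat 0%nat 0%nat x) (fun j => coef 0 0 0 j x)
    (fun j => 2 * (32 * C * exp (16 * 4 ^ 2)) * (/ 4) ^ j)).
  - now apply null_jets_slice.
  - reflexivity.
  - apply (ex_series_scal_l _ _ ex_series_quarter).
  - intros j.
    assert (D0 := coef_decay 4 0 0 0 (S j) x ltac:(lia) ltac:(lia) ltac:(lia) ltac:(lra) ltac:(lia) Hx).
    assert (D1 := coef_decay 4 0 0 1 (S j) x ltac:(lia) ltac:(lia) ltac:(lia) ltac:(lra) ltac:(lia) Hx).
    rewrite <- lambda_sq.
    simpl (rfact (2 * 0)) in D0, D1; rewrite pow_O, Rmult_1_r in D0, D1.
    rewrite pow_1 in D1; rewrite pow_O in D0; rewrite !Rmult_1_r in D0, D1.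
    assert (E4 : 32 * C * exp (16 * 4 ^ 2) / 4 ^ S j <= 32 * C * exp (16 * 4 ^ 2) * (/ 4) ^ j).
    { unfold Rdiv; rewrite <- pow_inv.
      apply Rmult_le_compat_l.
      - apply Rmult_le_pos; [|left; apply exp_pos]; generalize C_nonneg; lra.
      - simpl; assert (0 < (/ 4) ^ j) by (apply pow_lt; lra); lra. }
    lra.
  - destruct Hy; simpl in *; lra.
Qed.

End NullJets.

(** * Expansion along the generating functions *)

Lemma is_lim_seq_pow_fact x : is_lim_seq (fun n => x ^ n / rfact n) 0.
Proof. apply ex_series_lim_0, ex_series_exp. Qed.

(** Green's formula on [x, 0] between f_k and the reflected kernel [gen mu k] at x - s. Its boundary
    term at 0 is the k-th term of the series, and its integral has one part in common with the next
    step, so the alternating sum telescopes to f_0(x) plus one remainder integral. *)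
Lemma iterated_ode_expansion mu f K L : 0 < L -> 0 <= K ->
  (forall n, jet1 Ix (f n)) ->
  (forall n x, in_itv Ix x -> f (S n) 0%nat x = f n 3%nat x - mu * f n 1%nat x) ->
  (forall n, f n 0%nat 0 = 0 /\ f n 1%nat 0 = 0) ->
  (forall n x, in_itv Ix x -> Rabs (f n 0%nat x) <= K * (L ^ n * rfact (2 * n))) ->
  forall x, in_itv Ix x ->
    is_series (fun k => (-1) ^ k * f k 2%nat 0 * gen mu k 0 x) (f 0%nat 0%nat x).
Proof.
  intros HL HK J Rec Z Bd x0 Hx0.
  assert (Hle : x0 <= 0) by apply Hx0.
  set (I := (x0, 0) : itv).
  assert (SI : forall s, in_itv I s -> in_itv Ix s /\ in_itv Ix (x0 - s)).
  { intros s Hs; destruct Hs, Hx0; unfold in_itv; simpl in *; lra. }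
  set (G := fun k p s => gen mu k p (x0 - s)).
  assert (JG : forall k p s, in_itv I s -> is_deriv_on I (G k p) s (- G k (S p) s)).
  { intros k p s Hs; apply (is_deriv_on_reflect Ix I (gen mu k p)); auto.
    - intros y Hy; now apply SI.
    - apply gen_jet; now apply SI. }
  assert (Jf : forall k p s, in_itv I s -> is_deriv_on I (f k p) s (f k (S p) s)).
  { intros k p s Hs; apply (is_deriv_on_sub Ix); auto.
    - intros y Hy; now apply SI.
    - apply J; now apply SI. }
  assert (CG : forall k p, cont_on I (G k p))
    by (intros; apply deriv_cont_on with (fun s => - G k (S p) s); auto).
  assert (Cf : forall k p, cont_on I (f k p))
    by (intros; apply deriv_cont_on with (f k (S p)); auto).
  (* The bilinear concomitant of Green's formula. At s = 0 only the second derivative of f_k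
     survives; at s = x0 only the second derivative of the kernel, which is 1 for k = 0 and 0
     afterwards. *)
  set (H := fun k s => f k 2%nat s * G k 0%nat s + f k 1%nat s * G k 1%nat s
                + f k 0%nat s * G k 2%nat s - mu * (f k 0%nat s * G k 0%nat s)).
  set (H' := fun k s => f (S k) 0%nat s * G k 0%nat s
                - f k 0%nat s * (G k 3%nat s - mu * G k 1%nat s)).
  assert (DH : forall k s, in_itv I s -> is_deriv_on I (H k) s (H' k s)).
  { intros k s Hs; unfold H'; rewrite (Rec k s) by now apply SI.
    replace ((f k 3%nat s - mu * f k 1%nat s) * G k 0%nat s -
             f k 0%nat s * (G k 3%nat s - mu * G k 1%nat s))
      with ((f k 3%nat s * G k 0%nat s + f k 2%nat s * (- G k 1%nat s)) +
            (f k 2%nat s * G k 1%nat s + f k 1%nat s * (- G k 2%nat s)) +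
            (f k 1%nat s * G k 2%nat s + f k 0%nat s * (- G k 3%nat s)) -
            mu * (f k 1%nat s * G k 0%nat s + f k 0%nat s * (- G k 1%nat s))) by ring.
    assert (M : forall p q, is_deriv_on I (fun s => f k p s * G k q s) s
                (f k (S p) s * G k q s + f k p s * (- G k (S q) s))).
    { intros p q; apply (is_deriv_on_mult I (f k p) (G k q)); auto. }
    apply (is_deriv_on_minus I (fun s => f k 2%nat s * G k 0%nat s + f k 1%nat s * G k 1%nat s
                + f k 0%nat s * G k 2%nat s)); auto.
    - apply (is_deriv_on_plus I (fun s => f k 2%nat s * G k 0%nat s + f k 1%nat s * G k 1%nat s)); auto.
      apply (is_deriv_on_plus I (fun s => f k 2%nat s * G k 0%nat s)); auto.
    - apply (is_deriv_on_scal I (fun s => f k 0%nat s * G k 0%nat s)); auto. }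
  set (Int := fun k => RInt (fun s => f (S k) 0%nat s * G k 0%nat s) x0 0 : R).
  set (b := fun k => f k 2%nat 0).
  assert (G0 : forall k p, G k p 0 = gen mu k p x0) by (intros; unfold G; f_equal; ring).
  assert (GX : forall k p, G k p x0 = gen mu k p 0) by (intros; unfold G; f_equal; ring).
  assert (HE0 : forall k, H k 0 = b k * gen mu k 0 x0).
  { intros k; destruct (Z k) as [Z0 Z1]; unfold H; rewrite Z0, Z1, !G0; unfold b; ring. }
  assert (HEX : forall k, H k x0 = f k 0%nat x0 * gen mu k 2 0).
  { intros k; destruct (gen_at_0 mu k) as [g0 [g1 _]]; unfold H; rewrite !GX, g0, g1; ring. }
  assert (XA : forall s, in_itv I s -> Rabs (x0 - s) <= 1) by (intros; apply Ix_abs, SI; auto).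
  assert (Cp : forall k l p, cont_on I (fun s => f k 0%nat s * G l p s))
    by (intros; apply cont_on_mult; auto).
  assert (E0 : Int O = b O * gen mu 0 0 x0 - f 0%nat 0%nat x0).
  { replace (b O * gen mu 0 0 x0 - f 0%nat 0%nat x0) with (H O 0 - H O x0).
    2: { rewrite HE0, HEX; destruct (gen_at_0 mu 0) as [_ [_ ->]]; ring. }
    unfold Int; apply FTC_deriv_on; [exact Hle|apply (Cp 1%nat O O)|].
    intros s Hs; replace (f 1%nat 0%nat s * G 0%nat 0%nat s) with (H' O s); [now apply DH|].
    unfold H', G; rewrite (gen_ode_0 mu (x0 - s)) by (apply XA; exact Hs); ring. }
  assert (ES : forall k, Int (S k) + Int k = b (S k) * gen mu (S k) 0 x0).
  { intros k.
    replace (b (S k) * gen mu (S k) 0 x0) with (H (S k) 0 - H (S k) x0).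
    2: { rewrite HE0, HEX; destruct (gen_at_0 mu (S k)) as [_ [_ ->]]; ring. }
    assert (ex : forall k l, ex_RInt (fun s => f k 0%nat s * G l 0%nat s) x0 0).
    { intros k' l; apply (ex_RInt_cont_on I); [exact Hle|split; simpl; lra|split; simpl; lra|exact (Cp k' l O)]. }
    unfold Int.
    transitivity (RInt (fun s => f (S (S k)) 0%nat s * G (S k) 0%nat s + f (S k) 0%nat s * G k 0%nat s) x0 0 : R).
    { symmetry; apply (RInt_plus (fun s => f (S (S k)) 0%nat s * G (S k) 0%nat s)
                         (fun s => f (S k) 0%nat s * G k 0%nat s)); apply ex. }
    apply FTC_deriv_on; [exact Hle| |].
    { exact (cont_on_plus I _ _ (Cp (S (S k)) (S k) O) (Cp (S k) k O)). }
    intros s Hs.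
    replace (f (S (S k)) 0%nat s * G (S k) 0%nat s + f (S k) 0%nat s * G k 0%nat s) with (H' (S k) s);
      [now apply DH|].
    unfold H', G; rewrite (gen_ode_S mu k (x0 - s)) by (apply XA; exact Hs); ring. }
  (* Since [Int (S k) + Int k] is the unsigned term of rank k + 1, the signs (-1)^k cancel all
     integrals but the last. *)
  assert (ESum : forall N, sum_n (fun k => (-1) ^ k * b k * gen mu k 0 x0) N =
                    f 0%nat 0%nat x0 + (-1) ^ N * Int N :> R).
  { induction N as [|N IH].
    - rewrite sum_O, E0; simpl; ring.
    - rewrite sum_Sn, IH; unfold plus; simpl AbelianMonoid.sort.
      change (f 0%nat 0%nat x0 + (-1) ^ N * Int N + (-1) ^ S N * b (S N) * gen mu (S N) 0 x0 =
              f 0%nat 0%nat x0 + (-1) ^ S N * Int (S N)).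
      rewrite Rmult_assoc, <- ES; simpl pow; ring. }
  destruct (Rabs_sqrt_sq mu) as [M1 M2].
  set (E := exp (6 * (1 + Rabs mu))).
  assert (EP : 0 < E) by apply exp_pos.
  set (Q := 4 * (16 * L)).
  assert (BI : forall N, Rabs (Int N) <= (K * L * 8 * E * 4) * (Q ^ N / rfact N)).
  { intros N.
    apply Rle_trans with ((K * L * 8 * E * 4) * (Q ^ N / rfact N) * (0 - x0)).
    - apply RInt_bound; auto.
      { apply (ex_RInt_cont_on I); [exact Hle|split; simpl; lra|split; simpl; lra|exact (Cp (S N) N O)]. }
      intros s Hs.
      rewrite Rabs_mult; eapply Rle_trans.
      { apply Rmult_le_compat; auto using Rabs_pos.
        - apply Bd; now apply SI.
        - apply (gen_bound mu (1 + Rabs mu)); auto. }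
      fold E; simpl (rfact 0); rewrite Rmult_1_l.
      assert (F1 := rfact_pos N); assert (F3 := rfact_pos (3 * N + 2)).
      assert (P16 : 0 < 16 ^ N) by (apply pow_lt; lra).
      assert (PL := pow_lt L N HL).
      (* The shift 2 in (3N + 2)! exactly compensates the extra iterate f_(N+1), whose bound
         involves (2N + 2)!. *)
      assert (Fr : rfact (2 * S N) / rfact (3 * N + 2) <= / rfact N).
      { assert (Lw := rfact_add_lower (2 * S N) N).
        replace (2 * S N + N)%nat with (3 * N + 2)%nat in Lw by lia.
        apply Rmult_le_reg_r with (rfact (3 * N + 2) * rfact N); [nra|].
        replace (rfact (2 * S N) / rfact (3 * N + 2) * (rfact (3 * N + 2) * rfact N))
          with (rfact (2 * S N) * rfact N) by (field; lra).
        replace (/ rfact N * (rfact (3 * N + 2) * rfact N)) with (rfact (3 * N + 2)) by (field; lra).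
        exact Lw. }
      assert (P4 : 1 <= 4 ^ N) by (apply pow_R1_Rle; lra).
      replace (K * (L ^ S N * rfact (2 * S N)) * (8 * (16 ^ N / rfact (3 * N + 2)) * E))
        with ((K * L * 8 * E) * ((L ^ N * 16 ^ N) * (rfact (2 * S N) / rfact (3 * N + 2))))
        by (simpl pow; field; lra).
      unfold Q; rewrite !Rpow_mult_distr.
      replace (K * L * 8 * E * 4 * (4 ^ N * (16 ^ N * L ^ N) / rfact N))
        with ((K * L * 8 * E) * ((L ^ N * 16 ^ N) * (4 * 4 ^ N * / rfact N)))
        by (field; lra).
      apply Rmult_le_compat_l.
      + apply Rmult_le_pos; [|lra]; apply Rmult_le_pos; [|lra]; apply Rmult_le_pos; lra.
      + apply Rmult_le_compat_l; [nra|].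
        assert (0 < / rfact N) by now apply Rinv_0_lt_compat.
        nra.
    - rewrite <- (Rmult_1_r ((K * L * 8 * E * 4) * (Q ^ N / rfact N))) at 2.
      apply Rmult_le_compat_l; [|destruct Hx0; simpl in *; lra].
      apply Rmult_le_pos.
      + apply Rmult_le_pos; [|lra]; apply Rmult_le_pos; [|lra]; apply Rmult_le_pos; [|lra].
        apply Rmult_le_pos; lra.
      + apply Rdiv_le_0_compat; [apply pow_le; unfold Q; lra|apply rfact_pos]. }
  change (is_lim_seq (sum_n (fun k => (-1) ^ k * b k * gen mu k 0 x0)) (f 0%nat 0%nat x0)).
  apply is_lim_seq_ext with (fun N => f 0%nat 0%nat x0 + (-1) ^ N * Int N); [intros; now rewrite ESum|].
  replace (Finite (f 0%nat 0%nat x0)) with (Finite (f 0%nat 0%nat x0 + 0)) by (f_equal; ring).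
  apply is_lim_seq_plus'; [apply is_lim_seq_const|].
  apply is_lim_seq_abs_0.
  apply is_lim_seq_le_le with (fun _ => 0) (fun N => (K * L * 8 * E * 4) * (Q ^ N / rfact N)).
  - intros N; rewrite Rabs_pow_m1_mult; split; [apply Rabs_pos|apply BI].
  - apply is_lim_seq_const.
  - replace (Finite 0) with (Finite ((K * L * 8 * E * 4) * 0)) by (f_equal; ring).
    apply is_lim_seq_mult'; [apply is_lim_seq_const|apply is_lim_seq_pow_fact].
Qed.

(** * Uniqueness by the energy identity *)

(** A primitive of f is nondecreasing, vanishes at a and is nonpositive at b, so it is identically
    zero, and so is its derivative f. *)
Lemma RInt_nonneg_zero a b f : a < b -> cont_on (a, b) f ->
  (forall x, a <= x <= b -> 0 <= f x) -> RInt f a b <= 0 ->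
  forall x, a <= x <= b -> f x = 0.
Proof.
  intros Hab Cf Pf HI x Hx.
  set (I := (a, b) : itv).
  set (F := fun x : R => RInt (fun y => f (clamp I y)) a x : R).
  assert (DF : forall z, is_derive F z (f (clamp I z))).
  { intros z; apply (is_derive_RInt (fun y => f (clamp I y)) F a z); [|apply Cf].
    apply filter_forall; intros y; apply (@RInt_correct R_CompleteNormedModule).
    apply (@ex_RInt_continuous R_CompleteNormedModule); intros; apply Cf. }
  assert (D : forall z, in_itv I z -> is_deriv_on I F z (f z)).
  { intros z Hz; apply is_derive_deriv_on; auto.
    rewrite <- (clamp_id I z Hz) at 2; apply DF. }
  assert (Fa : F a = 0) by (unfold F; rewrite RInt_point; reflexivity).
  assert (Fb : F b <= 0).
  { eapply Rle_trans; [right|exact HI]; unfold F; apply RInt_ext_R; intros z Hz.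
    rewrite Rmin_left, Rmax_right in Hz by lra.
    rewrite clamp_id; [reflexivity|split; simpl; lra]. }
  assert (Ia : in_itv I a) by (split; simpl; lra).
  assert (Ib : in_itv I b) by (split; simpl; lra).
  assert (Mono : forall u v, in_itv I u -> in_itv I v -> u <= v -> F u <= F v).
  { intros u v Hu Hv [L| ->]; [|lra].
    destruct (MVT_deriv_on I F f u v Hu Hv L D) as [c [Hc E]].
    assert (0 <= f c) by (apply Pf; destruct Hu, Hv; simpl in *; lra).
    nra. }
  apply (deriv_on_zero I F x); auto.
  intros z Hz; assert (M1 := Mono a z Ia Hz (proj1 Hz)); assert (M2 := Mono z b Hz Ib (proj2 Hz)).
  lra.
Qed.

Lemma cont3_slice_x X Y I u x : cont3 X Y I u -> in_itv X x -> cont2 I Y (fun t y => u x y t).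
Proof.
  intros C Hx; apply cont2_eps_inv; intros t y Ht Hy eps Heps.
  destruct (cont3_eps X Y I u C x y t Hx Hy Ht eps Heps) as [d [Hd H]].
  exists d; split; auto; intros; apply H; auto.
  rewrite Rminus_diag, Rabs_R0; exact Hd.
Qed.

(** The derivatives entering the energy identity, as explicit functions. Unlike the operators
    [d1_3], [d2_3] and [d3_3], which are additive only where derivatives exist, such records can be
    subtracted member by member. *)
Record energy_jet (I : itv) (w wx wxx wxxx wy wxy wxyy wt : R -> R -> R -> R) : Prop := {
  cont_w : cont3 Ix Iy I w;
  cont_wx : cont3 Ix Iy I wx;
  cont_wxx : cont3 Ix Iy I wxx;
  cont_wxxx : cont3 Ix Iy I wxxx;
  cont_wy : cont3 Ix Iy I wy;
  cont_wxy : cont3 Ix Iy I wxy;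
  cont_wxyy : cont3 Ix Iy I wxyy;
  cont_wt : cont3 Ix Iy I wt;
  deriv_w_x : forall x y t, in_itv Ix x -> in_itv Iy y -> in_itv I t ->
    is_deriv_on Ix (fun z => w z y t) x (wx x y t);
  deriv_wx_x : forall x y t, in_itv Ix x -> in_itv Iy y -> in_itv I t ->
    is_deriv_on Ix (fun z => wx z y t) x (wxx x y t);
  deriv_wxx_x : forall x y t, in_itv Ix x -> in_itv Iy y -> in_itv I t ->
    is_deriv_on Ix (fun z => wxx z y t) x (wxxx x y t);
  deriv_wy_x : forall x y t, in_itv Ix x -> in_itv Iy y -> in_itv I t ->
    is_deriv_on Ix (fun z => wy z y t) x (wxy x y t);
  deriv_w_y : forall x y t, in_itv Ix x -> in_itv Iy y -> in_itv I t ->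
    is_deriv_on Iy (fun z => w x z t) y (wy x y t);
  deriv_wxy_y : forall x y t, in_itv Ix x -> in_itv Iy y -> in_itv I t ->
    is_deriv_on Iy (fun z => wxy x z t) y (wxyy x y t);
  deriv_w_t : forall x y t, in_itv Ix x -> in_itv Iy y -> in_itv I t ->
    is_deriv_on I (fun z => w x y z) t (wt x y t)
}.

(** The equation provides w_xyy with x differentiated first, while the energy flux needs the
    x-derivative of w_y. The exchange of the mixed derivatives reconciles the two. *)
Lemma Ck3_energy_jet I u : fst I < snd I -> Ck3 3 Ix Iy I u ->
  energy_jet I u (d1_3 Ix u) (d1_3 Ix (d1_3 Ix u)) (d1_3 Ix (d1_3 Ix (d1_3 Ix u)))
    (d2_3 Iy u) (d2_3 Iy (d1_3 Ix u)) (d2_3 Iy (d2_3 Iy (d1_3 Ix u))) (d3_3 I u).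
Proof.
  intros HI [Cu [Eu [[Cx [Ex [[Cxx [Exx [[Cxxx _] _]]] [[Cyx [Eyx [_ [[Cyyx _] _]]]] _]]]]
              [[Cy [Ey [[Cxy _] _]]] [Ct _]]]]].
  assert (HX := Ix_lt); assert (HY := Iy_lt).
  assert (Sch : forall x y t, in_itv Ix x -> in_itv Iy y -> in_itv I t ->
     d2_3 Iy (d1_3 Ix u) x y t = d1_3 Ix (d2_3 Iy u) x y t).
  { intros x y t Hx Hy Ht.
    apply (mixed_partials Ix Iy (fun x y => u x y t) (fun x y => d1_3 Ix u x y t)
      (fun x y => d2_3 Iy u x y t) (fun x y => d2_3 Iy (d1_3 Ix u) x y t)
      (fun x y => d1_3 Ix (d2_3 Iy u) x y t)); auto.
    - intros x' y' Hx' Hy'.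
      destruct (Eu x' y' t Hx' Hy' Ht) as [A1 [A2 _]].
      destruct (Ex x' y' t Hx' Hy' Ht) as [_ [A3 _]].
      destruct (Ey x' y' t Hx' Hy' Ht) as [A4 _].
      split; [|split; [|split]].
      + exact (ex_deriv_on_correct Ix (fun z => u z y' t) x' HX Hx' A1).
      + exact (ex_deriv_on_correct Iy (fun z => u x' z t) y' HY Hy' A2).
      + exact (ex_deriv_on_correct Iy (fun z => d1_3 Ix u x' z t) y' HY Hy' A3).
      + exact (ex_deriv_on_correct Ix (fun z => d2_3 Iy u z y' t) x' HX Hx' A4).
    - now apply cont3_slice with I.
    - now apply cont3_slice with I. }
  split; try assumption; intros x y t Hx Hy Ht.
  - exact (ex_deriv_on_correct Ix (fun z => u z y t) x HX Hx (proj1 (Eu x y t Hx Hy Ht))).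
  - exact (ex_deriv_on_correct Ix (fun z => d1_3 Ix u z y t) x HX Hx (proj1 (Ex x y t Hx Hy Ht))).
  - exact (ex_deriv_on_correct Ix (fun z => d1_3 Ix (d1_3 Ix u) z y t) x HX Hx
             (proj1 (Exx x y t Hx Hy Ht))).
  - rewrite Sch by assumption.
    exact (ex_deriv_on_correct Ix (fun z => d2_3 Iy u z y t) x HX Hx (proj1 (Ey x y t Hx Hy Ht))).
  - exact (ex_deriv_on_correct Iy (fun z => u x z t) y HY Hy (proj1 (proj2 (Eu x y t Hx Hy Ht)))).
  - exact (ex_deriv_on_correct Iy (fun z => d2_3 Iy (d1_3 Ix u) x z t) y HY Hy
             (proj1 (proj2 (Eyx x y t Hx Hy Ht)))).
  - exact (ex_deriv_on_correct I (fun z => u x y z) t HI Ht (proj2 (proj2 (Eu x y t Hx Hy Ht)))).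
Qed.

Definition sub3 (u v : R -> R -> R -> R) (x y t : R) : R := u x y t - v x y t.

Lemma cont3_sub X Y I u v : cont3 X Y I u -> cont3 X Y I v -> cont3 X Y I (sub3 u v).
Proof.
  intros Cu Cv.
  apply (cont3_ext X Y I _ (fun x y t => u x y t + (-1) * v x y t)).
  - intros; unfold sub3; ring.
  - apply cont3_plus; [exact Cu|].
    apply (cont3_mult X Y I (fun _ _ _ => -1)); [apply cont3_const|exact Cv].
Qed.

Lemma energy_jet_sub I u ux uxx uxxx uy uxy uxyy ut v vx vxx vxxx vy vxy vxyy vt :
  energy_jet I u ux uxx uxxx uy uxy uxyy ut -> energy_jet I v vx vxx vxxx vy vxy vxyy vt ->
  energy_jet I (sub3 u v) (sub3 ux vx) (sub3 uxx vxx) (sub3 uxxx vxxx)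
    (sub3 uy vy) (sub3 uxy vxy) (sub3 uxyy vxyy) (sub3 ut vt).
Proof.
  intros [] []; split; try (now apply cont3_sub); intros; unfold sub3;
    (apply is_deriv_on_minus; [assumption| |]; auto).
Qed.

Lemma is_derive_locally_zero f x a b l : a < x < b -> (forall y, a < y < b -> f y = 0) ->
  is_derive f x l -> l = 0.
Proof.
  intros Hx Z H.
  assert (H0 : is_derive f x 0).
  { apply is_derive_ext_loc with (fun _ => 0).
    - apply (locally_interval _ x a b); simpl; try tauto.
      intros y Y1 Y2; symmetry; apply Z; simpl in *; tauto.
    - apply (is_derive_const (0 : R_NormedModule) x). }
  apply is_derive_unique in H; apply is_derive_unique in H0; congruence.
Qed.

(* Multiplying the equation by [w] and integrating: the flux [Phi] satisfies
   [Phi' = - int w w_t dy], and only the nonpositive term [- w_x(-1, .)^2 / 2] survives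
   in [Phi (-1)]. *)
Lemma energy_identity a I w wx wxx wxxx wy wxy wxyy wt t :
  energy_jet I w wx wxx wxxx wy wxy wxyy wt -> in_itv I t ->
  (forall x y, in_itv_open Ix x -> in_itv_open Iy y ->
     wt x y t + (wxxx x y t + wxyy x y t + a * wx x y t) = 0) ->
  (forall y, in_itv_open Iy y -> w 0 y t = 0 /\ wx 0 y t = 0 /\ w (-1) y t = 0) ->
  (forall x, in_itv_open Ix x -> w x 0 t = 0 /\ w x 1 t = 0) ->
  RInt (fun x => RInt (fun y => 2 * (w x y t * wt x y t)) 0 1) (-1) 0 <= 0.
Proof.
  intros J Ht PDE BX BY.
  assert (Im1 : in_itv Ix (-1)) by (split; simpl; lra).
  assert (S2 : forall f, cont3 Ix Iy I f -> cont2 Ix Iy (fun x y => f x y t))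
    by (intros; now apply cont3_slice with I).
  assert (Cw := S2 _ (cont_w _ _ _ _ _ _ _ _ _ J)).
  assert (Cwx := S2 _ (cont_wx _ _ _ _ _ _ _ _ _ J)).
  assert (Cwxx := S2 _ (cont_wxx _ _ _ _ _ _ _ _ _ J)).
  assert (Cwxxx := S2 _ (cont_wxxx _ _ _ _ _ _ _ _ _ J)).
  assert (Cwy := S2 _ (cont_wy _ _ _ _ _ _ _ _ _ J)).
  assert (Cwxy := S2 _ (cont_wxy _ _ _ _ _ _ _ _ _ J)).
  assert (Cwxyy := S2 _ (cont_wxyy _ _ _ _ _ _ _ _ _ J)).
  assert (CM := cont2_mult Ix Iy); assert (CP := cont2_plus Ix Iy).
  assert (CC := cont2_const Ix Iy).
  set (phi := fun x y => w x y t * wxx x y t + (- / 2) * (wx x y t * wx x y t)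
                + (- / 2) * (wy x y t * wy x y t) + (a / 2) * (w x y t * w x y t)).
  set (psi := fun x y => w x y t * wxxx x y t + (-1) * (wy x y t * wxy x y t)
                + a * (w x y t * wx x y t)).
  assert (Cphi : cont2 Ix Iy phi).
  { exact (CP _ _ (CP _ _ (CP _ _ (CM _ _ Cw Cwxx) (CM _ _ (CC _) (CM _ _ Cwx Cwx)))
       (CM _ _ (CC _) (CM _ _ Cwy Cwy))) (CM _ _ (CC _) (CM _ _ Cw Cw))). }
  assert (Cpsi : cont2 Ix Iy psi).
  { exact (CP _ _ (CP _ _ (CM _ _ Cw Cwxxx) (CM _ _ (CC _) (CM _ _ Cwy Cwxy)))
       (CM _ _ (CC _) (CM _ _ Cw Cwx))). }
  assert (SL : forall f, cont2 Ix Iy f -> forall x, in_itv Ix x -> cont_on Iy (f x))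
    by (intros f Hf x Hx; apply (cont2_slice Ix Iy f x); auto; simpl; lra).
  assert (Dphi : forall x y, in_itv Ix x -> in_itv Iy y ->
            is_deriv_on Ix (fun z => phi z y) x (psi x y)).
  { intros x y Hx Hy.
    assert (d1 := deriv_w_x _ _ _ _ _ _ _ _ _ J x y t Hx Hy Ht).
    assert (d2 := deriv_wx_x _ _ _ _ _ _ _ _ _ J x y t Hx Hy Ht).
    assert (d3 := deriv_wxx_x _ _ _ _ _ _ _ _ _ J x y t Hx Hy Ht).
    assert (d4 := deriv_wy_x _ _ _ _ _ _ _ _ _ J x y t Hx Hy Ht).
    replace (psi x y) with
      ((wx x y t * wxx x y t + w x y t * wxxx x y t)
       + (- / 2) * (wxx x y t * wx x y t + wx x y t * wxx x y t)
       + (- / 2) * (wxy x y t * wy x y t + wy x y t * wxy x y t)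
       + (a / 2) * (wx x y t * w x y t + w x y t * wx x y t)) by (unfold psi; field).
    exact (is_deriv_on_plus Ix _ _ x _ _ Hx
      (is_deriv_on_plus Ix _ _ x _ _ Hx
        (is_deriv_on_plus Ix _ _ x _ _ Hx (is_deriv_on_mult Ix _ _ x _ _ Hx d1 d3)
          (is_deriv_on_scal Ix _ x _ (- / 2) Hx (is_deriv_on_mult Ix _ _ x _ _ Hx d2 d2)))
        (is_deriv_on_scal Ix _ x _ (- / 2) Hx (is_deriv_on_mult Ix _ _ x _ _ Hx d4 d4)))
      (is_deriv_on_scal Ix _ x _ (a / 2) Hx (is_deriv_on_mult Ix _ _ x _ _ Hx d1 d1))). }
  set (Phi := fun x => RInt (phi x) 0 1 : R).
  set (Psi := fun x => RInt (psi x) 0 1 : R).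
  assert (DPhi : forall x, in_itv Ix x -> is_deriv_on Ix Phi x (Psi x)).
  { intros x Hx; exact (is_deriv_on_RInt Ix 0 1 phi psi x Ix_lt Rle_0_1 Hx Dphi (SL _ Cphi) Cpsi). }
  assert (CPsi : cont_on Ix Psi).
  { assert (C3 : cont3 Ix (0, 1) I (fun x y _ => psi x y)).
    { intros [[x y] s] [Hx [Hy Hs]]; apply filterlim_locally; intros eps; simpl in *.
      destruct (cont2_eps Ix Iy psi Cpsi x y Hx Hy eps (cond_pos eps)) as [d [Hd H]].
      exists (mkposreal d Hd); intros [[x' y'] s'] [[B1 B2] _] [Hx' [Hy' _]]; now apply H. }
    assert (C2 := cont2_RInt Ix I 0 1 (fun x y _ => psi x y) ltac:(lra) C3).
    apply (cont2_slice I Ix (fun _ x => RInt (psi x) 0 1) t); auto; [simpl; lra|].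
    now apply cont2_swap. }
  assert (EQ : RInt (fun x => RInt (fun y => 2 * (w x y t * wt x y t)) 0 1) (-1) 0 =
               (-2) * (Phi 0 - Phi (-1)) :> R).
  { assert (E1 : RInt Psi (-1) 0 = Phi 0 - Phi (-1) :> R)
      by (apply (FTC_deriv_on Phi Psi); [lra|exact CPsi|exact DPhi]).
    rewrite <- E1.
    transitivity (RInt (fun x => (-2) * Psi x) (-1) 0 : R).
    2: { apply (RInt_scal Psi), (ex_RInt_cont_on Ix); auto using Ix_0; simpl; lra. }
    apply RInt_ext_R; intros x Hx; rewrite Rmin_left, Rmax_right in Hx by lra.
    assert (Hx' : in_itv Ix x) by (split; simpl; lra).
    assert (Hxo : in_itv_open Ix x) by (split; simpl; lra).
    destruct (BY x Hxo) as [B0 B1].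
    (* This integral is zero by the side conditions. Adding it to the derivative of the flux trades
       - w_y w_xy for w w_xyy, after which the equation gives - w w_t. *)
    assert (IBP : RInt (fun y => wy x y t * wxy x y t + w x y t * wxyy x y t) 0 1 = 0 :> R).
    { transitivity (w x 1 t * wxy x 1 t - w x 0 t * wxy x 0 t); [|rewrite B0, B1; ring].
      apply (FTC_deriv_on (fun y => w x y t * wxy x y t)); [lra| |].
      - apply (SL (fun x y => wy x y t * wxy x y t + w x y t * wxyy x y t)); auto.
      - intros y Hy.
        exact (is_deriv_on_mult Iy _ _ y _ _ Hy (deriv_w_y _ _ _ _ _ _ _ _ _ J x y t Hx' Hy Ht)
                 (deriv_wxy_y _ _ _ _ _ _ _ _ _ J x y t Hx' Hy Ht)). }
    assert (Cib := SL _ (CP _ _ (CM _ _ Cwy Cwxy) (CM _ _ Cw Cwxyy)) x Hx').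
    assert (EP : Psi x = RInt (fun y => psi x y +
                   (wy x y t * wxy x y t + w x y t * wxyy x y t)) 0 1).
    { transitivity (Psi x + 0); [ring|].
      transitivity (Psi x + RInt (fun y => wy x y t * wxy x y t + w x y t * wxyy x y t) 0 1);
        [now rewrite IBP|].
      symmetry; exact (RInt_plus_Iy _ _ (SL _ Cpsi x Hx') Cib). }
    rewrite EP, <- (RInt_scal_Iy _ _ (cont_on_plus Iy _ _ (SL _ Cpsi x Hx') Cib)).
    apply RInt_ext_R; intros y Hy; rewrite Rmin_left, Rmax_right in Hy by lra.
    assert (E := PDE x y Hxo ltac:(split; simpl; lra)).
    replace (wt x y t) with (- (wxxx x y t + wxyy x y t + a * wx x y t)) by lra.
    unfold psi; ring. }
  (* The conditions at x = 0 and x = -1 hold for all y in an open interval, so they may be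
     differentiated in y. *)
  assert (Wy0 : forall x0, in_itv Ix x0 -> (forall y, in_itv_open Iy y -> w x0 y t = 0) ->
            forall y, 0 < y < 1 -> wy x0 y t = 0).
  { intros x0 Hx0 Z y Hy.
    apply (is_derive_locally_zero (fun z => w x0 z t) y 0 1); auto.
    apply (is_deriv_on_interior Iy); [split; simpl; lra|].
    apply (deriv_w_y _ _ _ _ _ _ _ _ _ J); auto; split; simpl; lra. }
  assert (P0 : Phi 0 = 0).
  { apply RInt_zero_Iy; intros y Hy.
    destruct (BX y ltac:(split; simpl; lra)) as [b1 [b2 _]].
    unfold phi; rewrite b1, b2, (Wy0 0 Ix_0); auto; [ring|].
    intros z Hz; apply (BX z Hz). }
  assert (P1 : Phi (-1) <= 0).
  { apply Ropp_le_cancel; rewrite Ropp_0.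
    replace (- Phi (-1)) with ((-1) * Phi (-1)) by ring; unfold Phi.
    rewrite <- RInt_scal_Iy by auto.
    apply RInt_ge_0; [lra| |].
    - apply ex_RInt_Iy, (cont_on_mult Iy (fun _ => -1)); [apply cont_on_const|auto].
    - intros y Hy; destruct (BX y ltac:(split; simpl; lra)) as [_ [_ b3]].
      unfold phi; rewrite b3, (Wy0 (-1) Im1); auto.
      + assert (0 <= wx (-1) y t * wx (-1) y t) by nra; lra.
      + intros z Hz; apply (BX z Hz). }
  rewrite EQ; lra.
Qed.

(** The energy E(t), the integral of w^2, starts at 0 and has nonpositive derivative at interior
    times. The mean value theorem uses interior times only, so E <= 0 up to T. Two applications of
    [RInt_nonneg_zero], in x and then in y, give w^2 = 0. *)
Lemma energy_uniqueness a T w wx wxx wxxx wy wxy wxyy wt : 0 < T ->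
  energy_jet (0, T) w wx wxx wxxx wy wxy wxyy wt ->
  (forall x y t, in_itv_open Ix x -> in_itv_open Iy y -> in_itv_open (0, T) t ->
     wt x y t + (wxxx x y t + wxyy x y t + a * wx x y t) = 0) ->
  (forall y t, in_itv_open Iy y -> in_itv_open (0, T) t ->
     w 0 y t = 0 /\ wx 0 y t = 0 /\ w (-1) y t = 0) ->
  (forall x t, in_itv_open Ix x -> in_itv_open (0, T) t -> w x 0 t = 0 /\ w x 1 t = 0) ->
  (forall x y, in_itv_open Ix x -> in_itv_open Iy y -> w x y 0 = 0) ->
  forall x y t, in_itv Ix x -> in_itv Iy y -> in_itv (0, T) t -> w x y t = 0.
Proof.
  intros HT J PDE BX BY IC.
  set (I := (0, T) : itv).
  assert (HI : fst I < snd I) by (simpl; lra).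
  assert (Cw := cont_w _ _ _ _ _ _ _ _ _ J).
  assert (Cwt := cont_wt _ _ _ _ _ _ _ _ _ J).
  assert (Cq : cont3 Ix Iy I (fun x y t => w x y t * w x y t)) by now apply cont3_mult.
  assert (Cq' : cont3 Ix Iy I (fun x y t => 2 * (w x y t * wt x y t))).
  { apply (cont3_mult Ix Iy I (fun _ _ _ => 2)); [apply cont3_const|now apply cont3_mult]. }
  set (e := fun x t => RInt (fun y => w x y t * w x y t) 0 1 : R).
  set (e' := fun x t => RInt (fun y => 2 * (w x y t * wt x y t)) 0 1 : R).
  assert (Ce : cont2 Ix I e) by (apply (cont2_RInt Ix I 0 1 _ ltac:(lra) Cq)).
  assert (Ce' : cont2 Ix I e') by (apply (cont2_RInt Ix I 0 1 _ ltac:(lra) Cq')).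
  assert (De : forall x t, in_itv Ix x -> in_itv I t -> is_deriv_on I (e x) t (e' x t)).
  { intros x t Hx Ht.
    apply (is_deriv_on_RInt I 0 1 (fun t y => w x y t * w x y t)
      (fun t y => 2 * (w x y t * wt x y t)) t HI Rle_0_1 Ht).
    - intros s y Hs Hy; assert (d := deriv_w_t _ _ _ _ _ _ _ _ _ J x y s Hx Hy Hs).
      replace (2 * (w x y s * wt x y s)) with (wt x y s * w x y s + w x y s * wt x y s) by ring.
      exact (is_deriv_on_mult I _ _ s _ _ Hs d d).
    - intros s Hs; apply (cont2_slice I Iy (fun t y => w x y t * w x y t)); auto; [simpl; lra|].
      now apply (cont3_slice_x Ix Iy I (fun x y t => w x y t * w x y t)).
    - now apply (cont3_slice_x Ix Iy I (fun x y t => 2 * (w x y t * wt x y t))). }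
  set (E := fun t => RInt (fun x => e x t) (-1) 0 : R).
  set (E' := fun t => RInt (fun x => e' x t) (-1) 0 : R).
  assert (DE : forall t, in_itv I t -> is_deriv_on I E t (E' t)).
  { intros t Ht; apply (is_deriv_on_RInt I (-1) 0 (fun t x => e x t) (fun t x => e' x t) t HI ltac:(lra) Ht).
    - intros s z Hs Hz; now apply De.
    - intros s Hs; apply (cont2_slice I Ix (fun t x => e x t)); auto; [simpl; lra|].
      now apply cont2_swap.
    - now apply cont2_swap. }
  assert (NE : forall t, in_itv_open I t -> E' t <= 0).
  { intros t Ht; apply (energy_identity a I w wx wxx wxxx wy wxy wxyy wt t J);
      [destruct Ht; split; simpl in *; lra|auto|auto|auto]. }
  assert (E0 : E 0 = 0).
  { transitivity (RInt (fun _ => 0) (-1) 0 : R).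
    - apply RInt_ext_R; intros x Hx; rewrite Rmin_left, Rmax_right in Hx by lra.
      apply RInt_zero_Iy; intros y Hy; rewrite IC; [ring|split; simpl; lra..].
    - rewrite RInt_const; apply Rmult_0_r. }
  assert (EN : forall t, in_itv I t -> E t <= 0).
  { intros t Ht; destruct (Req_dec t 0) as [->|Hne]; [lra|].
    assert (Lt : 0 < t) by (destruct Ht; simpl in *; lra).
    assert (H0 : in_itv I 0) by (split; simpl; lra).
    destruct (MVT_deriv_on I E E' 0 t H0 Ht Lt DE) as [c [Hc Ec]].
    assert (N := NE c ltac:(destruct Ht; split; simpl in *; lra)); nra. }
  intros x y t Hx Hy Ht.
  assert (Sl : forall z, in_itv Ix z -> cont_on Iy (fun y => w z y t * w z y t)).
  { intros z Hz; apply (cont2_slice Ix Iy (fun x y => w x y t * w x y t)); auto; [simpl; lra|].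
    now apply (cont3_slice Ix Iy I (fun x y t => w x y t * w x y t)). }
  assert (Ex : e x t = 0).
  { apply (RInt_nonneg_zero (-1) 0 (fun x => e x t)); [lra| | |exact (EN t Ht)|exact Hx].
    - apply (cont2_slice I Ix (fun t x => e x t) t); auto; [simpl; lra|now apply cont2_swap].
    - intros z Hz; apply RInt_ge_0; [lra|now apply ex_RInt_Iy, Sl|intros; nra]. }
  assert (W : w x y t * w x y t = 0).
  { apply (RInt_nonneg_zero 0 1 (fun y => w x y t * w x y t)); [lra|now apply Sl| | |exact Hy].
    - intros; nra.
    - right; exact Ex. }
  nra.
Qed.

Lemma zk_solution_unique a T h u v : 0 < T -> zk_solution a T h u -> zk_solution a T h v ->
  forall x y t, in_itv Ix x -> in_itv Iy y -> in_itv (0, T) t -> v x y t = u x y t.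
Proof.
  intros HT [Ru [Pu [Bu [Su Iu]]]] [Rv [Pv [Bv [Sv Iv]]]] x y t Hx Hy Ht.
  apply Rminus_diag_uniq.
  assert (HI : fst (0, T) < snd (0, T)) by (simpl; lra).
  refine (energy_uniqueness a T (sub3 v u) _ _ _ _ _ _ _ HT
    (energy_jet_sub _ _ _ _ _ _ _ _ _ _ _ _ _ _ _ _ _ (Ck3_energy_jet _ v HI Rv)
       (Ck3_energy_jet _ u HI Ru)) _ _ _ _ x y t Hx Hy Ht).
  - intros x' y' t' Hx' Hy' Ht'.
    assert (A := Pu x' y' t' Hx' Hy' Ht'); assert (B := Pv x' y' t' Hx' Hy' Ht').
    unfold sub3; cbv beta delta [opP d1_2 d2_2] in A, B.
    unfold d1_3, d2_3, d3_3 in *; lra.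
  - intros y' t' Hy' Ht'; destruct (Bu y' t' Hy' Ht') as [A1 [A2 A3]].
    destruct (Bv y' t' Hy' Ht') as [B1 [B2 B3]]; unfold sub3.
    rewrite A1, A2, A3, B1, B2, B3; repeat split; ring.
  - intros x' t' Hx' Ht'; destruct (Su x' t' Hx' Ht') as [A1 A2].
    destruct (Sv x' t' Hx' Ht') as [B1 B2]; unfold sub3.
    rewrite A1, A2, B1, B2; split; ring.
  - intros x' y' Hx' Hy'; unfold sub3; rewrite (Iu x' y' Hx' Hy'), (Iv x' y' Hx' Hy'); ring.
Qed.

(** * The trajectory *)

(** Each derivation is a phase shift by pi / 2, which gives all orders by one formula. *)
Definition efun_jet (j q : nat) (y : R) : R :=
  sqrt 2 * ((INR j * PI) ^ q * sin (INR j * PI * y + INR q * (PI / 2))).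

Lemma efun_jet_0 j y : efun_jet j 0 y = efun j y.
Proof.
  unfold efun_jet, efun; simpl; rewrite Rmult_0_l, Rplus_0_r; ring.
Qed.

Lemma efun_jet_2 j y : efun_jet j 2 y = - lambda j * efun j y.
Proof.
  unfold efun_jet, efun; rewrite lambda_sq.
  replace (INR j * PI * y + INR 2 * (PI / 2)) with (INR j * PI * y + PI) by (simpl; field).
  rewrite neg_sin; ring.
Qed.

Lemma efun_jet_jet j I : jet1 I (efun_jet j).
Proof.
  intros q y Hy; apply is_derive_deriv_on; auto; unfold efun_jet.
  replace (INR j * PI * y + INR (S q) * (PI / 2))
    with (PI / 2 + (INR j * PI * y + INR q * (PI / 2))) by (rewrite S_INR; ring).
  rewrite <- cos_sin, <- (tech_pow_Rmult (INR j * PI) q).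
  auto_derive; auto; ring.
Qed.

(** By (j pi)^q <= q! exp(j pi), uniform analyticity in y is bought with an exponential in j, later
    paid for by the decay of the data. *)
Lemma efun_jet_bound j q y : Rabs (efun_jet j q y) <= 2 * (rfact q * exp (INR j * PI)).
Proof.
  unfold efun_jet; rewrite !Rabs_mult, <- RPow_abs, (Rabs_pos_eq (sqrt 2)) by apply sqrt_pos.
  assert (P : 0 <= INR j * PI) by (apply Rmult_le_pos; [apply pos_INR|left; apply PI_RGT_0]).
  rewrite (Rabs_pos_eq (INR j * PI)) by exact P.
  assert (S1 : Rabs (sin (INR j * PI * y + INR q * (PI / 2))) <= 1) by (apply Rabs_le, SIN_bound).
  assert (E := pow_fact_le_exp q _ P); assert (F := rfact_pos q).
  assert (E' : (INR j * PI) ^ q <= rfact q * exp (INR j * PI)).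
  { apply (Rmult_le_compat_l (rfact q)) in E; [|lra].
    replace (rfact q * ((INR j * PI) ^ q / rfact q)) with ((INR j * PI) ^ q) in E by (field; lra).
    exact E. }
  apply Rmult_le_compat; [apply sqrt_pos| |apply sqrt_2_le_2|].
  - apply Rmult_le_pos; [now apply pow_le|apply Rabs_pos].
  - rewrite <- (Rmult_1_r (rfact q * _)); apply Rmult_le_compat; auto using Rabs_pos.
    now apply pow_le.
Qed.

(** The square of an expression linear in j is the form taken by [gen_bound], which then costs exp(6
    j (PI + a)). *)
Lemma lambda_minus_bound a j : 0 < a -> (1 <= j)%nat ->
  Rabs (lambda j - a) <= (INR j * (PI + a)) ^ 2.
Proof.
  intros Ha Hj.
  assert (J : 1 <= INR j) by (apply (le_INR 1); exact Hj).
  assert (P := PI2_1); assert (L := pow2_ge_0 (INR j * PI)).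
  assert (U1 : 1 <= 2 * (INR j * INR j) * PI) by nra.
  assert (U : a <= 2 * (INR j * INR j) * PI * a).
  { rewrite <- (Rmult_1_l a) at 1; apply Rmult_le_compat_r; lra. }
  assert (V : 0 <= (INR j * INR j) * (a * a)) by (apply Rmult_le_pos; nra).
  replace ((INR j * (PI + a)) ^ 2) with ((INR j * PI) ^ 2 + 2 * (INR j * INR j) * PI * a
     + (INR j * INR j) * (a * a)) by ring.
  rewrite lambda_sq; apply Rabs_le; lra.
Qed.

(** The exponential rate in j which the data must beat: 6 (PI + a) from [gen_bound] and PI from
    [efun_jet_bound]. *)
Definition growth (a : R) : R := 6 * (PI + a) + PI.

Section Trajectory.

Variables (a T K kappa : R) (A : nat -> R) (Z : nat -> nat -> R -> R).
Hypothesis a_pos : 0 < a.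
Hypothesis T_pos : 0 < T.
Hypothesis K_pos : 0 < K.
Hypothesis Z_jet : forall k, jet1 (0, T) (Z k).
Hypothesis A_nonneg : forall k, 0 <= A k.
Hypothesis Z_bound : forall k i t, in_itv (0, T) t ->
  Rabs (Z k i t) <= A k * (K ^ i * rfact (2 * i)).
Hypothesis A_decay : forall k, A k * exp (growth a * INR (S k)) <= kappa * (/ 4) ^ k.

(** Modes are counted from 0, mode k having frequency S k. The orders of derivation in x, y, t are
    p, q, r; a time derivative only shifts the index in the jet of the k-th flat output. *)
Definition traj_term (k i p q r : nat) (x y t : R) : R :=
  gen (lambda (S k) - a) i p x * Z k (i + r) t * efun_jet (S k) q y.

Definition traj_mode (k p q r : nat) (x y t : R) : R :=
  Series (fun i => traj_term k i p q r x y t).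

Definition traj (p q r : nat) (x y t : R) : R :=
  Series (fun k => traj_mode k p q r x y t).

(** Gevrey weight of orders 1, 1, 2. The factor (16 K)^r collects K^r, then 4^r from splitting (2i +
    2r)!, and 4^r from (2r)! <= 4^r r!^2. *)
Definition gev (p q r : nat) : R := rfact p * rfact q * (rfact r ^ 2 * (16 * K) ^ r).

Lemma gev_pos p q r : 0 < gev p q r.
Proof.
  unfold gev; assert (H := rfact_pos p); assert (H1 := rfact_pos q); assert (H2 := rfact_pos r).
  apply Rmult_lt_0_compat; [nra|]; apply Rmult_lt_0_compat; apply pow_lt; lra.
Qed.

Lemma traj_term_jet k i : jet3 Ix Iy (0, T) (traj_term k i).
Proof.
  apply (jet3_product Ix Iy (0, T) (gen (lambda (S k) - a) i) (efun_jet (S k)) (fun r => Z k (i + r))).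
  - apply gen_jet.
  - apply efun_jet_jet.
  - intros r t Ht; rewrite Nat.add_succ_r; now apply Z_jet.
Qed.

Lemma kappa_nonneg : 0 <= kappa.
Proof.
  assert (H := A_decay 0); rewrite pow_O, !Rmult_1_r in H.
  eapply Rle_trans; [|exact H]; apply Rmult_le_pos; [apply A_nonneg|left; apply exp_pos].
Qed.

(** The bound separates the orders of derivation, the mode k (geometric, by [A_decay]) and the index
    i (an exponential series). This is the shape required by [jet3_Series], applied once in i and
    once in k. The factor 16 is 8 from [gen_bound] times 2 from [efun_jet_bound], and 64 is 16 times
    the 4 of the factorial splitting. *)
Lemma traj_term_bound k i p q r x y t : in_itv Ix x -> in_itv Iy y -> in_itv (0, T) t ->
  Rabs (traj_term k i p q r x y t) <=
    (gev p q r * (16 * kappa * (/ 4) ^ k)) * ((64 * K) ^ i / rfact i).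
Proof.
  intros Hx Hy Ht; unfold traj_term.
  assert (Jpos : 0 <= INR (S k) * (PI + a)).
  { apply Rmult_le_pos; [apply pos_INR|]; generalize PI_RGT_0; lra. }
  assert (G := gen_bound (lambda (S k) - a) (INR (S k) * (PI + a)) i p x
    (lambda_minus_bound a (S k) a_pos ltac:(lia)) Jpos (Ix_abs x Hx)).
  assert (E := efun_jet_bound (S k) q y).
  assert (Zb := Z_bound k (i + r) t Ht).
  rewrite !Rabs_mult.
  assert (Ak := A_nonneg k).
  assert (Fi := rfact_pos i); assert (F2i := rfact_pos (2 * i)); assert (F3 := rfact_pos (3 * i + 2)).
  set (X1 := exp (6 * (INR (S k) * (PI + a)))) in *; set (X2 := exp (INR (S k) * PI)) in *.
  assert (PX1 : 0 < X1) by apply exp_pos; assert (PX2 : 0 < X2) by apply exp_pos.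
  assert (PKi : 0 < K ^ i) by now apply pow_lt.
  assert (PKr : 0 < K ^ r) by now apply pow_lt.
  assert (P4i : 0 < 4 ^ i) by (apply pow_lt; lra).
  assert (P4r : 0 < 4 ^ r) by (apply pow_lt; lra).
  assert (Zb' : Rabs (Z k (i + r) t) <=
     A k * ((K ^ i * 4 ^ i * rfact (2 * i)) * (K ^ r * 4 ^ r * (4 ^ r * rfact r ^ 2)))).
  { eapply Rle_trans; [exact Zb|]; apply Rmult_le_compat_l; [exact Ak|].
    assert (U1 := rfact_add_upper (2 * i) (2 * r)); assert (U2 := rfact_add_upper r r).
    replace (2 * i + 2 * r)%nat with (2 * (i + r))%nat in U1 by lia.
    replace (r + r)%nat with (2 * r)%nat in U2 by lia.
    rewrite pow_mult in U1, U2; replace (2 ^ 2) with 4 in U1, U2 by ring.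
    rewrite pow_add in U1; rewrite pow_add.
    replace (K ^ i * 4 ^ i * rfact (2 * i) * (K ^ r * 4 ^ r * (4 ^ r * rfact r ^ 2)))
      with (K ^ i * K ^ r * (4 ^ i * 4 ^ r * (rfact (2 * i) * (4 ^ r * (rfact r * rfact r))))) by ring.
    apply Rmult_le_compat_l; [nra|]; eapply Rle_trans; [exact U1|].
    apply Rmult_le_compat_l; [nra|]; apply Rmult_le_compat_l; lra. }
  assert (Fr3 : rfact (2 * i) / rfact (3 * i + 2) <= / rfact i).
  { assert (Lw := rfact_add_lower (2 * i) i).
    replace (2 * i + i)%nat with (3 * i)%nat in Lw by lia.
    assert (Lm := rfact_mono (3 * i) (3 * i + 2) ltac:(lia)).
    apply Rmult_le_reg_r with (rfact (3 * i + 2) * rfact i); [nra|].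
    replace (rfact (2 * i) / rfact (3 * i + 2) * (rfact (3 * i + 2) * rfact i))
      with (rfact (2 * i) * rfact i) by (field; lra).
    replace (/ rfact i * (rfact (3 * i + 2) * rfact i)) with (rfact (3 * i + 2)) by (field; lra).
    lra. }
  assert (XX : X1 * X2 = exp (growth a * INR (S k))).
  { unfold X1, X2, growth; rewrite <- exp_plus; f_equal; ring. }
  assert (AD := A_decay k); rewrite <- XX in AD.
  apply Rle_trans with ((rfact p * (8 * (16 ^ i / rfact (3 * i + 2)) * X1)) *
     (A k * ((K ^ i * 4 ^ i * rfact (2 * i)) * (K ^ r * 4 ^ r * (4 ^ r * rfact r ^ 2)))) *
     (2 * (rfact q * X2))).
  { apply Rmult_le_compat; auto using Rabs_pos.
    - apply Rmult_le_pos; apply Rabs_pos.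
    - apply Rmult_le_compat; auto using Rabs_pos. }
  replace ((rfact p * (8 * (16 ^ i / rfact (3 * i + 2)) * X1)) *
     (A k * ((K ^ i * 4 ^ i * rfact (2 * i)) * (K ^ r * 4 ^ r * (4 ^ r * rfact r ^ 2)))) *
     (2 * (rfact q * X2)))
    with ((gev p q r * (16 * (A k * (X1 * X2)))) * ((64 * K) ^ i * (rfact (2 * i) / rfact (3 * i + 2)))).
  2: { unfold gev; replace 64 with (16 * 4) by ring.
       replace ((16 * K) ^ r) with ((4 * 4 * K) ^ r) by (f_equal; ring).
       rewrite !Rpow_mult_distr; field; lra. }
  assert (GP := gev_pos p q r).
  assert (P64 : 0 < (64 * K) ^ i) by (apply pow_lt; lra).
  assert (AX : 0 <= A k * (X1 * X2)) by (apply Rmult_le_pos; nra).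
  apply Rmult_le_compat.
  - apply Rmult_le_pos; lra.
  - apply Rmult_le_pos; [lra|]; apply Rdiv_le_0_compat; lra.
  - apply Rmult_le_compat_l; lra.
  - apply Rmult_le_compat_l; lra.
Qed.

Definition traj_sum : R := Series (fun i => (64 * K) ^ i / rfact i).

Lemma traj_sum_nonneg : 0 <= traj_sum.
Proof.
  eapply Rle_trans; [apply Rabs_pos|].
  apply (Series_dom (fun _ => 0) (fun i => (64 * K) ^ i / rfact i)); [|apply ex_series_exp].
  intros n; rewrite Rabs_R0; apply Rdiv_le_0_compat; [apply pow_le; lra|apply rfact_pos].
Qed.

Lemma ex_series_traj_term k p q r x y t : in_itv Ix x -> in_itv Iy y -> in_itv (0, T) t ->
  ex_series (fun i => traj_term k i p q r x y t).
Proof.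
  intros Hx Hy Ht; eapply ex_series_dom; [intros i; now apply traj_term_bound|].
  apply (ex_series_scal_l _ _ (ex_series_exp (64 * K))).
Qed.

Lemma traj_mode_bound k p q r x y t : in_itv Ix x -> in_itv Iy y -> in_itv (0, T) t ->
  Rabs (traj_mode k p q r x y t) <= (gev p q r * (16 * kappa * traj_sum)) * (/ 4) ^ k.
Proof.
  intros Hx Hy Ht; unfold traj_mode; eapply Rle_trans.
  - apply Series_dom; [intros i; now apply traj_term_bound|].
    apply (ex_series_scal_l _ _ (ex_series_exp (64 * K))).
  - rewrite (Series_scal_l _ (fun i => (64 * K) ^ i / rfact i)); fold traj_sum; right; ring.
Qed.

Lemma traj_mode_jet k : jet3 Ix Iy (0, T) (traj_mode k).
Proof.
  apply (jet3_Series Ix Iy (0, T) (traj_term k) (fun p q r => gev p q r * (16 * kappa * (/ 4) ^ k))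
    (fun i => (64 * K) ^ i / rfact i)).
  - intros i; apply traj_term_jet.
  - apply ex_series_exp.
  - intros; now apply traj_term_bound.
Qed.

Lemma ex_series_traj_mode p q r x y t : in_itv Ix x -> in_itv Iy y -> in_itv (0, T) t ->
  ex_series (fun k => traj_mode k p q r x y t).
Proof.
  intros Hx Hy Ht; eapply ex_series_dom; [intros k; now apply traj_mode_bound|].
  apply (ex_series_scal_l _ _ ex_series_quarter).
Qed.

Lemma traj_jet : jet3 Ix Iy (0, T) traj.
Proof.
  apply (jet3_Series Ix Iy (0, T) traj_mode (fun p q r => gev p q r * (16 * kappa * traj_sum))
    (fun k => (/ 4) ^ k)).
  - intros k; apply traj_mode_jet.
  - apply ex_series_quarter.
  - intros; now apply traj_mode_bound.
Qed.

(** The summand 1 makes the constant positive even for zero data, as the Gevrey classes require; 4/3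
    is the sum of the geometric series in k. *)
Definition traj_const : R := 1 + 16 * kappa * traj_sum * (4 / 3).

Lemma traj_const_pos : 0 < traj_const.
Proof.
  unfold traj_const; assert (H := kappa_nonneg); assert (H1 := traj_sum_nonneg); nra.
Qed.

Lemma traj_bound p q r x y t : in_itv Ix x -> in_itv Iy y -> in_itv (0, T) t ->
  Rabs (traj p q r x y t) <= traj_const * gev p q r.
Proof.
  intros Hx Hy Ht; unfold traj; eapply Rle_trans.
  - apply Series_dom; [intros k; now apply traj_mode_bound|].
    apply (ex_series_scal_l _ _ ex_series_quarter).
  - rewrite (Series_scal_l _ (fun k => (/ 4) ^ k)), Series_quarter.
    assert (G := gev_pos p q r); unfold traj_const; lra.
Qed.

(** The spatial operator kills the term i = 0 and sends the term i + 1 to minus the time derivative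
    of the term i, so the two series cancel after an index shift. *)
Lemma traj_mode_pde k x y t : in_itv Ix x -> in_itv Iy y -> in_itv (0, T) t ->
  traj_mode k 0 0 1 x y t +
    (traj_mode k 3 0 0 x y t + traj_mode k 1 2 0 x y t + a * traj_mode k 1 0 0 x y t) = 0.
Proof.
  intros Hx Hy Ht; unfold traj_mode.
  assert (Ex := fun p q r => ex_series_traj_term k p q r x y t Hx Hy Ht).
  assert (E30 := Ex 3%nat O O); assert (E12 := Ex 1%nat 2%nat O); assert (E10 := Ex 1%nat O O).
  assert (Ea := ex_series_scal_l a _ E10).
  rewrite <- (Series_scal_l a).
  rewrite <- Series_plus by assumption.
  rewrite <- Series_plus.
  2: { apply (ex_series_plus (fun i => traj_term k i 3 0 0 x y t)); assumption. }
  2: { exact Ea. }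
  assert (Xb := Ix_abs x Hx).
  rewrite (Series_incr_1 (fun n => traj_term k n 3 0 0 x y t + traj_term k n 1 2 0 x y t + a * traj_term k n 1 0 0 x y t)).
  2: { apply (ex_series_plus (fun n => traj_term k n 3 0 0 x y t + traj_term k n 1 2 0 x y t)).
       - apply (ex_series_plus (fun i => traj_term k i 3 0 0 x y t)); assumption.
       - exact Ea. }
  rewrite (Series_ext (fun n => traj_term k (S n) 3 0 0 x y t + traj_term k (S n) 1 2 0 x y t
             + a * traj_term k (S n) 1 0 0 x y t) (fun i => (-1) * traj_term k i 0 0 1 x y t)).
  - rewrite Series_scal_l; unfold traj_term.
    rewrite efun_jet_2, efun_jet_0.
    assert (O := gen_ode_0 (lambda (S k) - a) x Xb).
    replace (gen (lambda (S k) - a) 0 3 x)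
      with ((lambda (S k) - a) * gen (lambda (S k) - a) 0 1 x) by lra.
    ring.
  - intros i; unfold traj_term; rewrite efun_jet_2, efun_jet_0.
    assert (O := gen_ode_S (lambda (S k) - a) i x Xb).
    replace (gen (lambda (S k) - a) (S i) 3 x)
      with ((lambda (S k) - a) * gen (lambda (S k) - a) (S i) 1 x - gen (lambda (S k) - a) i 0 x) by lra.
    replace (S i + 0)%nat with (i + 1)%nat by lia; ring.
Qed.

Lemma traj_pde x y t : in_itv Ix x -> in_itv Iy y -> in_itv (0, T) t ->
  traj 0 0 1 x y t + (traj 3 0 0 x y t + traj 1 2 0 x y t + a * traj 1 0 0 x y t) = 0.
Proof.
  intros Hx Hy Ht; unfold traj.
  assert (Ex := fun p q r => ex_series_traj_mode p q r x y t Hx Hy Ht).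
  assert (E01 := Ex O O 1%nat); assert (E30 := Ex 3%nat O O).
  assert (E12 := Ex 1%nat 2%nat O); assert (E10 := Ex 1%nat O O).
  assert (Ea := ex_series_scal_l a _ E10).
  assert (E2 := ex_series_plus _ _ E30 E12); assert (E3 := ex_series_plus _ _ E2 Ea).
  rewrite <- (Series_scal_l a).
  rewrite <- Series_plus by assumption.
  rewrite <- Series_plus; [|exact E2|exact Ea].
  rewrite <- Series_plus; [|exact E01|exact E3].
  apply Series_zero; intros k; now apply traj_mode_pde.
Qed.

Lemma traj_eq_zero p q r x y t : (forall k i, traj_term k i p q r x y t = 0) ->
  traj p q r x y t = 0.
Proof.
  intros H; unfold traj; apply Series_zero; intros k; unfold traj_mode; apply Series_zero; auto.
Qed.

Lemma traj_left q r y t : traj 0 q r 0 y t = 0 /\ traj 1 q r 0 y t = 0.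
Proof.
  split; apply traj_eq_zero; intros k i; unfold traj_term;
    destruct (gen_at_0 (lambda (S k) - a) i) as [G0 [G1 _]]; rewrite ?G0, ?G1; ring.
Qed.

Lemma traj_sides p r x t : traj p 0 r x 0 t = 0 /\ traj p 0 r x 1 t = 0.
Proof.
  split; apply traj_eq_zero; intros k i; unfold traj_term; rewrite efun_jet_0, efun_sinj.
  - rewrite sinj_0; ring.
  - rewrite sinj_1; ring.
Qed.

Lemma traj_gevrey3 : gevrey3 1 1 2 Ix Iy (0, T) (traj 0 0 0).
Proof.
  assert (HI : fst (0, T) < snd (0, T)) by exact T_pos.
  split.
  - apply (jet3_Cinf3 Ix Iy (0, T) traj _ Ix_lt Iy_lt HI traj_jet); [|reflexivity].
    apply (jet3_cont3 Ix Iy (0, T) traj (fun p q r => traj_const * gev p q r) traj_jet).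
    intros; now apply traj_bound.
  - exists traj_const, 1, 1, (/ (16 * K)).
    assert (KI : 0 < / (16 * K)) by (apply Rinv_0_lt_compat; lra).
    split; [apply traj_const_pos|]; split; [lra|]; split; [lra|]; split; [exact KI|].
    intros p q r x y t Hx Hy Ht.
    rewrite (jet3_dpart3 Ix Iy (0, T) traj _ Ix_lt Iy_lt HI traj_jet) by auto.
    eapply Rle_trans; [now apply traj_bound|]; right; f_equal.
    unfold gev, factpow; rewrite !Rpower_1 by apply rfact_pos.
    replace 2 with (INR 2) by reflexivity; rewrite Rpower_pow by apply rfact_pos.
    rewrite !pow1, pow_inv, Rpow_mult_distr.
    assert (0 < 16 ^ r) by (apply pow_lt; lra); assert (0 < K ^ r) by now apply pow_lt.
    field; lra.
Qed.

Lemma traj_control_gevrey2 : gevrey2 1 2 Iy (0, T) (traj 0 0 0 (-1)).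
Proof.
  assert (HI : fst (0, T) < snd (0, T)) by exact T_pos.
  assert (Im1 : in_itv Ix (-1)) by (split; simpl; lra).
  assert (J : jet2 Iy (0, T) (fun q r => traj 0 q r (-1))).
  { intros q r y t Hy Ht; exact (proj2 (traj_jet O q r (-1) y t Im1 Hy Ht)). }
  split.
  - apply (jet2_Cinf2 Iy (0, T) (fun q r => traj 0 q r (-1)) _ Iy_lt HI J); [|reflexivity].
    apply (jet2_cont2 Iy (0, T) _ (fun q r => traj_const * gev 0 q r) J).
    intros; now apply traj_bound.
  - exists traj_const, 1, (/ (16 * K)).
    assert (KI : 0 < / (16 * K)) by (apply Rinv_0_lt_compat; lra).
    split; [apply traj_const_pos|]; split; [lra|]; split; [exact KI|].
    intros q r y t Hy Ht.
    rewrite (jet2_dpart2 Iy (0, T) (fun q r => traj 0 q r (-1)) _ Iy_lt HI J) by auto.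
    eapply Rle_trans; [now apply traj_bound|]; right; f_equal.
    unfold gev, factpow; rewrite !Rpower_1 by apply rfact_pos.
    replace 2 with (INR 2) by reflexivity; rewrite Rpower_pow by apply rfact_pos.
    rewrite !pow1, pow_inv, Rpow_mult_distr; simpl (rfact 0).
    assert (0 < 16 ^ r) by (apply pow_lt; lra); assert (0 < K ^ r) by now apply pow_lt.
    field; lra.
Qed.

Lemma traj_zk_solution : (forall k i, Z k i 0 = 0) ->
  zk_solution a T (traj 0 0 0 (-1)) (traj 0 0 0).
Proof.
  intros Z0; assert (HI : fst (0, T) < snd (0, T)) by exact T_pos.
  assert (D := jet3_d Ix Iy (0, T) traj (traj 0 0 0) 0 0 0 Ix_lt Iy_lt HI traj_jet
                 ltac:(reflexivity)).
  split; [apply traj_gevrey3|]; split; [|split; [|split]].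
  - intros x y t Hx Hy Ht.
    assert (Hx' : in_itv Ix x) by (destruct Hx; split; simpl in *; lra).
    assert (Hy' : in_itv Iy y) by (destruct Hy; split; simpl in *; lra).
    assert (Ht' : in_itv (0, T) t) by (destruct Ht; split; simpl in *; lra).
    destruct (D x y t Hx' Hy' Ht') as [_ [_ [_ ->]]].
    rewrite (opP_jet a (fun x y => traj 0 0 0 x y t) (fun p q x y => traj p q 0 x y t)); auto.
    + now apply traj_pde.
    + intros p q x' y' Hx2 Hy2; destruct (traj_jet p q O x' y' t Hx2 Hy2 Ht') as [J1 [J2 _]].
      split; assumption.
  - intros y t Hy Ht.
    assert (Hy' : in_itv Iy y) by (destruct Hy; split; simpl in *; lra).
    assert (Ht' : in_itv (0, T) t) by (destruct Ht; split; simpl in *; lra).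
    destruct (D 0 y t Ix_0 Hy' Ht') as [_ [-> _]].
    destruct (traj_left 0 0 y t) as [L0 L1].
    split; [exact L0|]; split; [exact L1|reflexivity].
  - intros x t _ _; exact (traj_sides 0 0 x t).
  - intros x y _ _; apply traj_eq_zero; intros k i; unfold traj_term; rewrite Z0; ring.
Qed.

(** The statement counts modes from 1 and the trajectory from 0, hence [pred j]. On [0, T] the
    iterated derivatives of the flat output are the members of its jet. *)
Lemma traj_double_series g x y t : generating_functions a g ->
  in_itv Ix x -> in_itv Iy y -> in_itv (0, T) t ->
  is_double_series
    (fun j i => g i j x * deriv_on_n (0, T) i (Z (pred j) O) t * efun j y) (traj 0 0 0 x y t).
Proof.
  intros Hg Hx Hy Ht; exists (fun j => traj_mode (pred j) 0 0 0 x y t); split.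
  - intros [|k] Hj; [lia|]; simpl pred.
    apply is_series_ext with (fun i => traj_term k i 0 0 0 x y t).
    + intros i; unfold traj_term; rewrite efun_jet_0, Nat.add_0_r.
      rewrite (generating_functions_eq a g Hg (S k) Hj i x Hx).
      now rewrite (jet1_deriv_on_n (0, T) (Z k) (Z k O) T_pos (Z_jet k) (fun _ _ => eq_refl) i t Ht).
    + apply Series_correct; now apply ex_series_traj_term.
  - apply (Series_correct (fun k => traj_mode k 0 0 0 x y t)); now apply ex_series_traj_mode.
Qed.

End Trajectory.

(** * From the target state to the controlled trajectory *)

Lemma space_R_null_jets a R1 R2 u : 0 < a -> 1 <= R1 -> 1 <= R2 -> space_R a R1 R2 u ->
  exists P C, null_jets a P /\
    (forall x y, in_itv Ix x -> in_itv Iy y -> u x y = P 0%nat 0%nat 0%nat x y) /\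
    (forall n p q x y, in_itv Ix x -> in_itv Iy y ->
       Rabs (P n p q x y) <= C * (a + 2) ^ n * factpow (p + q + 3 * n) (2 / 3)).
Proof.
  intros Ha H1 H2 [Cu [[C [HC Bu]] BC]].
  set (D := fun p q => dpart2 Ix Iy p q u).
  assert (JD : jet2 Ix Iy D) by (apply Cinf2_jet2; auto using Ix_lt, Iy_lt).
  assert (EP : forall n x y, in_itv Ix x -> in_itv Iy y -> opP_n a n u x y = jetP a D n O O x y)
    by (apply opP_n_jetP; auto).
  exists (jetP a D), C; split; [|split].
  - split; [|split; [|split]].
    + now apply jetP_jet2.
    + apply jetP_cont2; intros p q; exact (proj1 (Cinf2_dpart2 Ix Iy u p q Cu O)).
    + reflexivity.
    + intros n x y Hx Hy; destruct (BC n x y Hx Hy) as [B0 [B1 [B2 B3]]].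
      rewrite <- !EP by auto using Ix_0, Iy_0, Iy_1.
      rewrite <- (jet2_d1_eq Ix Iy (jetP a D n) (opP_n a n u) O O Ix_lt Iy_lt
                    (jetP_jet2 a D JD n) (EP n) 0 y Ix_0 Hy); auto.
  - reflexivity.
  - apply jetP_bound; auto; intros p q x y Hx Hy.
    eapply Rle_trans; [apply Bu; auto|]; apply Rmult_le_compat_l; [lra|].
    eapply Rle_trans; [|apply factpow_mult_le].
    assert (P1 : 1 <= R1 ^ p) by now apply pow_R1_Rle.
    assert (P2 : 1 <= R2 ^ q) by now apply pow_R1_Rle.
    assert (F : 0 < factpow p (2 / 3) * factpow q (2 / 3))
      by (apply Rmult_lt_0_compat; apply factpow_pos).
    rewrite <- (Rmult_1_r (factpow p (2 / 3) * factpow q (2 / 3))) at 2.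
    apply Rmult_le_compat_l; [lra|].
    rewrite <- Rinv_1; apply Rinv_le_contravar; [lra|]; nra.
Qed.

Theorem theorem1p2 (a T R1 R2 : R) (ha : 0 < a) (hT : 0 < T)
  (hR1 : R_threshold a < R1) (hR2 : R_threshold a < R2)
  (g : nat -> nat -> R -> R) (hg : generating_functions a g)
  (u1 : R -> R -> R) (hu1 : space_R a R1 R2 u1) :
  exists h : R -> R -> R,
    gevrey2 1 2 Iy (0, T) h /\
    exists u : R -> R -> R -> R,
      zk_solution a T h u /\
      (forall v : R -> R -> R -> R, zk_solution a T h v ->
         forall x y t : R, in_itv Ix x -> in_itv Iy y -> in_itv (0, T) t ->
           v x y t = u x y t) /\
      (forall x y : R, in_itv Ix x -> in_itv Iy y -> u x y T = u1 x y) /\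
      gevrey3 1 1 2 Ix Iy (0, T) u /\
      exists z : nat -> R -> R,
        (forall j : nat, (1 <= j)%nat -> Cinf1 (0, T) (z j)) /\
        (forall x y t : R, in_itv Ix x -> in_itv Iy y -> in_itv (0, T) t ->
           is_double_series
             (fun j i => g i j x * deriv_on_n (0, T) i (z j) t * efun j y)
             (u x y t)) /\
        (forall y t : R, in_itv Iy y -> in_itv (0, T) t ->
           is_double_series
             (fun j i => g i j (-1) * deriv_on_n (0, T) i (z j) t * efun j y)
             (h y t)).
Proof.
  assert (Th := R_threshold_ge1 a ha).
  destruct (space_R_null_jets a R1 R2 u1 ha ltac:(lra) ltac:(lra) hu1) as [P [C [HP [EP BP]]]].
  assert (C0 := C_nonneg a P C BP).
  set (L := 64 * (a + 2)).
  assert (HL : 0 < L) by (unfold L; lra).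
  destruct (gevrey2_interpolation T L hT HL) as [A [K [HA [HK Interp]]]].
  (* B^(-j) compensates exp(growth a * j) and leaves the factor (1/4)^j needed to sum over the
     modes. *)
  set (B := 4 * exp (growth a)).
  assert (Bg : 0 < growth a) by (unfold growth; generalize PI_RGT_0; lra).
  assert (HB : 1 <= B).
  { unfold B; generalize (exp_ineq1_le (growth a)); lra. }
  set (M := fun k => 32 * C * exp (16 * B ^ 2) / B ^ S k).
  assert (X0 := exp_pos (16 * B ^ 2)).
  assert (PB : forall k, 0 < B ^ k) by (intros; apply pow_lt; lra).
  assert (M0 : forall k, 0 <= M k)
    by (intros k; apply Rdiv_le_0_compat; [apply Rmult_le_pos; lra|apply PB]).
  (* The sign is that of the expansion along [gen]: with these derivatives at time T, the k-th mode
     of the trajectory is exactly the expansion of the sine coefficient of the target. *)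
  set (b := fun k n => (-1) ^ n * coef P n 2 0 (S k) 0).
  assert (Hb : forall k n, Rabs (b k n) <= M k * (L ^ n * rfact (2 * n))).
  { intros k n; unfold b; rewrite Rabs_pow_m1_mult.
    rewrite <- (Rmult_1_l (Rabs (coef P n 2 0 (S k) 0))).
    exact (coef_decay a P HP C ha BP B n 2 0 (S k) 0 ltac:(lia) ltac:(lia) ltac:(lia) HB
             ltac:(lia) Ix_0). }
  assert (CH : forall k, exists z, jet1 (0, T) z /\ (forall n, z n T = b k n) /\
      (forall n, z n 0 = 0) /\
      forall n t, in_itv (0, T) t -> Rabs (z n t) <= M k * A * (K ^ n * rfact (2 * n)))
    by (intros k; exact (Interp (b k) (M k) (M0 k) (Hb k))).
  (* The flat outputs are chosen mode by mode. The estimates stay uniform because A and K were fixed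
     before k. *)
  set (Z := fun k => proj1_sig (constructive_indefinite_description _ (CH k))).
  assert (HZ : forall k, jet1 (0, T) (Z k) /\ (forall n, Z k n T = b k n) /\
      (forall n, Z k n 0 = 0) /\
      forall n t, in_itv (0, T) t -> Rabs (Z k n t) <= M k * A * (K ^ n * rfact (2 * n)))
    by (intros k; exact (proj2_sig (constructive_indefinite_description _ (CH k)))).
  clearbody Z; clear CH.
  assert (ZJ : forall k, jet1 (0, T) (Z k)) by (intros k; apply HZ).
  assert (ZT : forall k n, Z k n T = b k n) by (intros k; apply HZ).
  assert (Z0 : forall k n, Z k n 0 = 0) by (intros k; apply HZ).
  assert (ZB : forall k n t, in_itv (0, T) t -> Rabs (Z k n t) <= M k * A * (K ^ n * rfact (2 * n)))
    by (intros k; apply HZ).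
  assert (MA0 : forall k, 0 <= M k * A) by (intros k; apply Rmult_le_pos; auto; lra).
  set (kappa := 32 * C * exp (16 * B ^ 2) * A).
  assert (Kp0 : 0 <= kappa) by (unfold kappa; repeat apply Rmult_le_pos; lra).
  assert (MD : forall k, M k * A * exp (growth a * INR (S k)) <= kappa * (/ 4) ^ k).
  { intros k; unfold M, kappa.
    replace (exp (growth a * INR (S k))) with ((B / 4) ^ S k).
    2: { unfold B; replace (4 * exp (growth a) / 4) with (exp (growth a)) by field.
         rewrite <- Rpower_pow by apply exp_pos; unfold Rpower; rewrite ln_exp; f_equal; ring. }
    unfold Rdiv; rewrite Rpow_mult_distr.
    replace (32 * C * exp (16 * B ^ 2) * / B ^ S k * A * (B ^ S k * (/ 4) ^ S k))
      with (kappa * (/ 4) ^ S k) by (unfold kappa; field; generalize (PB (S k)); lra).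
    fold kappa; apply Rmult_le_compat_l; [exact Kp0|].
    assert (0 < (/ 4) ^ k) by (apply pow_lt; lra); simpl; lra. }
  set (u := traj a Z 0 0 0).
  assert (Im1 : in_itv Ix (-1)) by (split; simpl; lra).
  assert (Sol : zk_solution a T (u (-1)) u)
    by exact (traj_zk_solution a T K kappa (fun k => M k * A) Z ha hT HK ZJ MA0 ZB MD Z0).
  exists (u (-1)); split.
  { exact (traj_control_gevrey2 a T K kappa (fun k => M k * A) Z ha hT HK ZJ MA0 ZB MD). }
  exists u; split; [exact Sol|].
  split; [intros v Hv; exact (zk_solution_unique a T (u (-1)) u v hT Sol Hv)|].
  split.
  { intros x y Hx Hy; rewrite (EP x y Hx Hy), (null_jets_sine_series a P HP C ha BP x y Hx Hy).
    apply Series_ext; intros k; unfold traj_mode, traj_term.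
    rewrite (Series_ext _ (fun i => ((-1) ^ i * coef P i 2 0 (S k) 0 * gen (lambda (S k) - a) i 0 x)
                                    * efun (S k) y)).
    2: { intros i; rewrite efun_jet_0, Nat.add_0_r, ZT; unfold b; ring. }
    rewrite Series_scal_r; f_equal; apply is_series_unique.
    (* For a fixed mode only the growth in n matters, so the decay estimate is used with B = 1. *)
    apply (iterated_ode_expansion (lambda (S k) - a) (fun n p => coef P n p 0 (S k))
             (32 * C * exp (16 * 1 ^ 2) / 1 ^ S k) L HL); auto.
    - apply Rdiv_le_0_compat; [|apply pow_lt; lra].
      apply Rmult_le_pos; [lra|left; apply exp_pos].
    - intros n; exact (coef_jet a P HP n 0 (S k)).
    - intros n z Hz; exact (coef_rec a P HP n (S k) z Hz).
    - intros n; exact (coef_0 a P HP n (S k)).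
    - intros n z Hz; rewrite <- (Rmult_1_l (Rabs (coef P n 0 0 (S k) z))).
      exact (coef_decay a P HP C ha BP 1 n 0 0 (S k) z ltac:(lia) ltac:(lia) ltac:(lia)
               ltac:(lra) ltac:(lia) Hz). }
  split; [exact (traj_gevrey3 a T K kappa (fun k => M k * A) Z ha hT HK ZJ MA0 ZB MD)|].
  exists (fun j => Z (pred j) O); split; [|split].
  - intros j _; exact (jet1_Cinf1 (0, T) (Z (pred j)) _ hT (ZJ (pred j)) (fun _ _ => eq_refl)).
  - intros x y t Hx Hy Ht.
    exact (traj_double_series a T K kappa (fun k => M k * A) Z ha hT HK ZJ MA0 ZB MD
             g x y t hg Hx Hy Ht).
  - intros y t Hy Ht.
    exact (traj_double_series a T K kappa (fun k => M k * A) Z ha hT HK ZJ MA0 ZB MD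
             g (-1) y t hg Im1 Hy Ht).
Qed.
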